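(* The Weighted Efficient Domination (WED) problem can be solved robustly in time $O(nm)$ on $P_5$-free graphs, where $n$ and $m$ denote the numbers of vertices and edges of the input graph.
   Context: All graphs are finite, undirected and simple. A vertex dominates itself and all its neighbors. A vertex set $D$ of a graph $G$ is an efficient dominating set (e.d.) if every vertex of $G$ is dominated by exactly one vertex of $D$. WED problem: given a graph $G=(V,E)$ and vertex weights $\omega:V\to\mathbb{N}$, find an e.d. of $G$ of minimum total weight, or determine that $G$ has no e.d. $P_k$ denotes the chordless (induced) path on $k$ vertices; a graph is $P_5$-free if it has no induced subgraph isomorphic to $P_5$. An algorithm for a problem on a graph class $\mathcal{C}$ is robust if it accepts an arbitrary graph as input and either solves the problem correctly or correctly determines that the input graph is not in $\mathcal{C}$. *)

(* Defs.v *)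
From mathcomp Require Import all_boot.
Set Implicit Arguments. Unset Strict Implicit. Unset Printing Implicit Defensive.

Section Graphs.
Variable n : nat.
Variable e : rel 'I_n.

Definition simple_graph : Prop := symmetric e /\ irreflexive e.

Definition dominates (v u : 'I_n) : bool := (v == u) || e v u.

Definition efficient_dominating (D : {set 'I_n}) : Prop :=
  forall u : 'I_n, #|[set v in D | dominates v u]| = 1.

Definition set_weight (w : 'I_n -> nat) (D : {set 'I_n}) : nat := \sum_(v in D) w v.

Definition min_weight_ed (w : 'I_n -> nat) (D : {set 'I_n}) : Prop :=
  efficient_dominating D /\
  forall D', efficient_dominating D' -> set_weight w D <= set_weight w D'.

Definition induced_P5 (f : 'I_5 -> 'I_n) : Prop :=
  injective f /\
  forall i j : 'I_5, e (f i) (f j) = ((i.+1 == j :> nat) || (j.+1 == i :> nat)).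

Definition P5_free : Prop := forall f : 'I_5 -> 'I_n, ~ induced_P5 f.

Definition num_edges : nat :=
  #|[set p : 'I_n * 'I_n | (p.1 < p.2)%N && e p.1 p.2]|.

Definition adj_list_of (adj : 'I_n -> seq 'I_n) : Prop :=
  forall i : 'I_n, uniq (adj i) /\ forall j : 'I_n, (j \in adj i) = e i j.
End Graphs.

Inductive instr : Type :=
| IConst of nat & nat
| IAdd of nat & nat & nat
| ISub of nat & nat & nat      (* ISub r a b   : M[r] := M[a] - M[b] (truncated) *)
| ILoad of nat & nat
| IStore of nat & nat
| IJz of nat & nat
| IHalt.

Definition memory := nat -> nat.
Definition upd (m : memory) (a v : nat) : memory := fun b => if b == a then v else m b.
Definition config := (nat * memory)%type.

(* one step; None = the machine has halted (IHalt or pc outside program) *)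
Definition step (p : seq instr) (c : config) : option config :=
  let: (pc, m) := c in
  match nth IHalt p pc with
  | IConst r k => Some (pc.+1, upd m r k)
  | IAdd r a b => Some (pc.+1, upd m r (m a + m b))
  | ISub r a b => Some (pc.+1, upd m r (m a - m b))
  | ILoad r a => Some (pc.+1, upd m r (m (m a)))
  | IStore a b => Some (pc.+1, upd m (m a) (m b))
  | IJz a l => Some (if m a == 0 then l else pc.+1, m)
  | IHalt => None
  end.

Fixpoint run (p : seq instr) (fuel : nat) (c : config) : option memory :=
  match step p c with
  | None => Some c.2
  | Some c' => if fuel is f.+1 then run p f c' else None
  end.

(* M[0] = n; M[1+i] = w(i); M[1+n+i] = start address of adjacency list of i;
   M[1+2n+i] = degree of i; from address 1+3n on: the adjacency lists of
   0,1,...,n-1 concatenated; all other cells 0. *)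
Definition vopt (n k : nat) : option 'I_n := insub k.

Definition adj_cells n (adj : 'I_n -> seq 'I_n) : seq nat :=
  flatten [seq map val (adj i) | i <- enum 'I_n].

Definition adj_start n (adj : 'I_n -> seq 'I_n) (i : 'I_n) : nat :=
  1 + 3 * n + sumn (map (fun j : 'I_n => size (adj j)) (filter (fun j : 'I_n => (j < i)%N) (enum 'I_n))).

Definition input_mem n (w : 'I_n -> nat) (adj : 'I_n -> seq 'I_n) : memory :=
  fun a =>
    if a == 0 then n
    else if a <= n then oapp w 0 (vopt n a.-1)
    else if a <= 2 * n then oapp (adj_start adj) 0 (vopt n (a.-1 - n))
    else if a <= 3 * n then oapp (fun i => size (adj i)) 0 (vopt n (a.-1 - 2 * n))
    else nth 0 (adj_cells adj) (a - (3 * n).+1).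

(* M[0] = 0 : "the input graph is not P5-free"
   M[0] = 1 : "the graph has no efficient dominating set"
   M[0] = 2 : D = { i | M[1+i] <> 0 } is a minimum-weight e.d. *)
Definition output_set n (out : memory) : {set 'I_n} := [set i : 'I_n | out i.+1 != 0].

(* Main.v *)
Require Import Defs.
From mathcomp Require Import all_boot.
From mathcomp Require Import zify.
Set Implicit Arguments. Unset Strict Implicit. Unset Printing Implicit Defensive.

(** Let [v] belong to an efficient dominating set [D], and let [N1], [N2], ... be the distance
levels of [v]. The vertices of [D] other than [v] avoid [N1] and [N2]. If [N4] is nonempty, or if
two adjacent vertices of [N3] have different neighbourhoods in [N2], then the graph has an induced
[P5]. Otherwise the vertices of [N3] with a given neighbourhood in [N2] contain at most one vertex
of [D], since they share a neighbour, and they have no neighbour in the other classes of [N3]; so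
this vertex of [D] is adjacent to all others in its class. Hence, if [v] is in an efficient
dominating set at all, a cheapest one in the component of [v] takes [v] and, in each class, a
cheapest vertex adjacent to the rest of the class. The classes are found by partition refinement.
Each [v] costs [O(n + m)], and an isolated [v] only [O(1)], which gives [O(n m + n)] in total.
A candidate is recorded at every vertex that [v] reaches, if it is cheaper than the candidate
recorded there; so the components need not be computed. *)

(** * The machine and a language of bounded loops *)

(** [P5]-freeness enters only through the two forbidden configurations, and both are looked for
    explicitly. If neither shows up, the exchange argument is valid in an arbitrary graph; this
    makes the algorithm robust. Whether [v] lies in an efficient dominating set is not tested
    beforehand: the candidate built from [v] is checked afterwards, and the exchange argument says
    that it passes whenever [v] does lie in one. Every component contains a vertex of each efficient
    dominating set, and weights add up over components, so trying all [v] attains the minimum.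

    The other obstacle is the machine. The program is fixed, while the input fills the memory from
    cell 0 on and the output must start there again. So registers have to be won from redundant
    input and given back at the end, and arrays of unknown length have to coexist. The algorithm is
    therefore written in a small language with counted loops only, where termination is automatic
    and running time is a sum over rounds, and it is compiled. *)

Fixpoint exec (p : seq instr) (k : nat) (c : config) : option config :=
  if k is k'.+1 then obind (exec p k') (step p c) else Some c.

Definition reach p T (c c' : config) : Prop := exists2 k, k <= T & exec p k c = Some c'.

Lemma exec_add p k l c c' c'' :
  exec p k c = Some c' -> exec p l c' = Some c'' -> exec p (k + l) c = Some c''.
Proof.
elim: k c => [|k IHk] c /=; first by case=> ->.
by case: (step p c) => //= c1; apply: IHk.
Qed.

Lemma reach_refl p c : reach p 0 c c. Proof. by exists 0. Qed.

Lemma reach_trans p T1 T2 c1 c2 c3 :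
  reach p T1 c1 c2 -> reach p T2 c2 c3 -> reach p (T1 + T2) c1 c3.
Proof.
case=> k1 le1 ex1 [k2 le2 ex2]; exists (k1 + k2); first exact: leq_add.
exact: exec_add ex1 ex2.
Qed.

Lemma reach_le p T1 T2 c1 c2 : T1 <= T2 -> reach p T1 c1 c2 -> reach p T2 c1 c2.
Proof. by move=> le12 [k lek ex]; exists k => //; apply: leq_trans le12. Qed.

Lemma reach_step p c c' : step p c = Some c' -> reach p 1 c c'.
Proof. by move=> st; exists 1 => //=; rewrite st. Qed.

(** Fuel beyond the halting time is harmless, so upper bounds on the number of steps suffice
    throughout. *)
Lemma reach_run p T c c' f :
  reach p T c c' -> step p c' = None -> T <= f -> run p f c = Some c'.2.
Proof.
case=> k lek ex halt leT; have {lek leT T}: k <= f by exact: leq_trans lek leT.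
elim: k f c ex => [|k IHk] f c /= => [[->]|].
  by case: f => [|f] _ /=; rewrite halt.
by case: f => [|f] //=; case: (step p c) => //= c1 ex lekf; apply: IHk.
Qed.

Fixpoint code_at (p : seq instr) (pos : nat) (c : seq instr) : Prop :=
  if c is i :: c' then nth IHalt p pos = i /\ code_at p pos.+1 c' else True.

Lemma code_at_cat p pos c1 c2 :
  code_at p pos (c1 ++ c2) <-> code_at p pos c1 /\ code_at p (pos + size c1) c2.
Proof.
elim: c1 pos => [|i c1 IH] pos /=; first by rewrite addn0; split=> [|[]].
by rewrite IH addSnnS; split=> [[? []]|[[]]].
Qed.

Lemma code_at_mid pre c post : code_at (pre ++ c ++ post) (size pre) c.
Proof.
elim: c pre => [|i c IH] pre //=; split; first by rewrite nth_cat ltnn subnn.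
by have := IH (rcons pre i); rewrite size_rcons cat_rcons.
Qed.

Lemma reach_const p T pos m c r k : nth IHalt p pos = IConst r k ->
  reach p T (pos.+1, upd m r k) c -> reach p T.+1 (pos, m) c.
Proof. by move=> E; apply: (@reach_trans p 1 T); apply: reach_step; rewrite /= E. Qed.

Lemma reach_add p T pos m c r a b : nth IHalt p pos = IAdd r a b ->
  reach p T (pos.+1, upd m r (m a + m b)) c -> reach p T.+1 (pos, m) c.
Proof. by move=> E; apply: (@reach_trans p 1 T); apply: reach_step; rewrite /= E. Qed.

Lemma reach_sub p T pos m c r a b : nth IHalt p pos = ISub r a b ->
  reach p T (pos.+1, upd m r (m a - m b)) c -> reach p T.+1 (pos, m) c.
Proof. by move=> E; apply: (@reach_trans p 1 T); apply: reach_step; rewrite /= E. Qed.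

Lemma reach_load p T pos m c r a : nth IHalt p pos = ILoad r a ->
  reach p T (pos.+1, upd m r (m (m a))) c -> reach p T.+1 (pos, m) c.
Proof. by move=> E; apply: (@reach_trans p 1 T); apply: reach_step; rewrite /= E. Qed.

Lemma reach_store p T pos m c a b : nth IHalt p pos = IStore a b ->
  reach p T (pos.+1, upd m (m a) (m b)) c -> reach p T.+1 (pos, m) c.
Proof. by move=> E; apply: (@reach_trans p 1 T); apply: reach_step; rewrite /= E. Qed.

Lemma reach_jz p T pos m c a l : nth IHalt p pos = IJz a l ->
  reach p T (if m a == 0 then l else pos.+1, m) c -> reach p T.+1 (pos, m) c.
Proof. by move=> E; apply: (@reach_trans p 1 T); apply: reach_step; rewrite /= E. Qed.

(** * A language with counted loops and its compilation *)

Inductive exp : Type :=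
| Cst of nat | Var of nat | Add of exp & exp | Sub of exp & exp | Arr of nat & exp.

Inductive cmd : Type :=
| Skip
| Asg of nat & exp
| Wr of nat & exp & exp
| Seq of cmd & cmd
| If of exp & cmd & cmd
| For of nat & exp & cmd.

Record st := St { vr : nat -> nat; ar : nat -> nat -> nat }.

Lemma nat_eqbP x y : reflect (x = y) (Nat.eqb x y).
Proof.
by apply: (iffP idP) => [|->]; [elim: x y => [|x IH] [|y] //= /IH->|elim: y].
Qed.

(** Names are compared with [Nat.eqb], so that accesses to literal names compute; array indices are
    symbolic and are compared with [==]. *)
Definition setv s x v := St (fun y => if Nat.eqb y x then v else vr s y) (ar s).
Definition seta s a i v :=
  St (vr s) (fun b j => if Nat.eqb b a then if j == i then v else ar s b j else ar s b j).

Fixpoint eval (e : exp) (s : st) : nat :=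
  match e with
  | Cst k => k
  | Var x => vr s x
  | Add a b => eval a s + eval b s
  | Sub a b => eval a s - eval b s
  | Arr a i => ar s a (eval i s)
  end.

Fixpoint loop (n : nat) (f : nat -> st -> st) (s : st) : st :=
  if n is n'.+1 then f n' (loop n' f s) else s.

Fixpoint exe (c : cmd) (s : st) : st :=
  match c with
  | Skip => s
  | Asg x e => setv s x (eval e s)
  | Wr a i e => seta s a (eval i s) (eval e s)
  | Seq c1 c2 => exe c2 (exe c1 s)
  | If e c1 c2 => if eval e s == 0 then exe c2 s else exe c1 s
  | For x e c => loop (eval e s) (fun i s => exe c (setv s x i)) s
  end.

(* Cells 0, 1, 2 hold the constants 0 and 1 and the base address of the arrays; then come 8
   temporaries, a counter and an index for each of 5 nested loops, and 43 variables. *)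
Definition cT t := 3 + t.
Definition cH d := 11 + d.*2.
Definition cG d := 12 + d.*2.
Definition cV x := 21 + x.

(* Entry [i] of array [a < 2 ^ k] is at distance [i * 2 ^ k + a] from the base: the arrays are
   interleaved, so that they are all unbounded. *)
Section Compiler.
Variable k : nat.

(** There is no multiplication instruction, so the factor [2 ^ k] comes from [k] doublings.
    Temporary [t.+1] is overwritten. *)
Definition caddr a t : seq instr :=
  nseq k (IAdd (cT t) (cT t) (cT t)) ++
  [:: IAdd (cT t) (cT t) 2; IConst (cT t.+1) a; IAdd (cT t) (cT t) (cT t.+1)].

(** The temporaries form an evaluation stack: the value ends up in temporary [t] and lower ones
    survive. Adding cell 0, which holds 0, is a move. *)
Fixpoint cexp (e : exp) (t : nat) : seq instr :=
  match e with
  | Cst c => [:: IConst (cT t) c]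
  | Var x => [:: IAdd (cT t) (cV x) 0]
  | Add a b => cexp a t ++ cexp b t.+1 ++ [:: IAdd (cT t) (cT t) (cT t.+1)]
  | Sub a b => cexp a t ++ cexp b t.+1 ++ [:: ISub (cT t) (cT t) (cT t.+1)]
  | Arr a i => cexp i t ++ caddr a t ++ [:: ILoad (cT t) (cT t)]
  end.

(** Jump targets are absolute, hence [pos]; the loop depth [d] selects the counter cells. [IJz 0]
    always jumps. The loop variable is reloaded from a hidden index in each round, so a body that
    overwrites it does not change the number of rounds. *)
Fixpoint ccmd (c : cmd) (d pos : nat) : seq instr :=
  match c with
  | Skip => [::]
  | Asg x e => cexp e 0 ++ [:: IAdd (cV x) (cT 0) 0]
  | Wr a i e => cexp i 0 ++ caddr a 0 ++ cexp e 1 ++ [:: IStore (cT 0) (cT 1)]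
  | Seq c1 c2 => let p1 := ccmd c1 d pos in p1 ++ ccmd c2 d (pos + size p1)
  | If e c1 c2 =>
      let pe := cexp e 0 in
      let q1 := (pos + size pe).+1 in
      let p1 := ccmd c1 d q1 in
      let q2 := (q1 + size p1).+1 in
      let p2 := ccmd c2 d q2 in
      pe ++ [:: IJz (cT 0) q2] ++ p1 ++ [:: IJz 0 (q2 + size p2)] ++ p2
  | For x e c =>
      let pe := cexp e 0 in
      let q1 := (pos + size pe).+2 in
      let p1 := ccmd c d.+1 q1.+2 in
      pe ++ [:: IAdd (cH d) (cT 0) 0; IConst (cG d) 0] ++
      [:: IJz (cH d) (q1.+2 + size p1).+3; IAdd (cV x) (cG d) 0] ++ p1 ++
      [:: IAdd (cG d) (cG d) 1; ISub (cH d) (cH d) 1; IJz 0 q1]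
  end.

Fixpoint wfe (e : exp) (t : nat) : bool :=
  match e with
  | Cst c => t < 8
  | Var x => (t < 8) && (x < 43)
  | Add a b | Sub a b => wfe a t && wfe b t.+1
  | Arr a i => [&& wfe i t, t.+1 < 8 & a < 2 ^ k]
  end.

Fixpoint wfc (c : cmd) (d : nat) : bool :=
  match c with
  | Skip => true
  | Asg x e => (x < 43) && wfe e 0
  | Wr a i e => [&& a < 2 ^ k, wfe i 0 & wfe e 1]
  | Seq c1 c2 => wfc c1 d && wfc c2 d
  | If e c1 c2 => [&& wfe e 0, wfc c1 d & wfc c2 d]
  | For x e c => [&& x < 43, d < 5, wfe e 0 & wfc c d.+1]
  end.

(** In [If], 2 counts the test and the jump over the other branch. In [For], 3 counts two
    initialisations and the final test, and 5 counts test, copy of the index, two counter updates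
    and the jump back. *)
Fixpoint tcmd (c : cmd) (s : st) : nat :=
  match c with
  | Skip => 0
  | Asg x e => size (cexp e 0) + 1
  | Wr a i e => size (cexp i 0) + (k + 3) + size (cexp e 1) + 1
  | Seq c1 c2 => tcmd c1 s + tcmd c2 (exe c1 s)
  | If e c1 c2 =>
      size (cexp e 0) + 2 + (if eval e s == 0 then tcmd c2 s else tcmd c1 s)
  | For x e c =>
      size (cexp e 0) + 3 +
      \sum_(i < eval e s)
        (tcmd c (setv (loop i (fun i s => exe c (setv s x i)) s) x i) + 5)
  end.

(** * Correctness of the compiler *)

Variable B : nat.
Hypothesis geB : 64 <= B.

(** Cells 3 to 20, the temporaries and loop counters, are left unconstrained, so that evaluating an
    expression preserves the representation. *)
Record repr (s : st) (m : memory) : Prop := Repr {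
  repr0 : m 0 = 0;
  repr1 : m 1 = 1;
  reprB : m 2 = B;
  reprV : forall x, x < 43 -> m (cV x) = vr s x;
  reprA : forall a i, a < 2 ^ k -> m (B + i * 2 ^ k + a) = ar s a i }.

Lemma repr_frame s m m' :
  (forall c, ~~ (3 <= c < 21) -> m' c = m c) -> repr s m -> repr s m'.
Proof.
move=> E [r0 r1 rB rV rA]; split; rewrite ?E //.
- by move=> x ltx; rewrite E ?rV // /cV; lia.
- by move=> a i lta; rewrite E ?rA //; lia.
Qed.

Variable p : seq instr.

Lemma upd_eq m a v : upd m a v a = v. Proof. by rewrite /upd eqxx. Qed.
Lemma upd_neq m a v b : b != a -> upd m a v b = m b.
Proof. by rewrite /upd => /negbTE->. Qed.

Definition same_but (P : pred nat) (m m' : memory) := forall c, ~~ P c -> m' c = m c.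

Lemma same_but_trans P m1 m2 m3 : same_but P m1 m2 -> same_but P m2 m3 -> same_but P m1 m3.
Proof. by move=> E1 E2 c nP; rewrite E2 ?E1. Qed.

Lemma same_but_upd (P : pred nat) m m' a v :
  P a -> same_but P m m' -> same_but P m (upd m' a v).
Proof.
by move=> Pa E c nP; rewrite upd_neq ?E //; apply: contraNneq nP => ->.
Qed.

Lemma same_but_sub (P Q : pred nat) m m' :
  (forall c, P c -> Q c) -> same_but P m m' -> same_but Q m m'.
Proof. by move=> PQ E c nQ; apply: E; apply: contra nQ; apply: PQ. Qed.

Lemma nseq_dblP t j pos m : code_at p pos (nseq j (IAdd (cT t) (cT t) (cT t))) ->
  exists m', [/\ reach p j (pos, m) (pos + j, m'), m' (cT t) = m (cT t) * 2 ^ j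
             & same_but (pred1 (cT t)) m m'].
Proof.
elim: j pos m => [|j IH] pos m /=.
  by move=> _; exists m; rewrite addn0 muln1; split=> //; apply: reach_refl.
case=> Ei /IH{IH} IH.
case: (IH (upd m (cT t) (m (cT t) + m (cT t)))) => m' [rm' Em' sm'].
exists m'; split.
- by apply: (reach_add Ei); rewrite -addSnnS.
- by rewrite Em' upd_eq expnS; lia.
- apply: same_but_trans sm'; apply: same_but_upd => //; exact: eqxx.
Qed.

Lemma size_caddr a t : size (caddr a t) = k + 3.
Proof. by rewrite size_cat size_nseq. Qed.

Lemma caddrP a t pos m : t.+1 < 8 -> m 2 = B -> code_at p pos (caddr a t) ->
  exists m', [/\ reach p (k + 3) (pos, m) (pos + (k + 3), m'),
     m' (cT t) = B + m (cT t) * 2 ^ k + a & same_but (fun c => 3 + t <= c < 11) m m'].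
Proof.
move=> lt8 m2 /code_at_cat[/(@nseq_dblP _ _ _ m) [m1 [r1 E1 s1]]].
rewrite size_nseq /= => -[I1 [I2 [I3 _]]].
exists (upd (upd (upd m1 (cT t) (m1 (cT t) + m1 2)) (cT t.+1) a) (cT t)
         (B + m (cT t) * 2 ^ k + a)); split.
- apply: (reach_trans r1).
  apply: (reach_add I1); apply: (reach_const I2); apply: (reach_add I3).
  rewrite upd_neq ?upd_eq; last by rewrite /cT; lia.
  rewrite E1 s1; last by rewrite /= /cT; lia.
  rewrite m2 [_ + B]addnC -!addSn !addnS addn0; exact: reach_refl.
- by rewrite upd_eq.
- do 3!(apply: same_but_upd; first by rewrite /cT; lia).
  by apply: same_but_sub s1 => c /eqP->; rewrite /cT; lia.
Qed.

Lemma wfe_lt e t : wfe e t -> t < 8.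
Proof. by elim: e t => /= [c|x|a IH b _|a IH b _|a i IH] t //= => [/andP[]|/andP[/IH]|/andP[/IH]|/andP[/IH]]. Qed.

Lemma cexpP s e t pos m : repr s m -> wfe e t -> code_at p pos (cexp e t) ->
  exists m', [/\ reach p (size (cexp e t)) (pos, m) (pos + size (cexp e t), m'),
     m' (cT t) = eval e s & same_but (fun c => 3 + t <= c < 11) m m'].
Proof.
(* [Add] and [Sub] share one argument: the first operand is safe in temporary [u] because the second
   is evaluated from [u.+1] on. *)
have binop o (f : nat -> nat -> nat) a b u :
    (forall pos m c, nth IHalt p pos = o ->
       reach p 0 (pos.+1, upd m (cT u) (f (m (cT u)) (m (cT u.+1)))) c ->
       reach p 1 (pos, m) c) ->
    (forall pos m, repr s m -> wfe a u -> code_at p pos (cexp a u) ->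
      exists m', [/\ reach p (size (cexp a u)) (pos, m) (pos + size (cexp a u), m'),
        m' (cT u) = eval a s & same_but (fun c => 3 + u <= c < 11) m m']) ->
    (forall pos m, repr s m -> wfe b u.+1 -> code_at p pos (cexp b u.+1) ->
      exists m', [/\ reach p (size (cexp b u.+1)) (pos, m) (pos + size (cexp b u.+1), m'),
        m' (cT u.+1) = eval b s & same_but (fun c => 3 + u.+1 <= c < 11) m m']) ->
    forall pos m, repr s m -> wfe a u && wfe b u.+1 ->
    let C := cexp a u ++ cexp b u.+1 ++ [:: o] in code_at p pos C ->
    exists m', [/\ reach p (size C) (pos, m) (pos + size C, m'),
     m' (cT u) = f (eval a s) (eval b s) & same_but (fun c => 3 + u <= c < 11) m m'].
  move=> Hs IHa IHb {}pos {}m rm /andP[wa wb] C.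
  case/code_at_cat=> ca /code_at_cat[cb /= [I _]].
  have ltu := wfe_lt wa.
  case: (IHa _ _ rm wa ca) => m1 [r1 E1 s1].
  have rm1: repr s m1 by apply: repr_frame rm => c nc; apply: s1; lia.
  case: (IHb _ _ rm1 wb cb) => m2 [r2 E2 s2].
  exists (upd m2 (cT u) (f (eval a s) (eval b s))); rewrite upd_eq; split=> //.
    rewrite !size_cat /= !addnA; apply: reach_trans (reach_trans r1 r2) _.
    apply: Hs I _; rewrite addn1 E2 s2 ?E1; first exact: reach_refl.
    by rewrite /cT; lia.
  apply: same_but_upd; first by rewrite /cT; lia.
  by apply: (same_but_trans s1); apply: same_but_sub s2 => c; lia.
elim: e t pos m => [c|x|a IHa b IHb|a IHa b IHb|a i IHi] t pos m rm.
- move=> /= lt8 [I _]; exists (upd m (cT t) c); rewrite upd_eq; split=> //.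
    by apply: (reach_const I); rewrite addn1; apply: reach_refl.
  by apply: same_but_upd => //; rewrite /cT; lia.
- case/andP=> /= lt8 ltx [I _]; exists (upd m (cT t) (vr s x)); rewrite upd_eq; split=> //.
    apply: (reach_add I); rewrite (reprV rm) // (repr0 rm) addn0 addn1.
    exact: reach_refl.
  by apply: same_but_upd => //; rewrite /cT; lia.
- apply: (@binop (IAdd (cT t) (cT t) (cT t.+1)) addn) => // [? ? ? I R|? ?|? ?].
  + exact: (reach_add I R).
  + exact: IHa.
  + exact: IHb.
- apply: (@binop (ISub (cT t) (cT t) (cT t.+1)) subn) => // [? ? ? I R|? ?|? ?].
  + exact: (reach_sub I R).
  + exact: IHa.
  + exact: IHb.
- case/and3P=> wi lt8 lta /code_at_cat[ci /code_at_cat[ca /= [I _]]].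
  case: (IHi _ _ _ rm wi ci) => m1 [r1 E1 s1].
  have rm1: repr s m1 by apply: repr_frame rm => c nc; apply: s1; lia.
  case: (caddrP lt8 (reprB rm1) ca) => m2 [r2 E2 s2].
  have rm2: repr s m2 by apply: repr_frame rm1 => c nc; apply: s2; lia.
  rewrite size_caddr in I.
  exists (upd m2 (cT t) (ar s a (eval i s))); rewrite upd_eq; split=> //=.
    rewrite 2!size_cat size_caddr !addnA; rewrite !addnA in r2 I.
    have := reach_trans r1 r2; rewrite !addnA => r12; apply: (reach_trans r12).
    apply: (reach_load I); rewrite E2 E1 (reprA rm2) // addn1; exact: reach_refl.
  apply: same_but_upd; first by rewrite /cT; lia.
  by apply: (same_but_trans s1).
Qed.

Lemma repr_setv s m x v : x < 43 -> repr s m -> repr (setv s x v) (upd m (cV x) v).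
Proof.
move=> ltx [r0 r1 rB rV rA]; split=> [||||a i lta]; rewrite ?upd_neq //.
- move=> y lty /=; case: nat_eqbP => [->|ne]; first by rewrite upd_eq.
  by rewrite upd_neq ?rV // /cV; lia.
- by rewrite rA.
- by rewrite /cV; lia.
Qed.

Lemma repr_seta s m a i v : a < 2 ^ k -> repr s m ->
  repr (seta s a i v) (upd m (B + i * 2 ^ k + a) v).
Proof.
move=> lta [r0 r1 rB rV rA]; split=> [||||b j ltb].
- by rewrite upd_neq //; lia.
- by rewrite upd_neq //; lia.
- by rewrite upd_neq //; lia.
- by move=> y lty /=; rewrite upd_neq ?rV // /cV; lia.
- rewrite /= /upd; have k0: 0 < 2 ^ k by rewrite expn_gt0.
  (* Quotient and remainder by [2 ^ k] recover index and array from an address, so distinct entries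
     never collide. *)
  have -> : (B + j * 2 ^ k + b == B + i * 2 ^ k + a) = (j == i) && (b == a).
    rewrite -!addnA eqn_add2l; apply/eqP/andP=> [E|[/eqP-> /eqP->]//].
    have := congr1 (modn^~ (2 ^ k)) E; have := congr1 (divn^~ (2 ^ k)) E.
    by rewrite /= !divnMDl // !modnMDl !divn_small // !modn_small // !addn0 => -> ->.
  case: nat_eqbP => [->|/eqP/negbTE ->]; rewrite ?eqxx ?andbF ?andbT rA //.
Qed.

(** The last clause protects the counters of the enclosing loops; applied to a body at depth [d.+1],
    it keeps the two counters of the loop itself. *)
Lemma ccmdP c s d pos m : d <= 5 -> repr s m -> wfc c d -> code_at p pos (ccmd c d pos) ->
  exists m', [/\ reach p (tcmd c s) (pos, m) (pos + size (ccmd c d pos), m'),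
     repr (exe c s) m' & forall b, 11 <= b < 11 + d.*2 -> m' b = m b].
Proof.
elim: c s d pos m => [|x e|a i e|c1 IH1 c2 IH2|e c1 IH1 c2 IH2|x e c IHc] s d pos m led rm.
- by exists m; split=> //=; rewrite addn0; apply: reach_refl.
- case/andP=> ltx we /code_at_cat[ce /= [I _]].
  case: (cexpP rm we ce) => m1 [r1 E1 s1].
  have rm1: repr s m1 by apply: repr_frame rm => b nb; apply: s1; lia.
  exists (upd m1 (cV x) (eval e s)); split.
  + rewrite size_cat /= addnA; apply: (reach_trans r1); apply: (reach_add I).
    by rewrite E1 (repr0 rm1) addn0 addn1; apply: reach_refl.
  + exact: repr_setv.
  + by move=> b ltb; rewrite upd_neq ?s1 //; rewrite /cV; lia.
- case/and3P=> lta wi we /code_at_cat[ci /code_at_cat[ca /code_at_cat[ce /= [I _]]]].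
  case: (cexpP rm wi ci) => m1 [r1 E1 s1].
  have rm1: repr s m1 by apply: repr_frame rm => b nb; apply: s1; lia.
  case: (@caddrP a 0 _ _ isT (reprB rm1) ca) => m2 [r2 E2 s2].
  have rm2: repr s m2 by apply: repr_frame rm1 => b nb; apply: s2; lia.
  case: (cexpP rm2 we ce) => m3 [r3 E3 s3].
  have rm3: repr s m3 by apply: repr_frame rm2 => b nb; apply: s3; lia.
  exists (upd m3 (B + eval i s * 2 ^ k + a) (eval e s)); split.
  + rewrite size_cat; have -> : size (caddr a 0 ++ cexp e 1 ++ [:: IStore (cT 0) (cT 1)]) =
      k + 3 + size (cexp e 1) + 1 by rewrite size_cat size_caddr size_cat /= addnA.
    rewrite !size_caddr !addnA in r2 r3 I *.
    have := reach_trans r1 (reach_trans r2 r3); rewrite !addnA => r; apply: (reach_trans r).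
    apply: (reach_store I); rewrite E3 s3 // E2 E1 // addn1; exact: reach_refl.
  + exact: repr_seta.
  + move=> b ltb; rewrite upd_neq ?s3 ?s2 ?s1 //; lia.
- case/andP=> w1 w2 /code_at_cat[k1 k2].
  case: (IH1 _ _ _ _ led rm w1 k1) => m1 [r1 rm1 s1].
  case: (IH2 _ _ _ _ led rm1 w2 k2) => m2 [r2 rm2 s2].
  exists m2; split=> //.
  + by rewrite size_cat addnA; apply: reach_trans r1 r2.
  + by move=> b ltb; rewrite s2 ?s1.
- case/and3P=> we w1 w2; rewrite [ccmd (If _ _ _) _ _]/= => /code_at_cat[ke [I1 /code_at_cat[k1 [I2 k2]]]].
  case: (cexpP rm we ke) => m1 [r1 E1 s1].
  have rm1: repr s m1 by apply: repr_frame rm => b nb; apply: s1; lia.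
  rewrite [tcmd _ _]/= [exe _ _]/= -addnA; case: eqP => E.
    case: (IH2 _ _ _ _ led rm1 w2 k2) => m2 [r2 rm2 s2].
    exists m2; split=> // [|b ltb]; last by rewrite s2 // s1 //; lia.
    apply: (reach_trans r1); rewrite addSn; apply: (reach_jz I1); rewrite E1 E eqxx.
    apply: reach_le (leqW (leqnn _)) _.
    rewrite !size_cat /= size_cat /=.
    set q := (X in reach _ _ _ (X, _)); set q' := (X in reach _ _ _ (X, _)) in r2.
    by have -> : q = q' by rewrite /q /q'; lia.
  case: (IH1 _ _ _ _ led rm1 w1 k1) => m2 [r2 rm2 s2].
  exists m2; split=> // [|b ltb]; last by rewrite s2 // s1 //; lia.
  apply: (reach_trans r1); rewrite addSn; apply: (reach_jz I1); rewrite E1 (introF eqP E).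
  rewrite addnC; apply: (reach_trans r2); apply: (reach_jz I2); rewrite (repr0 rm2) /=.
  rewrite !size_cat /= size_cat /=.
  set q := (X in reach _ _ (X, _)); set q' := (X in reach _ _ _ (X, _)).
  have -> : q = q' by rewrite /q /q'; lia.
  exact: reach_refl.
- case/and4P=> ltx ltd we wc; rewrite [ccmd (For _ _ _) _ _]/= => /code_at_cat[ke [I1 [I2 [I3 [I4 /code_at_cat[kc [I5 [I6 [I7 _]]]]]]]]].
  case: (cexpP rm we ke) => m1 [r1 E1 s1].
  have rm1: repr s m1 by apply: repr_frame rm => b nb; apply: s1; lia.
  rewrite [tcmd _ _]/= [exe _ _]/=.
  set q := (pos + size (cexp e 0)) in I1 I2 I3 I4 kc I5 I6 I7 r1 *.
  set N := eval e s in E1 *.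
  set body := fun i s0 => exe c (setv s0 x i).
  pose m2 := upd (upd m1 (cH d) N) (cG d) 0.
  pose tb i := tcmd c (setv (loop i body s) x i) + 5.
  (* One counter runs down to stop the loop, the other runs up to supply the loop variable. *)
  have inv i : i <= N -> exists m', [/\ reach p (\sum_(j < i) tb j) (q.+2, m2) (q.+2, m'),
      repr (loop i body s) m', m' (cH d) = N - i, m' (cG d) = i &
      forall b, 11 <= b < 11 + d.*2 -> m' b = m b].
    elim: i => [|i IHi] leiN.
      exists m2; rewrite big_ord0; split.
      - exact: reach_refl.
      - by apply: repr_frame rm1 => b nb; rewrite /m2 !upd_neq // /cH /cG; lia.
      - by rewrite /m2 upd_neq ?upd_eq ?subn0 // /cH /cG; lia.
      - by rewrite /m2 upd_eq.
      - by move=> b ltb; rewrite /m2 !upd_neq ?s1 // /cH /cG; lia.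
    case: (IHi (ltnW leiN)) => m3 [r3 rm3 H3 G3 s3].
    have rm4 := repr_setv i ltx rm3.
    case: (IHc _ _ _ _ ltd rm4 wc kc) => m5 [r5 rm5 s5].
    have cHx : cH d != cV x by rewrite /cH /cV; lia.
    have cGx : cG d != cV x by rewrite /cG /cV; lia.
    have H5 : m5 (cH d) = N - i by rewrite s5 ?upd_neq // /cH; lia.
    have G5 : m5 (cG d) = i by rewrite s5 ?upd_neq // /cG; lia.
    pose m6 := upd (upd m5 (cG d) i.+1) (cH d) (N - i.+1).
    exists m6; split.
    - rewrite big_ord_recr /=; apply: (reach_trans r3).
      rewrite /tb addnC !addSn add0n; apply: (reach_jz I3).
      have -> : m3 (cH d) == 0 = false by rewrite H3; lia.
      apply: (reach_add I4); rewrite G3 (repr0 rm3) addn0 -addn3.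
      apply: (reach_trans r5).
      apply: (reach_add I5); rewrite G5 (repr1 rm5) addn1.
      apply: (reach_sub I6); rewrite !upd_neq ?(repr1 rm5) ?H5 //; last by rewrite /cH /cG; lia.
      apply: (reach_jz I7); rewrite !upd_neq ?(repr0 rm5) //=.
      rewrite -subnDA addn1; exact: reach_refl.
    - by apply: repr_frame rm5 => b nb; rewrite /m6 !upd_neq // /cH /cG; lia.
    - by rewrite /m6 upd_eq.
    - by rewrite /m6 upd_neq ?upd_eq // /cH /cG; lia.
    - move=> b ltb; rewrite /m6 !upd_neq ?s5 ?upd_neq ?s3 // /cH /cG /cV; lia.
  case: (inv N (leqnn _)) => m7 [r7 rm7 H7 G7 s7].
  exists m7; split=> //.
  rewrite -/N -/body -/(tb _).
  have -> : size (cexp e 0) + 3 + \sum_(i < N) tb i = size (cexp e 0) + (2 + (\sum_(i < N) tb i + 1)) by lia.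
  apply: (reach_trans r1); apply: reach_trans.
    apply: (reach_add I1); rewrite E1 (repr0 rm1) addn0; apply: (reach_const I2); exact: reach_refl.
  apply: (reach_trans r7); apply: (reach_jz I3); rewrite H7 subnn /=.
  rewrite size_cat /= size_cat /=.
  set q1 := (X in reach _ _ (X, _)); set q2 := (X in reach _ _ _ (X, _)).
  have -> : q1 = q2 by rewrite /q1 /q2 /q; lia.
  exact: reach_refl.
Qed.
End Compiler.

(** * Frames, induction and running times of loops *)

(** A syntactic over-approximation of the variables written, so that frame conditions hold by
    computation. *)
Fixpoint wv (c : cmd) (x : nat) : bool :=
  match c with
  | Skip | Wr _ _ _ => false
  | Asg y _ => Nat.eqb x y
  | Seq c1 c2 | If _ c1 c2 => wv c1 x || wv c2 x
  | For y _ c => Nat.eqb x y || wv c x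
  end.

Fixpoint wa (c : cmd) (a : nat) : bool :=
  match c with
  | Skip | Asg _ _ => false
  | Wr b _ _ => Nat.eqb a b
  | Seq c1 c2 | If _ c1 c2 => wa c1 a || wa c2 a
  | For _ _ c => wa c a
  end.

Definition same (c : cmd) (s s' : st) : Prop :=
  (forall x, ~~ wv c x -> vr s' x = vr s x) /\ (forall a, ~~ wa c a -> ar s' a = ar s a).

Lemma same_trans c s1 s2 s3 : same c s1 s2 -> same c s2 s3 -> same c s1 s3.
Proof. by move=> [v1 a1] [v2 a2]; split=> x nx; rewrite ?v2 ?v1 ?a2 ?a1. Qed.

Lemma same_sub c c' s s' : (forall x, wv c x -> wv c' x) -> (forall a, wa c a -> wa c' a) ->
  same c s s' -> same c' s s'.
Proof.
move=> Sv Sa [V A]; split=> x nx; [apply: V|apply: A].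
  by apply: contra nx; apply: Sv.
by apply: contra nx; apply: Sa.
Qed.

Lemma loop_ind (P : nat -> st -> Prop) n f s :
  P 0 s -> (forall i s', i < n -> P i s' -> P i.+1 (f i s')) -> P n (loop n f s).
Proof.
elim: n => [|n IH] //= P0 PS; apply: (PS) => //; apply: IH => // i s' ltin.
by apply: PS; apply: leqW.
Qed.

Lemma exe_same c s : same c s (exe c s).
Proof.
elim: c s => [|x e|a i e|c1 IH1 c2 IH2|e c1 IH1 c2 IH2|x e c IH] s //=.
- by split=> y //=; case: nat_eqbP.
- by split=> b //=; case: nat_eqbP.
- apply: same_trans (same_sub _ _ (IH1 s)) (same_sub _ _ (IH2 _)) => y /= ->; rewrite ?orbT //.
- case: ifP => _; [apply: same_sub (IH2 _)|apply: same_sub (IH1 _)] => y /= ->; rewrite ?orbT //.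
- apply: (@loop_ind (fun _ s' => same (For x e c) s s')) => // i s' _ H.
  apply: (same_trans H); apply: (@same_trans _ _ (setv s' x i)).
    by split=> y //=; case: nat_eqbP.
  by apply: same_sub (IH _) => y //= ->; rewrite orbT.
Qed.

Lemma exe_vr c x s : ~~ wv c x -> vr (exe c s) x = vr s x.
Proof. by case: (exe_same c s) => H _; apply: H. Qed.

Lemma exe_ar c a s : ~~ wa c a -> ar (exe c s) a = ar s a.
Proof. by case: (exe_same c s) => _; apply. Qed.

Lemma For_ind x e c (P : nat -> st -> Prop) s :
  P 0 s ->
  (forall i s', i < eval e s -> same (For x e c) s s' -> P i s' -> P i.+1 (exe c (setv s' x i))) ->
  P (eval e s) (exe (For x e c) s).
Proof.
move=> P0 PS; rewrite /=.
pose Q i s' := same (For x e c) s s' /\ P i s'.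
suff: Q (eval e s) (exe (For x e c) s) by case.
apply: loop_ind => // i s' lti [S Pi]; split; last exact: PS.
apply: (same_trans S); apply: (@same_trans _ _ (setv s' x i)).
  by split=> y //=; case: nat_eqbP.
by apply: same_sub (exe_same _ _) => y //= ->; rewrite orbT.
Qed.

Lemma tcmd_For k x e c s (b : nat -> nat) :
  (forall i s', i < eval e s -> same (For x e c) s s' -> tcmd k c (setv s' x i) <= b i) ->
  tcmd k (For x e c) s <= size (cexp k e 0) + 3 + \sum_(i < eval e s) (b i + 5).
Proof.
move=> H /=; rewrite leq_add2l; apply: leq_sum => i _; rewrite leq_add2r; apply: H => //.
apply: (@loop_ind (fun _ s' => same (For x e c) s s')) => // j s' _ S.
apply: (same_trans S); apply: (@same_trans _ _ (setv s' x j)).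
  by split=> y //=; case: nat_eqbP.
by apply: same_sub (exe_same _ _) => y //= ->; rewrite orbT.
Qed.

(** * Loops over vertices and neighbours, and syntactic cost bounds *)

Local Notation vN := 0 (only parsing).
Local Notation vV := 1 (only parsing).
Local Notation vU := 2 (only parsing).
Local Notation vP := 3 (only parsing).
Local Notation vY := 4 (only parsing).
Local Notation aW := 0 (only parsing).
Local Notation aS := 1 (only parsing).
Local Notation aD := 2 (only parsing).
Local Notation aA := 3 (only parsing).

Definition ForV (c : cmd) : cmd := For vU (Var vN) c.
Definition ForN (c : cmd) : cmd :=
  For vP (Arr aD (Var vU)) (Seq (Asg vY (Arr aA (Add (Arr aS (Var vU)) (Var vP)))) c).

Definition keeps (c : cmd) : bool :=
  all (fun x => ~~ wv c x) [:: vN; vU; vP] && all (fun a => ~~ wa c a) [:: aW; aS; aD; aA].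

Definition pres (c : cmd) : bool :=
  ~~ wv c vN && all (fun a => ~~ wa c a) [:: aW; aS; aD; aA].

Lemma pres_seq c1 c2 : pres (Seq c1 c2) = pres c1 && pres c2.
Proof.
rewrite /pres /= !negb_or; case: (wv c1 0) => //=; rewrite ?andbF //.
case: (wv c2 0); rewrite ?andbF //=.
by case: (wa c1 0); case: (wa c1 1); case: (wa c1 2); case: (wa c1 3); rewrite ?andbF.
Qed.

Section Graph.
Variables (n : nat) (w : nat -> nat) (adjn : nat -> seq nat).

Definition graph_in (s : st) : Prop :=
  vr s vN = n /\ forall u, u < n -> [/\ ar s aW u = w u, ar s aD u = size (adjn u) &
    forall p, p < size (adjn u) -> ar s aA (ar s aS u + p) = nth 0 (adjn u) p].

Lemma graph_in_same c s s' :
  pres c -> same c s s' -> graph_in s -> graph_in s'.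
Proof.
move=> /andP[nN /= /and5P[n0 n1 n2 n3 _]] [V A] [E H]; split; first by rewrite V.
by move=> u /H; rewrite !A.
Qed.

Lemma ForV_ind c (P : nat -> st -> Prop) s : graph_in s -> P 0 s ->
  (forall i s', i < n -> same (ForV c) s s' -> P i s' -> P i.+1 (exe c (setv s' vU i))) ->
  P n (exe (ForV c) s).
Proof.
move=> [E _] P0 PS; have En : eval (Var vN) s = n by [].
by rewrite -{1}En; apply: For_ind => // i s'; rewrite En; apply: PS.
Qed.

(** The invariant is indexed by the visited prefix of the adjacency list, which hides positions and
    addresses. *)
Lemma ForN_ind c (P : seq nat -> st -> Prop) s U : graph_in s -> U < n -> vr s vU = U ->
  keeps c -> P [::] s ->
  (forall pre y post s', adjn U = pre ++ y :: post -> same (ForN c) s s' -> P pre s' ->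
     P (rcons pre y) (exe c (setv (setv s' vP (size pre)) vY y))) ->
  P (adjn U) (exe (ForN c) s).
Proof.
move=> [EN HG] ltU EU /andP[/= /and4P[kN kU kP _] /and5P[k0 k1 k2 k3 _]] P0 PS.
have [_ ED EA] := HG U ltU.
have En : eval (Arr aD (Var vU)) s = size (adjn U) by rewrite /= EU.
suff: P (take (eval (Arr aD (Var vU)) s) (adjn U)) (exe (ForN c) s) by rewrite En take_size.
apply: (@For_ind _ _ _ (fun i => P (take i (adjn U)))) => [|i s']; first by rewrite take0.
rewrite En => lti S Pi.
have -> : exe (Seq (Asg vY (Arr aA (Add (Arr aS (Var vU)) (Var vP)))) c) (setv s' vP i) =
   exe c (setv (setv s' vP i) vY (nth 0 (adjn U) i)).
  rewrite /=; case: (S) => V A.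
  have -> : vr s' vU = U by rewrite V.
  by rewrite !A // EA.
rewrite (take_nth 0 lti).
have := PS (take i (adjn U)) (nth 0 (adjn U) i) (drop i.+1 (adjn U)) s'.
rewrite size_take lti -drop_nth // cat_take_drop; exact.
Qed.

Variable k : nat.

(** Three cost classes decided by computation: [flat] means constant time, [local] time linear in
    the degree of [vU], and [linear] time linear in the size of the graph. *)
Fixpoint flat (c : cmd) : bool :=
  match c with
  | Skip | Asg _ _ | Wr _ _ _ => true
  | Seq c1 c2 | If _ c1 c2 => flat c1 && flat c2
  | For _ _ _ => false
  end.

(** A coefficient that does not depend on the state: a loop with a variable bound is charged for one
    round, and the number of rounds reappears as a factor in the cost lemmas. *)
Fixpoint kcost (c : cmd) : nat :=
  match c with
  | Skip => 0
  | Asg x e => size (cexp k e 0) + 1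
  | Wr a i e => size (cexp k i 0) + (k + 3) + size (cexp k e 1) + 1
  | Seq c1 c2 => kcost c1 + kcost c2
  | If e c1 c2 => size (cexp k e 0) + 2 + (kcost c1 + kcost c2)
  | For _ (Cst j) c => 4 + j * (kcost c + 5)
  | For x e c => size (cexp k e 0) + 3 + (kcost c + 5)
  end.

Lemma flat_cost c s : flat c -> tcmd k c s <= kcost c.
Proof.
elim: c s => [|x e|a i e|c1 IH1 c2 IH2|e c1 IH1 c2 IH2|x e c IH] s //=.
  by case/andP=> f1 f2; apply: leq_add; [apply: IH1|apply: IH2].
case/andP=> f1 f2; rewrite leq_add2l; case: ifP => _.
  by apply: leq_trans (IH2 _ f2) (leq_addl _ _).
by apply: leq_trans (IH1 _ f1) (leq_addr _ _).
Qed.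

Fixpoint local (c : cmd) : bool :=
  match c with
  | Skip | Asg _ _ | Wr _ _ _ => true
  | Seq c1 c2 | If _ c1 c2 => local c1 && local c2
  | For _ (Arr aD (Var vU)) c => flat c
  | For _ _ _ => false
  end.

Lemma local_cost c s : local c -> ~~ wv c vU -> ~~ wa c aD ->
  tcmd k c s <= kcost c * (1 + ar s aD (vr s vU)).
Proof.
elim: c s => [|x e|a i e|c1 IH1 c2 IH2|e c1 IH1 c2 IH2|x e c _] s.
- by [].
- by move=> _ _ _; apply: leq_pmulr.
- by move=> _ _ _; apply: leq_pmulr.
- case/andP=> l1 l2; rewrite /= !negb_or => /andP[u1 u2] /andP[d1 d2].
  rewrite mulnDl; apply: leq_add; first exact: IH1.
  by have := IH2 (exe c1 s) l2 u2 d2; rewrite exe_vr // exe_ar.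
- case/andP=> l1 l2; rewrite /= !negb_or => /andP[u1 u2] /andP[d1 d2].
  rewrite mulnDl; apply: leq_add; first exact: leq_pmulr.
  case: ifP => _; rewrite mulnDl.
    by apply: leq_trans (IH2 _ l2 u2 d2) (leq_addl _ _).
  by apply: leq_trans (IH1 _ l1 u1 d1) (leq_addr _ _).
- have L : local (For x e c) -> e = Arr aD (Var vU) /\ flat c.
    by case: e => // -[|[|[|?]]] // [] // -[|[|[|?]]].
  move=> /L[-> fc] _ _; apply: leq_trans (tcmd_For (b := fun=> kcost c) _) _.
    by move=> i s' _ _; apply: flat_cost.
  have -> : kcost (For x (Arr aD (Var vU)) c) =
    size (cexp k (Arr aD (Var vU)) 0) + 3 + (kcost c + 5) by [].
  rewrite sum_nat_const card_ord [eval _ _]/=; move: (ar s aD _) (kcost c) (size _) => z K S.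
  by nia.
Qed.

Definition deg_sum : nat := \sum_(u < n) size (adjn u).

(** A constant number of linear passes is linear. Such a loop must not use [vN] as its variable, or
    it would destroy the stored graph. *)
Fixpoint linear (c : cmd) : bool :=
  match c with
  | Skip | Asg _ _ | Wr _ _ _ => true
  | Seq c1 c2 | If _ c1 c2 => linear c1 && linear c2
  | For x (Cst j) c => linear c && ~~ Nat.eqb x vN
  | For vU (Var vN) c => [&& local c, ~~ wv c vU & ~~ wa c aD]
  | For _ _ _ => false
  end.

Lemma linear_cost c s : linear c -> graph_in s -> pres c ->
  tcmd k c s <= kcost c * (1 + n + deg_sum).
Proof.
set L := 1 + n + deg_sum; have L0 : 0 < L by [].
elim: c s => [|x e|a i e|c1 IH1 c2 IH2|e c1 IH1 c2 IH2|x e c IH] s.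
- by [].
- by move=> _ _ _; apply: leq_pmulr.
- by move=> _ _ _; apply: leq_pmulr.
- case/andP=> l1 l2 G; rewrite pres_seq => /andP[p1 p2] /=.
  rewrite mulnDl; apply: leq_add; first exact: IH1.
  by apply: IH2 => //; apply: graph_in_same p1 (exe_same c1 s) G.
- case/andP=> l1 l2 G; rewrite -[pres _]/(pres (Seq c1 c2)) pres_seq => /andP[p1 p2] /=.
  rewrite mulnDl; apply: leq_add; first exact: leq_pmulr.
  rewrite mulnDl; case: ifP => _.
    by apply: leq_trans (leq_addl _ _); apply: IH2.
  by apply: leq_trans (leq_addr _ _); apply: IH1.
- case: e => [j|y|e1 e2|e1 e2|a i]; try by case: x => [|[|[|x]]].
    2: case: x y => [|[|[|x]]] [|y] //; case/and3P=> l u d G _.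
    2: {
    apply: leq_trans (tcmd_For (b := fun u => kcost c * (1 + size (adjn u))) _) _.
      case: (G) => EN HG i s'; rewrite [eval _ _]/= EN => lti [V A].
      apply: leq_trans (local_cost _ l u d) _.
      rewrite /= A //; case: (HG i lti) => _ -> _; exact: leqnn.
    rewrite [eval _ _]/=; case: G => -> _.
    have -> : kcost (For vU (Var vN) c) =
      size (cexp k (Var vN) 0) + 3 + (kcost c + 5) by [].
    rewrite big_split -big_distrr big_split /= !sum_nat_const card_ord.
    rewrite -/deg_sum /L; move: (kcost c) => K; nia. }
  move=> lx G pc; have /andP[l x0] : linear c && ~~ Nat.eqb x vN.
    by case: x lx {pc} => [|[|[|x]]].
  have pc' : pres c by move: pc; rewrite /pres /= negb_or => /andP[/andP[_ ->]].
  apply: leq_trans (tcmd_For (b := fun=> kcost c * L) _) _.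
    move=> i s' _ S; apply: IH => //.
    have [EN HG] := graph_in_same pc S G; split=> //=.
    by case: (x) x0.
  have -> : kcost (For x (Cst j) c) = 4 + j * (kcost c + 5) by [].
  rewrite sum_nat_const card_ord [eval _ _]/= [size _]/=; move: (kcost c) => K; nia.
Qed.
End Graph.

(** * The algorithm *)

Opaque ForV ForN.

Local Notation vK := 5 (only parsing).
Local Notation vBad := 6 (only parsing).
Local Notation vFr := 7 (only parsing).
Local Notation vT := 8 (only parsing).
Local Notation vC := 9 (only parsing).
Local Notation vD := 10 (only parsing).
Local Notation vOk := 11 (only parsing).
Local Notation vCost := 12 (only parsing).
Local Notation vCode := 13 (only parsing).
(* Levels are distances from the current vertex plus 1, and 0 for unreached vertices. [aSz], [aB]
   and [aNew] are indexed by classes; [aB] holds the best vertex of a class plus 1, and [aM] the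
   weight of the best candidate plus 1, with 0 for none. [aX] is the candidate of the current
   vertex, [aI] the solution. *)
Local Notation aL := 4 (only parsing).
Local Notation aC := 5 (only parsing).
Local Notation aNew := 6 (only parsing).
Local Notation aSz := 7 (only parsing).
Local Notation aB := 8 (only parsing).
Local Notation aX := 9 (only parsing).
Local Notation aM := 10 (only parsing).
Local Notation aI := 11 (only parsing).

Local Notation At a x := (Arr a (Var x)) (only parsing).
Local Notation Neq e1 e2 := (Add (Sub e1 e2) (Sub e2 e1)) (only parsing).
Local Notation IfEq e1 e2 c := (If (Neq e1 e2) Skip c) (only parsing).
Local Notation Incr x := (Asg x (Add (Var x) (Cst 1))) (only parsing).

Lemma neq0E x y : (x - y + (y - x) == 0) = (x == y).
Proof. lia. Qed.

(** Class names are never reused: each try starts from a fresh one. Stale entries of [aNew] then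
    stay at most [vFr] and are recognised as stale, instead of being cleared. *)
Definition cInit :=
  Seq (Incr vFr)
  (Seq (ForV (Seq (Wr aL (Var vU) (Cst 0))
             (Seq (Wr aC (Var vU) (Var vFr)) (Wr aX (Var vU) (Cst 0)))))
       (Wr aL (Var vV) (Cst 1))).

Definition cSpread := If (At aL vY) Skip (Wr aL (Var vY) (Add (Var vK) (Cst 2))).
Definition cLayer := IfEq (At aL vU) (Add (Var vK) (Cst 1)) (ForN cSpread).
(** Four rounds reach distance 4, that is level 5, just far enough to see whether [N4] is empty. *)
Definition cLevels := For vK (Cst 4) (ForV cLayer).

Definition cFar := ForV (IfEq (At aL vU) (Cst 5) (Asg vBad (Cst 1))).

(* A class [c] met by the neighbourhood of the current vertex [vU] is split: the part inside is
   renamed to [aNew c], which is fresh exactly if it exceeds [vT]. *)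
Definition cMove :=
  IfEq (At aL vY) (Cst 4)
    (Seq (Asg vC (At aC vY))
    (Seq (If (Sub (At aNew vC) (Var vT)) Skip (Seq (Incr vFr) (Wr aNew (Var vC) (Var vFr))))
         (Wr aC (Var vY) (At aNew vC)))).
Definition cSplit := IfEq (At aL vU) (Cst 3) (Seq (Asg vT (Var vFr)) (ForN cMove)).
Definition cRefine := ForV cSplit.

(** Only the names now in use are cleared; all names given so far could be too many for linear
    time. *)
Definition cReset := ForV (Seq (Wr aSz (At aC vU) (Cst 0)) (Wr aB (At aC vU) (Cst 0))).

Definition cSize :=
  ForV (IfEq (At aL vU) (Cst 4) (Wr aSz (At aC vU) (Add (Arr aSz (At aC vU)) (Cst 1)))).

Definition cDegree :=
  IfEq (At aL vY) (Cst 4)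
    (Seq (Incr vD) (If (Neq (At aC vY) (At aC vU)) (Asg vBad (Cst 1)) Skip)).
Definition cSetBest := Wr aB (At aC vU) (Add (Var vU) (Cst 1)).
Definition cBest :=
  ForV (IfEq (At aL vU) (Cst 4)
    (Seq (Asg vD (Cst 0))
    (Seq (ForN cDegree)
         (IfEq (Add (Var vD) (Cst 1)) (Arr aSz (At aC vU))
            (If (Arr aB (At aC vU))
               (If (Sub (Arr aW (Sub (Arr aB (At aC vU)) (Cst 1))) (At aW vU)) cSetBest Skip)
               cSetBest))))).

Definition cMark :=
  Seq (Wr aX (Var vV) (Cst 1))
  (Seq (Asg vCost (At aW vV))
       (ForV (IfEq (At aL vU) (Cst 4)
          (IfEq (Arr aB (At aC vU)) (Add (Var vU) (Cst 1))
             (Seq (Wr aX (Var vU) (Cst 1)) (Asg vCost (Add (Var vCost) (At aW vU)))))))).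

(** This check makes the answer sound: if [v] is in no efficient dominating set, the set built from
    it need not be one on the component. *)
Definition cCheck :=
  Seq (Asg vOk (Cst 1))
    (ForV (If (At aL vU)
       (Seq (If (At aX vU) (Asg vD (Cst 1)) (Asg vD (Cst 0)))
       (Seq (ForN (If (At aX vY) (Incr vD) Skip))
            (If (Neq (Var vD) (Cst 1)) (Asg vOk (Cst 0)) Skip)))
       Skip)).

Definition cKeep :=
  Seq (Wr aM (Var vU) (Add (Var vCost) (Cst 1))) (Wr aI (Var vU) (At aX vU)).
Definition cUpdate :=
  If (Var vOk)
    (ForV (If (At aL vU)
       (If (At aM vU)
          (If (Sub (At aM vU) (Add (Var vCost) (Cst 1))) cKeep Skip)
          cKeep)
       Skip))
    Skip.

Definition cTry :=
  Seq cInit (Seq cLevels (Seq cFar (Seq cRefine (Seq cReset (Seq cSize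
  (Seq cBest (Seq cMark (Seq cCheck cUpdate)))))))).

(** An isolated vertex must dominate itself. A full try would cost order [n] here, with no incident
    edge to pay for it. *)
Definition cVertex :=
  If (At aD vV) cTry
     (Seq (Wr aM (Var vV) (Add (At aW vV) (Cst 1))) (Wr aI (Var vV) (Cst 1))).

Definition cMain :=
  Seq (Seq (Asg vBad (Cst 0)) (Asg vFr (Cst 0)))
  (Seq (For vV (Var vN) cVertex)
  (Seq (Asg vCode (Cst 2))
  (Seq (ForV (If (At aM vU) Skip (Asg vCode (Cst 1))))
       (If (Var vBad) (Asg vCode (Cst 0)) Skip)))).

Lemma wfc_cMain : wfc 4 cMain 0. Proof. by []. Qed.

(** * Correctness of the phases of one try *)

Section Main.
Variables (n : nat) (w : nat -> nat) (adjn : nat -> seq nat).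
Hypothesis adj_lt : forall u y, u < n -> y \in adjn u -> y < n.
Hypothesis adj_sym : forall u y, u < n -> y \in adjn u -> u \in adjn y.
Hypothesis adj_irr : forall u, u \notin adjn u.
Hypothesis adj_uniq : forall u, uniq (adjn u).

Local Notation graph_in := (graph_in n w adjn) (only parsing).
Local Notation ForV_ind := (@ForV_ind n w adjn) (only parsing).
Local Notation ForN_ind := (@ForN_ind n w adjn) (only parsing).

Lemma exe_if e c1 c2 s : exe (If e c1 c2) s = if eval e s == 0 then exe c2 s else exe c1 s.
Proof. by []. Qed.

Lemma exe_chain c1 c2 c3 c4 c5 c6 c7 c8 c9 c10 s :
  exe (Seq c1 (Seq c2 (Seq c3 (Seq c4 (Seq c5 (Seq c6 (Seq c7 (Seq c8 (Seq c9 c10))))))))) s =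
  exe c10 (exe c9 (exe c8 (exe c7 (exe c6 (exe c5 (exe c4 (exe c3 (exe c2 (exe c1 s))))))))).
Proof. by []. Qed.

Lemma pres_in c s : pres c -> graph_in s -> graph_in (exe c s).
Proof. by move=> p; apply: graph_in_same p (exe_same c s). Qed.

Lemma graph_in_setv x v s : graph_in s -> graph_in (setv s x.+1 v).
Proof. by []. Qed.

Lemma cInitP s : graph_in s -> vr s vV < n ->
  let s' := exe cInit s in
  [/\ forall u, u < n -> ar s' aL u = (u == vr s vV),
      forall u, u < n -> ar s' aC u = vr s' vFr,
      forall u, u < n -> ar s' aX u = 0 &
      vr s' vFr = (vr s vFr).+1].
Proof.
move=> G ltv /=; rewrite addn1.
set s1 := setv s vFr (vr s vFr).+1.
have G1 : graph_in s1 by [].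
set c := ForV _; set s2 := exe _ s1.
have F2 : vr s2 vFr = (vr s vFr).+1 by rewrite /s2 exe_vr.
have V2 : vr s2 vV = vr s vV by rewrite /s2 exe_vr.
have : forall u, u < n -> [/\ ar s2 aL u = 0, ar s2 aC u = (vr s vFr).+1 & ar s2 aX u = 0].
  apply: (ForV_ind (P := fun i s' => forall u, u < i ->
    [/\ ar s' aL u = 0, ar s' aC u = (vr s vFr).+1 & ar s' aX u = 0]) G1) => // i s' lti S IH u.
  rewrite ltnS leq_eqVlt /= => /predU1P[->|ltu]; first by rewrite eqxx S.1.
  by case: ltngtP ltu => // ltu _; apply: IH.
move=> H; split=> [u ltu|u ltu|u ltu|] //=; case: (H u ltu) => [E1 E2 E3] //.
- by rewrite V2 E1; case: eqP.
- by rewrite E2 F2.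
Qed.

(** Breadth-first labels after [k] rounds, described without a distance function: the third clause
    provides parents, the fourth says that neighbours of processed levels are reached and at most
    one level further. *)
Definition levels (v k : nat) (L : nat -> nat) : Prop :=
  [/\ forall u, u < n -> L u <= k.+1,
      forall u, u < n -> (L u == 1) = (u == v),
      forall y, y < n -> 1 < L y -> exists2 u, u \in adjn y & L y = (L u).+1 &
      forall u y, u < n -> 0 < L u <= k -> y \in adjn u -> 0 < L y <= (L u).+1].

(** No vertex of level at most [k] has an unreached neighbour, so labelling such a neighbour of a
    level [k.+1] vertex leaves the closure clause intact. *)
Lemma levels_set v k L U y : U < n -> L U = k.+1 -> y \in adjn U -> L y = 0 ->
  (forall u, u < n -> L u <= k.+2) -> 
  [/\ forall u, u < n -> (L u == 1) = (u == v),
      forall y, y < n -> 1 < L y -> exists2 u, u \in adjn y & L y = (L u).+1 &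
      forall u y, u < n -> 0 < L u <= k -> y \in adjn u -> 0 < L y <= (L u).+1] ->
  let L' z := if z == y then k.+2 else L z in
  [/\ forall u, u < n -> (L' u == 1) = (u == v),
      forall y, y < n -> 1 < L' y -> exists2 u, u \in adjn y & L' y = (L' u).+1 &
      forall u y, u < n -> 0 < L' u <= k -> y \in adjn u -> 0 < L' y <= (L' u).+1].
Proof.
move=> ltU LU yU Ly bnd [H1 H2 H3] L'.
have nUy : U == y = false by apply/eqP=> E; rewrite E Ly in LU.
have yn := adj_lt ltU yU.
split=> [u ltu|z ltz|u z ltu]; rewrite /L'.
- by case: (u =P y) => [->|_]; rewrite -H1 // Ly.
- case: (z =P y) => [->|_] l1; first by exists U; rewrite ?nUy ?LU // adj_sym.
  case: (H2 z ltz l1) => u uz Eu; exists u => //.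
  by case: (u =P y) => // E; move: l1; rewrite Eu E Ly.
- case: (u =P y) => [_|_]; first by lia.
  move=> bu zu; have := H3 u z ltu bu zu.
  by case: (z =P y) => [->|//]; rewrite Ly.
Qed.

Lemma cLevelsP s v : graph_in s -> v < n ->
  (forall u, u < n -> ar s aL u = (u == v)) -> levels v 4 (ar (exe cLevels s) aL).
Proof.
move=> G ltv L0; rewrite /cLevels.
apply: (For_ind (e := Cst 4) (P := fun k s' => levels v k (ar s' aL))).
  split=> [u ltu|u ltu|y lty|u y ltu]; rewrite L0 //; by case: (_ == v).
move=> k s1 ltk S1 [I1 I2 I3 I4].
have G1 : graph_in (setv s1 vK k) by apply: graph_in_setv; apply: graph_in_same S1 G.
(* In the middle of a round, levels go up to [k.+2] but closure is known only up to level [k]; the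
   last clause collects the vertices of level [k.+1] treated so far. *)
pose Q i s' := [/\ forall u, u < n -> ar s' aL u <= k.+2,
  [/\ forall u, u < n -> (ar s' aL u == 1) = (u == v),
      forall y, y < n -> 1 < ar s' aL y -> exists2 u, u \in adjn y & ar s' aL y = (ar s' aL u).+1 &
      forall u y, u < n -> 0 < ar s' aL u <= k -> y \in adjn u -> 0 < ar s' aL y <= (ar s' aL u).+1] &
  forall u y, u < i -> ar s' aL u = k.+1 -> y \in adjn u -> 0 < ar s' aL y].
have [] : Q n (exe (ForV cLayer) (setv s1 vK k)); last first.
  move=> J1 [J2 J3 J4] J5; split=> // u y ltu /andP[Lu]; rewrite leq_eqVlt => /orP[/eqP E|leL] yu.
    by rewrite (J5 u y) // E J1 // (adj_lt ltu).
  by apply: (J4 u y) => //; rewrite Lu.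
apply: (ForV_ind (P := Q) G1) => [|i s2 lti S2 HQ].
  by split=> //= u ltu; apply: leqW; apply: I1.
have Kk : vr s2 vK = k by rewrite S2.1.
rewrite /cLayer /= Kk addn1 neq0E; case: eqP => E; last first.
  case: HQ => J1 J2 J3; split=> // u y; rewrite ltnS leq_eqVlt => /predU1P[->|ltu] //.
  exact: J3.
have G2 : graph_in (setv s2 vU i).
  by apply: graph_in_setv; apply: graph_in_same S2 G1.
pose R (pre : seq nat) s' := [/\ Q i s', ar s' aL i = k.+1 & forall y, y \in pre -> 0 < ar s' aL y].
have [] : R (adjn i) (exe (ForN cSpread) (setv s2 vU i)); last first.
  move=> [J1 J2 J3] J4 J5; split=> // u y; rewrite ltnS leq_eqVlt => /predU1P[->|ltu] //.
    by move=> _; apply: J5.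
  exact: J3.
apply: (ForN_ind G2 lti) => // pre y post s3 Ead S3 [[J1 J2 J3] J4 J5].
have K3 : vr s3 vK = k by rewrite S3.1.
rewrite /cSpread /= K3; case: (ar s3 aL y =P 0) => Ly; last first.
  split=> // z; rewrite mem_rcons inE => /predU1P[->|]; first by rewrite lt0n; apply/eqP.
  exact: J5.
have yi : y \in adjn i by rewrite Ead mem_cat inE eqxx orbT.
rewrite addn2; split=> [|/=|z]; first split.
- by move=> u ltu /=; case: eqP => // _; apply: J1.
- exact: (levels_set lti J4 yi Ly J1 J2).
- move=> u z ltu /=; case: (z =P y) => // _; case: (u =P y) => [_ ?|_]; [lia|exact: J3].
- by case: eqP => // Ei; rewrite -Ei J4 in Ly.
- by rewrite mem_rcons inE /=; case: eqP => //= _; apply: J5.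
Qed.

(** Distinctness is left out: it follows from the adjacencies and non-adjacencies. *)
Definition path5 : Prop := exists a b c d f,
  [/\ [/\ a < n, b < n, c < n, d < n & f < n],
      [/\ b \in adjn a, c \in adjn b, d \in adjn c & f \in adjn d],
      [/\ c \notin adjn a, d \notin adjn a & f \notin adjn a] &
      [/\ d \notin adjn b, f \notin adjn b & f \notin adjn c]].

(** * Induced paths found from the levels *)

Section Levels.
Variables (v : nat) (L : nat -> nat).
Hypothesis lev : levels v 4 L.

Lemma level_far u y : u < n -> y < n -> 0 < L u -> (L u).+2 <= L y -> y \notin adjn u.
Proof.
case: lev => H1 _ _ H4 ltu lty Lu Ly; apply/negP=> yu.
have := H1 y lty; have := H4 u y ltu; rewrite Lu yu /= => H.
suff /H/(_ isT) : L u <= 4 by lia.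
by have := H1 y lty; lia.
Qed.

Lemma level_parent y : y < n -> 1 < L y ->
  exists u, [/\ u < n, y \in adjn u, u \in adjn y & L u = (L y).-1].
Proof.
case: lev => _ _ H3 _ lty /(H3 y lty)[u uy E]; have ltu := adj_lt lty uy.
by exists u; split; rewrite ?E // adj_sym.
Qed.

(** Parents lead back to [v] along a shortest path, whose non-consecutive vertices are at least two
    levels apart. *)
Lemma far_path5 y : y < n -> L y = 5 -> path5.
Proof.
move=> lty Ly.
have [d [ltd yd _ Ld]] : exists u, [/\ u < n, y \in adjn u, u \in adjn y & L u = 4].
  by case: (level_parent lty); rewrite Ly // => d ?; exists d.
have [c [ltc dc _ Lc]] : exists u, [/\ u < n, d \in adjn u, u \in adjn d & L u = 3].
  by case: (level_parent ltd); rewrite Ld // => c ?; exists c.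
have [b [ltb cb _ Lb]] : exists u, [/\ u < n, c \in adjn u, u \in adjn c & L u = 2].
  by case: (level_parent ltc); rewrite Lc // => b ?; exists b.
have [a [lta ba _ La]] : exists u, [/\ u < n, b \in adjn u, u \in adjn b & L u = 1].
  by case: (level_parent ltb); rewrite Lb // => a ?; exists a.
by exists a, b, c, d, y; split=> //; split=> //; apply: level_far; rewrite ?La ?Lb ?Lc ?Ld ?Ly.
Qed.

(** The path is [v], a parent of [z], [z], [x], [y]. Levels settle every non-edge except the one
    between [z] and [y], which is assumed. *)
Lemma split_path5 x y z : z < n -> x < n -> L z = 3 -> L x = 4 -> L y = 4 ->
  x \in adjn z -> y \in adjn x -> y \notin adjn z -> path5.
Proof.
move=> ltz ltx Lz Lx Ly xz yx yz; have lty := adj_lt ltx yx.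
have [b [ltb zb _ Lb]] : exists u, [/\ u < n, z \in adjn u, u \in adjn z & L u = 2].
  by case: (level_parent ltz); rewrite Lz // => b ?; exists b.
have [a [lta ba _ La]] : exists u, [/\ u < n, b \in adjn u, u \in adjn b & L u = 1].
  by case: (level_parent ltb); rewrite Lb // => a ?; exists a.
by exists a, b, z, x, y; split=> //; split=> //; apply: level_far; rewrite ?La ?Lb ?Lz ?Lx ?Ly.
Qed.
End Levels.

Lemma cFarP s v : graph_in s -> levels v 4 (ar s aL) ->
  let s' := exe cFar s in
  (vr s' vBad = 0 -> vr s vBad = 0 /\ forall u, u < n -> ar s aL u <= 4) /\
  (vr s' vBad <> 0 -> vr s vBad <> 0 \/ path5).
Proof.
move=> G lev; apply: (ForV_ind (P := fun i s' =>
  (vr s' vBad = 0 -> vr s vBad = 0 /\ forall u, u < i -> ar s aL u <= 4) /\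
  (vr s' vBad <> 0 -> vr s vBad <> 0 \/ path5)) G) => [|i s1 lti S [H1 H2]].
  by split=> // E; left.
have EL : ar s1 aL = ar s aL by rewrite S.2.
rewrite /= neq0E EL; case: eqP => E /=.
  by split=> // _; right; apply: far_path5 lev _ lti E.
split=> // /H1[-> H]; split=> // u; rewrite ltnS leq_eqVlt => /predU1P[->|]; last exact: H.
by case: lev => /(_ i lti) + _ _ _; lia.
Qed.

(** * Partition refinement of the third neighbourhood *)

Definition separates (i : nat) (L C : nat -> nat) : Prop :=
  forall x y, x < n -> y < n -> L x = 4 -> L y = 4 ->
    C x = C y <-> forall z, z < i -> L z = 3 -> (x \in adjn z) = (y \in adjn z).

Definition fresh_ok (s : st) : Prop :=
  (forall x, x < n -> ar s aC x <= vr s vFr) /\ (forall c, ar s aNew c <= vr s vFr).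

Lemma cRefineP s : graph_in s -> fresh_ok s ->
  (forall x y, x < n -> y < n -> ar s aC x = ar s aC y) ->
  let s' := exe cRefine s in
  separates n (ar s aL) (ar s' aC) /\ fresh_ok s'.
Proof.
move=> G F0 C0.
apply: (ForV_ind (P := fun i s' => separates i (ar s aL) (ar s' aC) /\ fresh_ok s') G).
  by split=> // x y ltx lty _ _; split=> // _; apply: C0.
move=> i s1 lti S [Sep [F1 F2]].
have EL : ar s1 aL = ar s aL by rewrite S.2.
rewrite /cSplit /= neq0E EL; case: eqP => Li; last first.
  split=> // x y ltx lty Lx Ly; rewrite Sep //; split=> H z.
    by rewrite ltnS leq_eqVlt => /predU1P[-> //|]; apply: H.
  by move=> ltz; apply: H; apply: leqW.
set s2 := setv _ vT _.
have G2 : graph_in s2 by do 2!apply: graph_in_setv; apply: graph_in_same S G.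
pose T := vr s1 vFr; pose C := ar s1 aC; pose L := ar s aL.
(* [T] is the largest name before splitting by [i]. An entry of [aNew] above [T] was made during
   this split, and by the last clause it determines the old class. *)
pose R (pre : seq nat) s' :=
  [/\ [/\ vr s' vT = T, T <= vr s' vFr & forall c, ar s' aNew c <= vr s' vFr],
      forall x, x < n -> ar s' aC x = if (L x == 4) && (x \in pre) then ar s' aNew (C x) else C x,
      forall x, x < n -> L x = 4 -> x \in pre -> T < ar s' aNew (C x) &
      forall c c', T < ar s' aNew c -> ar s' aNew c = ar s' aNew c' -> c = c'].
have [] : R (adjn i) (exe (ForN cMove) s2); last first.
  set s3 := exe _ _ => -[_ J2 J3] J4 J5 J6; split; last first.
    split=> // x ltx; rewrite J4 //; case: ifP => // _.
    by apply: leq_trans J2; apply: F1.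
  have Tlt x : x < n -> C x <= T by apply: F1.
  move=> x y ltx lty Lx Ly; rewrite !J4 // /L Lx Ly eqxx /=.
  have step : (C x = C y /\ (x \in adjn i) = (y \in adjn i)) <->
     forall z, z < i.+1 -> ar s aL z = 3 -> (x \in adjn z) = (y \in adjn z).
    rewrite Sep //; split=> [[H Hi] z|H].
      by rewrite ltnS leq_eqVlt => /predU1P[-> //|]; apply: H.
    by split=> [z ltz|]; apply: H => //; apply: leqW.
  (* Names given in this split exceed [T] and old ones do not, so a vertex inside the neighbourhood
     of [i] never shares a name with one outside. *)
  rewrite -step; case: ifP => xi; case: ifP => yi.
  - split=> [E|[-> //]]; split=> //; apply: J6 E; exact: J5.
  - by split=> [E|[]//]; have := J5 x ltx Lx xi; have := Tlt y lty; lia.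
  - by split=> [E|[]//]; have := J5 y lty Ly yi; have := Tlt x ltx; lia.
  - by split=> [->|[]].
apply: (ForN_ind G2 lti) => // [|pre y post s3 Ead S3].
  split=> //= [x _|c c']; first by rewrite andbF.
  by move=> lt; have := F2 c; rewrite leqNgt lt.
have yi : y \in adjn i by rewrite Ead mem_cat inE eqxx orbT.
have lty := adj_lt lti yi.
have ypre : y \notin pre.
  by have := adj_uniq i; rewrite Ead cat_uniq => /and3P[_ /norP[]].
have E3 : ar s3 aL = L by rewrite S3.2 //=.
case=> -[T3 F3 N3] J4 J5 J6; rewrite /cMove /= neq0E E3 T3.
case: eqP => Ly; last first.
  split=> // x ltx; rewrite mem_rcons inE.
    by rewrite J4 //; case: (x =P y) => //= ->; rewrite (introF eqP Ly).
  by move=> Lx /predU1P[E|]; [rewrite E in Lx|apply: J5].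
rewrite subn_eq0 J4 // (negbTE ypre) andbF.
case: leqP => NT /=; last first.
  split=> //= [x ltx|x ltx Lx]; rewrite mem_rcons inE.
    case: (x =P y) => [->|_]; last by rewrite J4.
    by rewrite Ly eqxx.
  by case/predU1P => [->|]; [|apply: J5].
rewrite eqxx addn1; split=> [|x ltx|x ltx Lx|c c'].
- split=> //=; first exact: leqW.
  by move=> c; case: eqP => // _; apply: leqW.
- rewrite mem_rcons inE /=; case: (x =P y) => [->|_] /=; first by rewrite Ly !eqxx.
  rewrite J4 //; case: (C x =P C y) => // E; case: ifP => // /andP[/eqP Lx xp].
  by have := J5 x ltx Lx xp; rewrite E; lia.
- rewrite mem_rcons inE /= => /predU1P[->|xp]; first by rewrite eqxx ltnS.
  by case: eqP => [_|_]; [rewrite ltnS|apply: J5].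
- move=> /=; case: eqP => [->|_]; case: eqP => [->|_] //.
  + by move=> _ E; have := N3 c'; rewrite -E ltnn.
  + by move=> _ E; have := N3 c; rewrite E ltnn.
  + exact: J6.
Qed.

Lemma cResetP s : graph_in s -> forall u, u < n ->
  ar (exe cReset s) aSz (ar s aC u) = 0 /\ ar (exe cReset s) aB (ar s aC u) = 0.
Proof.
move=> G; apply: (ForV_ind (P := fun i s' => forall u, u < i ->
  ar s' aSz (ar s aC u) = 0 /\ ar s' aB (ar s aC u) = 0) G) => // i s1 lti S IH u.
have EC : ar s1 aC = ar s aC by rewrite S.2.
rewrite /= EC ltnS leq_eqVlt => /predU1P[->|/IH[-> ->]]; first by rewrite eqxx.
by case: eqP.
Qed.

Lemma iota0S i : iota 0 i.+1 = iota 0 i ++ [:: i].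
Proof. by rewrite -addn1 iotaD. Qed.

Lemma count_iotaS (a : pred nat) i : count a (iota 0 i.+1) = count a (iota 0 i) + a i.
Proof. by rewrite iota0S count_cat /= addn0. Qed.

(** * Class sizes, best vertices, and the check of the candidate *)

Definition class_size (L C : nat -> nat) (c : nat) : nat :=
  count (fun x => (L x == 4) && (C x == c)) (iota 0 n).

Lemma cSizeP s : graph_in s -> (forall u, u < n -> ar s aSz (ar s aC u) = 0) ->
  forall u, u < n ->
  ar (exe cSize s) aSz (ar s aC u) = class_size (ar s aL) (ar s aC) (ar s aC u).
Proof.
move=> G Z; apply: (ForV_ind (P := fun i s' => forall u, u < n ->
  ar s' aSz (ar s aC u) =
  count (fun x => (ar s aL x == 4) && (ar s aC x == ar s aC u)) (iota 0 i)) G) => //.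
move=> i s1 lti S IH u ltu; rewrite count_iotaS -IH //= neq0E.
have EL : ar s1 aL = ar s aL by rewrite S.2.
have EC : ar s1 aC = ar s aC by rewrite S.2.
rewrite EL EC; case: (ar s aL i =P 4) => _ /=; last by rewrite addn0.
by rewrite eq_sym; case: eqP => [->|_]; rewrite ?addn0.
Qed.

(** A counting test for adjacency to the rest of the class, correct once edges within [N3] are known
    to stay inside classes. *)
Definition universal (L C : nat -> nat) (x : nat) : Prop :=
  count (fun y => L y == 4) (adjn x) + 1 = class_size L C (C x).

(** [b] encodes a vertex plus 1, hence the predecessors; it can be 0 only if no vertex of the class
    below [i] is universal. *)
Definition best_of (i : nat) (L C : nat -> nat) (c b : nat) : Prop :=
  (forall x, x < i -> L x = 4 -> C x = c -> universal L C x -> b <> 0 /\ w b.-1 <= w x) /\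
  (b <> 0 -> [/\ b.-1 < n, L b.-1 = 4, C b.-1 = c & universal L C b.-1]).

Lemma cBestP s : graph_in s ->
  let L := ar s aL in let C := ar s aC in
  (forall x y, x < n -> y \in adjn x -> L x = 4 -> L y = 4 -> C x <> C y -> path5) ->
  (forall u, u < n -> ar s aSz (C u) = class_size L C (C u)) ->
  (forall u, u < n -> ar s aB (C u) = 0) ->
  let s' := exe cBest s in
  [/\ vr s' vBad = 0 -> vr s vBad = 0 /\
        forall x y, x < n -> y \in adjn x -> L x = 4 -> L y = 4 -> C x = C y,
      vr s' vBad <> 0 -> vr s vBad <> 0 \/ path5 &
      forall u, u < n -> best_of n L C (C u) (ar s' aB (C u))].
Proof.
move=> G L C Hp5 HS HB.
apply: (ForV_ind (P := fun i s' =>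
  [/\ vr s' vBad = 0 -> vr s vBad = 0 /\
        forall x y, x < i -> y \in adjn x -> L x = 4 -> L y = 4 -> C x = C y,
      vr s' vBad <> 0 -> vr s vBad <> 0 \/ path5 &
      forall u, u < n -> best_of i L C (C u) (ar s' aB (C u))]) G).
  by split=> // [E|u /HB->]; [left|].
move=> i s1 lti S [Bad1 Bad2 Best].
have EL : ar s1 aL = L by rewrite S.2.
have EC : ar s1 aC = C by rewrite S.2.
have ES : ar s1 aSz = ar s aSz by rewrite S.2.
rewrite /= neq0E EL; case: (L i =P 4) => Li; last first.
  split=> // [/Bad1[-> H]|u ltu].
    split=> // x y; rewrite ltnS leq_eqVlt => /predU1P[->|]; [by []|exact: H].
  have [B1 B2] := Best u ltu; split=> // x; rewrite ltnS leq_eqVlt => /predU1P[->|] //.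
  exact: B1.
set s2 := setv _ vD _.
have G2 : graph_in s2 by do 2!apply: graph_in_setv; apply: graph_in_same S G.
have : let s' := exe (ForN cDegree) s2 in
  [/\ vr s' vD = count (fun y => L y == 4) (adjn i),
    vr s' vBad = 0 -> vr s1 vBad = 0 /\ forall y, y \in adjn i -> L y = 4 -> C i = C y &
    vr s' vBad <> 0 -> vr s1 vBad <> 0 \/ path5].
  apply: (ForN_ind (P := fun pre s' => [/\ vr s' vD = count (fun y => L y == 4) pre,
    vr s' vBad = 0 -> vr s1 vBad = 0 /\ forall y, y \in pre -> L y = 4 -> C i = C y &
    vr s' vBad <> 0 -> vr s1 vBad <> 0 \/ path5]) G2 lti) => //.
    by split=> //= E; left.
  move=> pre y post s3 Ead S3 [D3 B3 P3].
  have yi : y \in adjn i by rewrite Ead mem_cat inE eqxx orbT.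
  have EL3 : ar s3 aL = L by rewrite S3.2.
  have EC3 : ar s3 aC = C by rewrite S3.2.
  have EU3 : vr s3 vU = i by rewrite S3.1.
  rewrite /cDegree /= neq0E EL3 -cats1 count_cat /= addn0; case: (L y =P 4) => Ly /=; last first.
    rewrite addn0; split=> // /B3[E H]; split=> // z; rewrite mem_cat inE => /orP[|/eqP->//].
    exact: H.
  rewrite neq0E EC3 EU3; case: (C y =P C i) => Cy /=.
    split=> [|/B3[E H]|] //; first by rewrite D3.
    by split=> // z; rewrite mem_cat inE => /orP[|/eqP->//]; apply: H.
  split=> //; first by rewrite D3.
  by move=> _; right; apply: (Hp5 i y) => // E; apply: Cy.
set s3 := exe _ _ => -[D3 B3 P3].
have EC3 : ar s3 aC = C by rewrite /s3 exe_ar.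
have ES3 : ar s3 aSz = ar s aSz by rewrite /s3 exe_ar.
have EU3 : vr s3 vU = i by rewrite /s3 exe_vr.
have EB3 : ar s3 aB = ar s1 aB by rewrite /s3 exe_ar.
have EW3 : ar s3 aW = ar s aW by rewrite /s3 exe_ar //= S.2.
have Ew u : u < n -> ar s aW u = w u by case: G => _ /(_ u) H /H[].
rewrite neq0E D3 EC3 EU3 ES3 HS //.
have badE (b : bool) : (vr s3 vBad = 0 -> vr s vBad = 0 /\
        forall x y, x < i.+1 -> y \in adjn x -> L x = 4 -> L y = 4 -> C x = C y) /\
   (vr s3 vBad <> 0 -> vr s vBad <> 0 \/ path5).
  split=> [/B3[/Bad1[-> H] Hi]|/P3[/Bad2|]]; [|by []|by right].
  split=> // x y; rewrite ltnS leq_eqVlt => /predU1P[->|ltx]; last exact: H.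
  by move=> yi _; apply: Hi.
have [badE1 badE2] := badE true; clear badE.
have old u : u < n -> ~ (C i = C u /\ universal L C i) -> best_of i.+1 L C (C u) (ar s1 aB (C u)).
  move=> ltu nu; have [B1 B2] := Best u ltu; split=> // x.
  rewrite ltnS leq_eqVlt => /predU1P[->|]; last exact: B1.
  by move=> _ E U; case: nu.
case: eqP => [U|nU]; last first.
  by split=> // u ltu; rewrite EB3; apply: old => // -[].
rewrite EB3.
have new u : u < n -> C i = C u ->
    (forall x, x < i -> L x = 4 -> C x = C u -> universal L C x -> w i <= w x) ->
    best_of i.+1 L C (C u) i.+1.
  move=> ltu Eu H; split=> // x; rewrite ltnS leq_eqVlt /= => /predU1P[->|ltx] // Lx Cx Ux.
  by split=> //; apply: (H x).
have [Bi1 Bi2] := Best i lti.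
case: eqP => B0.
  split=> // u ltu; rewrite /cSetBest /= addn1 EB3; case: eqP => [E|ne].
    apply: new => // x ltx Lx Cx Ux.
    by case: (Bi1 x ltx Lx (etrans Cx E) Ux); rewrite B0.
  by apply: old => // -[E _]; apply: ne; rewrite E.
have [ltb Lb Cb Ub] := Bi2 B0.
rewrite EW3 subn1 !Ew // subn_eq0; case: leqP => wb.
  split=> // u ltu; rewrite EB3; have [B1 B2] := Best u ltu; split=> // x.
  rewrite ltnS leq_eqVlt => /predU1P[->|] //; last exact: B1.
  by move=> _ <- _.
split=> // u ltu; rewrite /cSetBest /= addn1 EB3; case: eqP => [E|ne].
  apply: new => // x ltx Lx Cx Ux.
  by case: (Bi1 x ltx Lx (etrans Cx E) Ux) => _; apply: leq_trans (ltnW wb).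
by apply: old => // -[E _]; apply: ne; rewrite E.
Qed.

Lemma cMarkP s : graph_in s -> vr s vV < n -> ar s aL (vr s vV) <> 4 ->
  (forall u, u < n -> ar s aX u = 0) ->
  let s' := exe cMark s in
  let best u := (ar s aL u == 4) && (ar s aB (ar s aC u) == u.+1) in
  (forall u, u < n -> (ar s' aX u != 0) = (u == vr s vV) || best u) /\
  vr s' vCost = w (vr s vV) + \sum_(u <- iota 0 n | best u) w u.
Proof.
move=> G ltv Lv X0 s' best.
have Ew u : u < n -> ar s aW u = w u by case: G => _ /(_ u) H /H[].
rewrite {}/s' /=; set s1 := setv _ vCost _.
have G1 : graph_in s1 by [].
set c := ForV _.
have : (forall u, u < n -> (ar (exe c s1) aX u != 0) = (u == vr s vV) || (u < n) && best u) /\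
   vr (exe c s1) vCost = w (vr s vV) + \sum_(u <- iota 0 n | best u) w u.
  apply: (ForV_ind (P := fun i s' =>
    (forall u, u < n -> (ar s' aX u != 0) = (u == vr s vV) || (u < i) && best u) /\
    vr s' vCost = w (vr s vV) + \sum_(u <- iota 0 i | best u) w u) G1).
    split=> [u ltu|]; last by rewrite /= Ew ?big_nil ?addn0.
    by rewrite /= X0 // orbF; case: (u == _).
  move=> i s2 lti S2 [HX HC].
  have EL : ar s2 aL = ar s aL by rewrite S2.2.
  have EB : ar s2 aB = ar s aB by rewrite S2.2.
  have EC : ar s2 aC = ar s aC by rewrite S2.2.
  have EW : ar s2 aW = ar s aW by rewrite S2.2.
  rewrite iota0S big_cat /= big_cons big_nil.
  rewrite !neq0E EL EB EC addn1.
  have skip : best i = false ->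
    (forall u, u < n -> (ar s2 aX u != 0) = (u == vr s vV) || (u < i.+1) && best u) /\
    vr s2 vCost = w (vr s vV) + (\sum_(u <- iota 0 i | best u) w u +
       if best i then w i + 0 else 0).
    move=> nb; rewrite nb /= addn0; split=> // u ltu; rewrite HX //.
    by rewrite ltnS [u <= i]leq_eqVlt; case: (u =P i) => [->|]; rewrite ?nb ?andbF //=.
  case: (ar s aL i =P 4) => Li; last by apply: skip; rewrite /best (introF eqP Li).
  case: (ar s aB _ =P i.+1) => Bi; last by apply: skip; rewrite /best (introF eqP Bi) andbF.
  have bi : best i by rewrite /best Li Bi !eqxx.
  rewrite bi /= HC EW Ew // addn0 addnA; split=> // u ltu.
  rewrite ltnS leq_eqVlt; case: (u =P i) => [->|_] /=; first by rewrite bi orbT.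
  exact: HX.
by case=> H ->; split=> // u ltu; rewrite H // ltu.
Qed.

Definition dominated_once (X : pred nat) (u : nat) : bool := count X (u :: adjn u) == 1.

Lemma cCheckP s : graph_in s ->
  (vr (exe cCheck s) vOk <> 0) <->
  (forall u, u < n -> ar s aL u <> 0 -> dominated_once (fun y => ar s aX y != 0) u).
Proof.
move=> G; rewrite /cCheck /=; set s1 := setv s vOk 1.
have G1 : graph_in s1 by [].
set X := fun y : nat => _.
set c := ForV _; pose P i s' := (vr s' vOk <> 0) <->
  (forall u, u < i -> ar s aL u <> 0 -> dominated_once X u).
suff: P n (exe c s1) by [].
apply: (ForV_ind (P := P) G1) => // i s2 lti S2 IH.
have EL : ar s2 aL = ar s aL by rewrite S2.2.
have EX : ar s2 aX = ar s aX by rewrite S2.2.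
have step : (forall u, u < i.+1 -> ar s aL u <> 0 -> dominated_once X u) <->
   (forall u, u < i -> ar s aL u <> 0 -> dominated_once X u) /\
   (ar s aL i <> 0 -> dominated_once X i).
  split=> [H|[H Hi] u]; last by rewrite ltnS leq_eqVlt => /predU1P[->|] //; apply: H.
  by split=> [u ltu|]; apply: H => //; apply: leqW.
rewrite /P step /= EL; case: eqP => Li; first by apply: (iff_trans IH); split=> [?|[]].
rewrite EX; set s3 := (Z in exe (ForN _) Z).
have s3E : [/\ graph_in s3, vr s3 vU = i, ar s3 aX = ar s aX, vr s3 vD = X i & vr s3 vOk = vr s2 vOk].
  have G2 : graph_in (setv s2 vU i) by apply: graph_in_setv; apply: graph_in_same S2 G1.
  by rewrite /s3 /X; case: eqP => E /=; split=> //; apply: graph_in_setv.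
clearbody s3; case: s3E => G3 U3 X3 D3 O3.
set s4 := exe _ s3.
have D4 : vr s4 vD = count X (i :: adjn i).
  apply: (ForN_ind (P := fun pre s' => vr s' vD = X i + count X pre) G3 lti) => //.
    by rewrite /= addn0.
  move=> pre y post s5 _ S5 D5; rewrite -cats1 count_cat /= addn0 addnA -D5.
  have -> : ar s5 aX = ar s aX by rewrite S5.2.
  by rewrite -/(X y) /X; case: eqP => _ /=; rewrite ?addn0.
have O4 : vr s4 vOk = vr s2 vOk by rewrite /s4 exe_vr.
rewrite neq0E D4 /dominated_once; case: eqP => E /=.
  by rewrite O4; apply: (iff_trans IH); split=> [?|[]].
by split=> // -[_ H]; case: E; have := H Li.
Qed.

Lemma cUpdateP s : graph_in s ->
  let s' := exe cUpdate s in
  let better u := [&& vr s vOk != 0, ar s aL u != 0 &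
                   (ar s aM u == 0) || (vr s vCost < (ar s aM u).-1)] in
  forall u, u < n -> 
    ar s' aM u = (if better u then (vr s vCost).+1 else ar s aM u) /\
    ar s' aI u = (if better u then ar s aX u else ar s aI u).
Proof.
move=> G /=; case: eqP => //= Ok; set c := ForV _.
have : forall u, u < n ->
    ar (exe c s) aM u = (if [&& u < n, ar s aL u != 0 &
      (ar s aM u == 0) || (vr s vCost < (ar s aM u).-1)] then (vr s vCost).+1 else ar s aM u) /\
    ar (exe c s) aI u = (if [&& u < n, ar s aL u != 0 &
      (ar s aM u == 0) || (vr s vCost < (ar s aM u).-1)] then ar s aX u else ar s aI u).
  apply: (ForV_ind (P := fun i s' => forall u, u < n ->
    ar s' aM u = (if [&& u < i, ar s aL u != 0 &
      (ar s aM u == 0) || (vr s vCost < (ar s aM u).-1)] then (vr s vCost).+1 else ar s aM u) /\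
    ar s' aI u = (if [&& u < i, ar s aL u != 0 &
      (ar s aM u == 0) || (vr s vCost < (ar s aM u).-1)] then ar s aX u else ar s aI u)) G) => //.
  move=> i s1 lti S IH.
  have EL : ar s1 aL = ar s aL by rewrite S.2.
  have EX : ar s1 aX = ar s aX by rewrite S.2.
  have EK : vr s1 vCost = vr s vCost by rewrite S.1.
  have [Mi Ii] := IH i lti; rewrite ltnn /= in Mi Ii.
  have skip : (ar s aL i != 0) && ((ar s aM i == 0) || (vr s vCost < (ar s aM i).-1)) = false ->
    forall u, u < n -> ar s1 aM u = (if [&& u < i.+1, ar s aL u != 0 &
      (ar s aM u == 0) || (vr s vCost < (ar s aM u).-1)] then (vr s vCost).+1 else ar s aM u) /\
    ar s1 aI u = (if [&& u < i.+1, ar s aL u != 0 &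
      (ar s aM u == 0) || (vr s vCost < (ar s aM u).-1)] then ar s aX u else ar s aI u).
    move=> nb u ltu; rewrite ltnS leq_eqVlt; case: (u =P i) => [->|_]; last exact: IH.
    by rewrite nb /= Mi Ii.
  have upd : (ar s aL i != 0) && ((ar s aM i == 0) || (vr s vCost < (ar s aM i).-1)) = true ->
    forall u, u < n -> ar (exe cKeep (setv s1 vU i)) aM u = (if [&& u < i.+1, ar s aL u != 0 &
      (ar s aM u == 0) || (vr s vCost < (ar s aM u).-1)] then (vr s vCost).+1 else ar s aM u) /\
    ar (exe cKeep (setv s1 vU i)) aI u = (if [&& u < i.+1, ar s aL u != 0 &
      (ar s aM u == 0) || (vr s vCost < (ar s aM u).-1)] then ar s aX u else ar s aI u).
    move=> nb u ltu; rewrite /cKeep /= EK addn1 EX ltnS leq_eqVlt.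
    case: (u =P i) => [->|_]; last exact: IH.
    by rewrite nb.
  rewrite /= EL; case: (ar s aL i =P 0) => Li; first by apply: skip; rewrite Li.
  rewrite Mi; case: (ar s aM i =P 0) => M0; first by apply: upd; rewrite M0 andbT; apply/eqP.
  case: eqP => lt; rewrite EK in lt; first by apply: skip; rewrite (introF eqP M0) /=; lia.
  by apply: upd; rewrite (introF eqP M0) (introF eqP Li) /=; lia.
by move=> H u ltu; case: (H u ltu) => -> ->; rewrite ltu.
Qed.

Lemma count1P (X : pred nat) (s : seq nat) : uniq s ->
  reflect (exists2 y, y \in s /\ X y & forall z, z \in s -> X z -> z = y) (count X s == 1).
Proof.
move=> us; rewrite -size_filter; apply: (iffP idP) => [|[y [ys Xy] H]].
  case E: (filter X s) => [|y [|z r]] // _.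
  have mem z : (z \in s) && X z = (z == y) by rewrite andbC -mem_filter E inE.
  exists y => [|z zs Xz]; last by apply/eqP; rewrite -mem zs.
  by apply/andP; rewrite mem.
have -> : filter X s = filter (pred1 y) s.
  by apply: eq_in_filter => z zs /=; apply/idP/eqP => [|->//]; apply: H.
by rewrite size_filter count_uniq_mem // ys.
Qed.

Lemma dominated_onceP (X : pred nat) u :
  reflect (exists2 y, y \in u :: adjn u /\ X y & forall z, z \in u :: adjn u -> X z -> z = y)
          (dominated_once X u).
Proof. by apply: count1P; rewrite /= adj_irr adj_uniq. Qed.

Lemma sum_subseq_uniq (f : nat -> nat) (s t : seq nat) : uniq s -> {subset s <= t} ->
  \sum_(x <- s) f x <= \sum_(x <- t) f x.
Proof.
elim: s t => [|x s IH] t /=; first by rewrite big_nil.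
case/andP=> xs us st; have xt : x \in t by apply: st; rewrite inE eqxx.
rewrite big_cons (big_rem x xt) /= leq_add2l; apply: IH => // y ys.
have := st y; rewrite inE ys orbT => /(_ isT) yt.
have : y \in x :: rem x t by rewrite -(perm_mem (perm_to_rem xt)).
by rewrite inE => /predU1P[E|//]; rewrite -E ys in xs.
Qed.

(** * The exchange argument against an arbitrary efficient dominating set *)

Section Candidate.
Variables (v : nat) (L C B : nat -> nat).
Hypotheses (ltv : v < n) (lev : levels v 4 L) (near : forall u, u < n -> L u <= 4).
Hypothesis adjC : forall x y, x < n -> y \in adjn x -> L x = 4 -> L y = 4 -> C x = C y.
Hypothesis sep : separates n L C.
Hypothesis best : forall u, u < n -> best_of n L C (C u) (B (C u)).

Let nbr_refl u : u \in u :: adjn u. Proof. by rewrite inE eqxx. Qed.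

Let nbr_sym u y : u < n -> y \in u :: adjn u -> u \in y :: adjn y.
Proof. by rewrite !inE => ltu /predU1P[->|/(adj_sym ltu)->]; rewrite ?eqxx ?orbT. Qed.

Let nbr_lt u y : u < n -> y \in u :: adjn u -> y < n.
Proof. by move=> ltu; rewrite inE => /predU1P[->|/(adj_lt ltu)]. Qed.

Let Lv : L v = 1. Proof. by apply/eqP; case: lev => _ -> //; rewrite eqxx. Qed.

Lemma level1 u : u < n -> L u = 1 -> u = v.
Proof. by case: lev => _ H _ _ /H E /eqP; rewrite E => /eqP. Qed.

(** With level 5 empty, closure holds at every reached vertex. *)
Lemma level_nbr u y : u < n -> 0 < L u -> y \in adjn u -> 0 < L y <= (L u).+1.
Proof. by case: lev => _ _ _ H ltu Lu; apply: H; rewrite // Lu near. Qed.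

Lemma same_class_nbr x y z : x < n -> y < n -> z < n -> L x = 4 -> L y = 4 -> L z = 3 ->
  C x = C y -> x \in adjn z -> y \in adjn z.
Proof. by move=> ltx lty ltz Lx Ly Lz /(sep ltx lty Lx Ly)/(_ z ltz Lz) <-. Qed.

(** By [adjC], [x] and its neighbours at level 4 lie inside the class; equal size then means
    equality. *)
Lemma universalP x : x < n -> L x = 4 ->
  universal L C x <-> (forall y, y < n -> L y = 4 -> C y = C x -> y \in x :: adjn x).
Proof.
move=> ltx Lx; rewrite /universal /class_size -!size_filter addn1.
set N := [seq y <- adjn x | _]; set K := filter _ _.
have uN : uniq (x :: N) by rewrite /= mem_filter negb_and adj_irr orbT filter_uniq.
have uK : uniq K by rewrite filter_uniq ?iota_uniq.
have memK y : (y \in K) = [&& y < n, L y == 4 & C y == C x].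
  by rewrite mem_filter mem_iota add0n andbC.
have memN y : y \in x :: N -> y \in x :: adjn x.
  by rewrite !inE mem_filter => /predU1P[->|/andP[_ ->]]; rewrite ?eqxx ?orbT.
have NK : {subset x :: N <= K}.
  move=> y; rewrite memK inE mem_filter => /predU1P[->|/andP[/eqP Ly yx]].
    by rewrite ltx Lx !eqxx.
  by rewrite (adj_lt ltx yx) Ly (adjC ltx yx) ?eqxx.
split=> [E y lty Ly Cy|H].
  have [_ NKE] := uniq_min_size uN NK (eq_leq (esym E)).
  by apply: memN; rewrite NKE memK lty Ly Cy !eqxx.
apply/eqP; rewrite eqn_leq (uniq_leq_size uN NK) /=; apply: (@uniq_leq_size _ K (x :: N) uK) => y.
rewrite memK => /and3P[lty /eqP Ly /eqP Cy]; have := H y lty Ly Cy.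
by rewrite !inE mem_filter Ly.
Qed.

Definition best4 u := (L u == 4) && (B (C u) == u.+1).
Definition candidate u := (u == v) || best4 u.

Lemma candidate_level u : candidate u -> u = v \/ L u = 4.
Proof. by case/orP=> [/eqP|/andP[/eqP]]; [left|right]. Qed.

Variable D : pred nat.
Hypotheses (edD : forall u, u < n -> dominated_once D u) (Dv : D v).

Lemma ed_unique u d d' : u < n -> d \in u :: adjn u -> d' \in u :: adjn u ->
  D d -> D d' -> d = d'.
Proof.
move=> ltu du d'u Dd Dd'; case/dominated_onceP: (edD ltu) => y _ H.
by rewrite (H d du Dd) (H d' d'u Dd').
Qed.

(** A vertex of [D] at level 2 would be dominated by itself and by [v]; one at level 3 shares with
    [v] a neighbour at level 2. *)
Lemma ed_level d : d < n -> L d <> 0 -> D d -> d = v \/ L d = 4.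
Proof.
move=> ltd /eqP; rewrite -lt0n => Ld0 Dd; have := near ltd.
rewrite leq_eqVlt => /orP[/eqP|]; [by right|left].
have [/(level1 ltd)//|L1] := L d =P 1.
have [|p [ltp dp pd Lp]] := level_parent lev ltd; first lia.
have [Lp1|Lp2] : L p = 1 \/ L p = 2 by lia.
  have Ep := level1 ltp Lp1; rewrite Ep in pd.
  by apply: (@ed_unique d) => //; rewrite inE pd orbT.
have [|q [ltq pq qp Lq]] := level_parent lev ltp; first by rewrite Lp2.
have Eq : q = v by apply: level1 ltq _; rewrite Lq Lp2.
by apply: (@ed_unique p) => //; rewrite inE ?dp -?Eq ?qp orbT.
Qed.

(** The dominator of [x] is reached and is not [v], which is too far away; so it is at level 4, and
    edges there stay inside classes. *)
Lemma ed_class x : x < n -> L x = 4 ->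
  exists d, [/\ d < n, L d = 4, D d, C d = C x & d \in x :: adjn x].
Proof.
move=> ltx Lx; case/dominated_onceP: (edD ltx) => d [dx Dd] _.
have ltd := nbr_lt ltx dx; exists d.
have Ld0 : L d <> 0.
  move: dx; rewrite inE => /predU1P[->|dx]; first by rewrite Lx.
  by have := level_nbr ltx _ dx; rewrite Lx; lia.
have [Ed|Ld] := ed_level ltd Ld0 Dd.
  move: dx; rewrite Ed inE => /predU1P[Ev|/(adj_sym ltx) xv]; first by move: Lv; rewrite Ev Lx.
  by have := level_nbr ltv _ xv; rewrite Lv Lx => /(_ isT).
split=> //; move: dx; rewrite inE => /predU1P[->//|dx].
by rewrite (adjC ltx dx).
Qed.

(** Members of a class have the same neighbours at level 3, and such a neighbour would be dominated
    twice. *)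
Lemma ed_class_unique d d' : d < n -> d' < n -> L d = 4 -> L d' = 4 -> D d -> D d' ->
  C d = C d' -> d = d'.
Proof.
move=> ltd ltd' Ld Ld' Dd Dd' E.
have [|z [ltz dz _ Lz]] := level_parent lev ltd; first by rewrite Ld.
rewrite Ld in Lz; apply: (@ed_unique z) => //; rewrite inE ?dz ?orbT //.
by rewrite (same_class_nbr _ _ _ _ _ _ E) ?orbT.
Qed.

(** Each member of the class is dominated from within the class, where [D] has only one vertex. *)
Lemma ed_universal d : d < n -> L d = 4 -> D d -> universal L C d.
Proof.
move=> ltd Ld Dd; apply/universalP => // x ltx Lx Cx.
have [d' [ltd' Ld' Dd' Cd' d'x]] := ed_class ltx Lx.
have <- : d' = d by apply: ed_class_unique; rewrite // Cd'.
exact: nbr_sym.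
Qed.

Lemma class_best x : x < n -> L x = 4 ->
  exists d b, [/\ [/\ d < n, L d = 4, D d, C d = C x & d \in x :: adjn x],
    [/\ b < n, L b = 4 & C b = C x], candidate b,
    x \in b :: adjn b & B (C x) = b.+1 /\ w b <= w d].
Proof.
move=> ltx Lx; have [d [ltd Ld Dd Cd dx]] := ed_class ltx Lx.
have [B1 B2] := best ltx; have [B0 wb] := B1 d ltd Ld Cd (ed_universal ltd Ld Dd).
have BE : B (C x) = (B (C x)).-1.+1 by rewrite prednK // lt0n; apply/eqP.
have := B2 B0; move: (B (C x)).-1 BE wb => b BE wb [ltb Lb Cb Ub]; exists d, b; split=> //.
  by rewrite /candidate /best4 Lb Cb BE !eqxx orbT.
by have [/(_ Ub) H _] := universalP ltb Lb; apply: H.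
Qed.

Lemma class_best_unique z b : L z = 4 -> candidate z -> B (C z) = b.+1 -> z = b.
Proof.
move=> Lz; rewrite /candidate /best4; case: eqP => [E|_] /=; first by rewrite E Lv in Lz.
by case/andP=> _ /eqP-> [].
Qed.

(** Levels 1 and 2 are dominated by [v] alone. At level 3, replacing a vertex of [D] by the best one
    of its class changes nothing, as both have the same neighbours there; at level 4, universality
    of the best vertex does the work. *)
Lemma candidate_ed u : u < n -> L u <> 0 -> dominated_once candidate u.
Proof.
move=> ltu Lu0; apply/dominated_onceP.
have Lu : 0 < L u by rewrite lt0n; apply/eqP.
have cv : candidate v by rewrite /candidate eqxx.
have [u1|u1] := L u =P 1.
  rewrite (level1 ltu u1); exists v => // z; rewrite inE => /predU1P[//|zv].
  case/candidate_level=> // Lz; have := level_nbr ltv _ zv.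
  by rewrite Lv Lz => /(_ isT).
have vu : L u = 2 \/ v \notin adjn u.
  case: (boolP (v \in adjn u)) => [/(adj_sym ltu)/(level_nbr ltv)|]; last by right.
  by rewrite Lv; left; lia.
have [u2|u2] := L u =P 2.
  have [|q [ltq uq qu Lq]] := level_parent lev ltu; first by rewrite u2.
  rewrite u2 in Lq; have Eq := level1 ltq Lq; rewrite Eq in qu.
  exists v; first by rewrite inE qu orbT.
  move=> z; rewrite inE => /predU1P[->|zu] /candidate_level[]// Lz.
    by rewrite Lz in u2.
  by have := level_nbr ltu Lu zu; rewrite Lz u2.
case: vu => // vu.
have nuv : u <> v by move=> E; rewrite E Lv in u1.
have [u3|u3] := L u =P 3.
  have inadj z : z \in u :: adjn u -> candidate z \/ D z -> L z = 4 /\ z \in adjn u.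
    rewrite inE => /predU1P[->|zu] cz.
      case: cz => [/candidate_level[]//|/(ed_level ltu Lu0)[]//]; by rewrite u3.
    have ltz := adj_lt ltu zu; have := level_nbr ltu Lu zu; case: cz => cz Lz; split=> //.
      by case: (candidate_level cz) => // E; rewrite -E zu in vu.
    by case: (@ed_level z ltz) => //; [lia|move=> E; rewrite -E zu in vu].
  case/dominated_onceP: (edD ltu) => d [du Dd] _.
  have [Ld {}du] := inadj d du (or_intror Dd); have ltd := adj_lt ltu du.
  have [d1 [b [[_ _ _ _ _] [ltb Lb Cb] cb _ [BE _]]]] := class_best ltd Ld.
  exists b; first by rewrite inE (same_class_nbr ltd ltb ltu Ld Lb u3) ?orbT.
  (* Another candidate next to [u] brings the vertex [e] of [D] in its class, also next to [u]; so
     [e] is [d] and the classes agree. *)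
  move=> z zu cz; have [Lz {}zu] := inadj z zu (or_introl cz).
  have ltz := adj_lt ltu zu.
  have [e [lte Le De Ce _]] := ed_class ltz Lz.
  have eu : e \in adjn u by apply: (same_class_nbr ltz) zu.
  have Ee : e = d by apply: (@ed_unique u); rewrite // inE ?eu ?du orbT.
  by apply: class_best_unique => //; rewrite -Ce Ee.
have u4 : L u = 4 by have := near ltu; lia.
have [d [b [_ [ltb Lb Cb] cb ub [BE _]]]] := class_best ltu u4.
exists b; first by split=> //; apply: nbr_sym.
move=> z zu cz; have ltz := nbr_lt ltu zu.
case: (candidate_level cz) => [E|Lz].
  by move: zu; rewrite E inE (negbTE vu) orbF => /eqP Ev; case: nuv.
apply: class_best_unique => //; rewrite -BE; congr B.
by move: zu; rewrite inE => /predU1P[->//|zu]; rewrite (adjC ltu zu).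
Qed.

Lemma candidate_weight :
  w v + \sum_(u <- iota 0 n | best4 u) w u <=
  \sum_(u <- iota 0 n | (L u != 0) && D u) w u.
Proof.
have mem_t a u : (u \in [seq u <- iota 0 n | a u]) = (u < n) && a u.
  by rewrite mem_filter mem_iota andbC.
rewrite -big_filter -[X in _ <= X]big_filter.
set s := [seq u <- iota 0 n | best4 u].
have -> : w v + \sum_(u <- s) w u = \sum_(u <- v :: s) w u by rewrite big_cons.
set t := [seq u <- iota 0 n | (L u != 0) && D u].
(* [f] replaces the vertex of [D] in a class by the best one and fixes [v]: it never increases the
   weight, and its image contains the candidate. *)
pose f d := if L d == 4 then (B (C d)).-1 else d.
apply: (@leq_trans (\sum_(d <- t) w (f d))).
  rewrite -(big_map f predT w); apply: sum_subseq_uniq.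
    by rewrite /= mem_t /best4 Lv /= andbF filter_uniq ?iota_uniq.
  move=> u; rewrite inE mem_t => /predU1P[->|/and3P[ltu /eqP Lu Bu]].
    by apply/mapP; exists v; rewrite ?mem_t ?ltv ?Lv ?Dv // /f Lv.
  have [d [ltd Ld Dd Cd _]] := ed_class ltu Lu.
  by apply/mapP; exists d; rewrite ?mem_t ?ltd ?Ld ?Dd // /f Ld Cd (eqP Bu).
rewrite !big_seq; apply: leq_sum => d; rewrite mem_t => /and3P[ltd _ Dd].
rewrite /f; case: eqP => // Ld.
have [e [b [[lte Le De Ce _] _ _ _ [-> wb]]]] := class_best ltd Ld.
by rewrite /= (@ed_class_unique d e).
Qed.
End Candidate.

(** * Components and the loop over all vertices *)

Variable cid : nat -> nat.
Hypothesis cid_adj : forall u y, u < n -> y \in adjn u -> cid y = cid u.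
(** Equal identifiers mean connected vertices; this is phrased as induction along a path, in the
    form in which it is used. *)
Hypothesis cid_min : forall (X : nat -> Prop) u y, u < n -> y < n ->
  (forall x z, x < n -> z \in adjn x -> X x -> X z) -> X u -> cid y = cid u -> X y.

Definition weight_in (P : pred nat) (c : nat) : nat :=
  \sum_(x <- iota 0 n | (cid x == c) && P x) w x.

Definition eff_dom (D : pred nat) : Prop := forall u, u < n -> dominated_once D u.

(** The candidate [X] is abstract, so the main loop need not know how it was built. Once the flag is
    raised, nothing is claimed about recorded candidates. *)
Record tried (s s' : st) (v : nat) : Prop := Tried {
  tried_new : forall c, ar s' aNew c <= vr s' vFr;
  tried_bad : vr s' vBad <> 0 -> vr s vBad <> 0 \/ path5;
  tried_ok : vr s' vBad = 0 -> vr s vBad = 0 /\ exists (ok : bool) (X : pred nat),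
    [/\ ok -> forall u, u < n -> cid u = cid v -> dominated_once X u,
        forall D, eff_dom D -> D v -> ok /\ weight_in X (cid v) <= weight_in D (cid v) &
        forall u, u < n -> let k := weight_in X (cid v) in
          let better := [&& ok, cid u == cid v & (ar s aM u == 0) || (k < (ar s aM u).-1)] in
          ar s' aM u = (if better then k.+1 else ar s aM u) /\
          (ar s' aI u != 0) = (if better then X u else ar s aI u != 0)] }.

(** The reached set is closed under adjacency because level 5 is empty; conversely, parents lead
    back to [v]. *)
Lemma reached_component v L u : v < n -> levels v 4 L -> (forall u, u < n -> L u <= 4) ->
  u < n -> (L u != 0) = (cid u == cid v).
Proof.
move=> ltv lev near ltu; apply/idP/eqP; last first.
  apply: (cid_min (X := fun x => L x != 0)) => // [x y ltx yx|].
    by rewrite -!lt0n => Lx; case/andP: (level_nbr lev near ltx Lx yx).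
  by case: lev => _ /(_ v ltv) + _ _; rewrite eqxx => /eqP->.
have : L u <= 4 by apply: near.
elim: {1}4 u ltu => [|k IH] u ltu; first by rewrite leqn0 => ->.
move=> leu Lu0; have [/(level1 lev ltu)->//|L1] := L u =P 1.
have [|p [ltp up pu Lp]] := level_parent lev ltu; first lia.
by rewrite (cid_adj ltp up); apply: IH => //; lia.
Qed.

Lemma cTryP s : graph_in s -> vr s vV < n -> (forall c, ar s aNew c <= vr s vFr) ->
  tried s (exe cTry s) (vr s vV).
Proof.
move=> G ltv New; set v := vr s vV in ltv *.
rewrite /cTry exe_chain.
(* Intermediate states become opaque existential witnesses, lest simplification unfold all phases
   run so far. *)
have [s1 E1] : exists s1, s1 = exe cInit s by eexists.
rewrite -E1; have S1 : same cInit s s1 by rewrite E1; apply: exe_same.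
have G1 : graph_in s1 by rewrite E1; apply: pres_in.
have [s2 E2] : exists s2, s2 = exe cLevels s1 by eexists.
rewrite -E2; have S2 : same cLevels s1 s2 by rewrite E2; apply: exe_same.
have G2 : graph_in s2 by rewrite E2; apply: pres_in.
have [s3 E3] : exists s3, s3 = exe cFar s2 by eexists.
rewrite -E3; have S3 : same cFar s2 s3 by rewrite E3; apply: exe_same.
have G3 : graph_in s3 by rewrite E3; apply: pres_in.
have [s4 E4] : exists s4, s4 = exe cRefine s3 by eexists.
rewrite -E4; have S4 : same cRefine s3 s4 by rewrite E4; apply: exe_same.
have G4 : graph_in s4 by rewrite E4; apply: pres_in.
have [s5 E5] : exists s5, s5 = exe cReset s4 by eexists.
rewrite -E5; have S5 : same cReset s4 s5 by rewrite E5; apply: exe_same.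
have G5 : graph_in s5 by rewrite E5; apply: pres_in.
have [s6 E6] : exists s6, s6 = exe cSize s5 by eexists.
rewrite -E6; have S6 : same cSize s5 s6 by rewrite E6; apply: exe_same.
have G6 : graph_in s6 by rewrite E6; apply: pres_in.
have [s7 E7] : exists s7, s7 = exe cBest s6 by eexists.
rewrite -E7; have S7 : same cBest s6 s7 by rewrite E7; apply: exe_same.
have G7 : graph_in s7 by rewrite E7; apply: pres_in.
have [s8 E8] : exists s8, s8 = exe cMark s7 by eexists.
rewrite -E8; have S8 : same cMark s7 s8 by rewrite E8; apply: exe_same.
have G8 : graph_in s8 by rewrite E8; apply: pres_in.
have [s9 E9] : exists s9, s9 = exe cCheck s8 by eexists.
rewrite -E9; have S9 : same cCheck s8 s9 by rewrite E9; apply: exe_same.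
have G9 : graph_in s9 by rewrite E9; apply: pres_in.
have [s10 E10] : exists s10, s10 = exe cUpdate s9 by eexists.
rewrite -E10; have S10 : same cUpdate s9 s10 by rewrite E10; apply: exe_same.
have [IL IC IX IF] := cInitP G ltv; rewrite -E1 in IL IC IX IF.
have lev := cLevelsP G1 ltv IL; rewrite -E2 in lev.
have [far0 far1] := cFarP G2 lev; rewrite -E3 in far0 far1.
have L3 : ar s3 aL = ar s2 aL by rewrite S3.2.
have C3 : ar s3 aC = ar s1 aC by rewrite S3.2 // S2.2 //.
have F3 : vr s3 vFr = vr s1 vFr by rewrite S3.1 // S2.1 //.
have N3 : ar s3 aNew = ar s aNew by rewrite S3.2 // S2.2 // S1.2 //.
have fr3 : fresh_ok s3.
  split=> [x ltx|c]; first by rewrite C3 F3 IC.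
  by rewrite N3 F3 IF; apply: leqW.
have [|sep [C4 N4]] := cRefineP G3 fr3; first by move=> x y ltx lty; rewrite C3 !IC.
rewrite -E4 L3 in sep C4 N4.
have reset := cResetP G4; rewrite -E5 in reset.
have C5 : ar s5 aC = ar s4 aC by rewrite S5.2.
have size5 := cSizeP G5; rewrite C5 -E6 in size5.
have {}size5 := size5 (fun u ltu => (reset u ltu).1).
have C6 : ar s6 aC = ar s4 aC by rewrite S6.2 //.
have L5 : ar s5 aL = ar s2 aL by rewrite S5.2 // S4.2 //.
have L6 : ar s6 aL = ar s2 aL by rewrite S6.2 //.
have B6 u : u < n -> ar s6 aB (ar s4 aC u) = 0.
  by rewrite S6.2 // => ltu; case: (reset u ltu).
have := cBestP G6; rewrite /= L6 C6 -E7; case.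
- move=> x y ltx yx Lx Ly nC.
  have lty := adj_lt ltx yx.
  (* Different classes differ on some [z] at level 3; whichever end of the edge is next to [z],
     there is an induced path. *)
  have [/hasP[z]|/hasPn H] := boolP (has (fun z => (ar s2 aL z == 3) &&
      ((x \in adjn z) != (y \in adjn z))) (iota 0 n)); last first.
    case: nC; apply/(sep x y ltx lty Lx Ly) => z ltz Lz.
    by have := H z; rewrite mem_iota Lz eqxx negbK => /(_ ltz)/eqP.
  rewrite mem_iota => /= ltz /andP[/eqP Lz].
  case: (boolP (x \in adjn z)) => xz; case: (boolP (y \in adjn z)) => // yz _.
    exact: (split_path5 lev ltz ltx Lz Lx Ly xz yx yz).
  by apply: (split_path5 lev ltz lty Lz Ly Lx yz _ xz); apply: adj_sym yx.
- by move=> u ltu; rewrite size5 // L5.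
- exact: B6.
move=> adjC bad7 best.
have L8 : ar s8 aL = ar s2 aL by rewrite S8.2 // S7.2 //.
have L7 : ar s7 aL = ar s2 aL by rewrite S7.2 //.
have C7 : ar s7 aC = ar s4 aC by rewrite S7.2 //.
have V7 : vr s7 vV = v by rewrite S7.1 // S6.1 // S5.1 // S4.1 // S3.1 // S2.1 // S1.1 //.
have X7 u : u < n -> ar s7 aX u = 0.
  by rewrite S7.2 // S6.2 // S5.2 // S4.2 // S3.2 // S2.2 //; apply: IX.
have Lv : ar s7 aL v <> 4.
  by rewrite L7; case: lev => _ /(_ v ltv) + _ _; rewrite eqxx => /eqP->.
have := cMarkP G7; rewrite V7 => /(_ ltv Lv X7); rewrite -E8 L7 C7 => -[mark cost].
have check := cCheckP G8; rewrite -E9 L8 in check.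
have update := cUpdateP G9; rewrite -E10 in update.
have Bad10 : vr s10 vBad = vr s7 vBad by rewrite S10.1 // S9.1 // S8.1 //.
have Bad6 : vr s6 vBad = vr s3 vBad by rewrite S6.1 // S5.1 // S4.1 //.
have Bad2 : vr s2 vBad = vr s vBad by rewrite S2.1 // S1.1 //.
split.
- move=> c; have -> : ar s10 aNew = ar s4 aNew.
    by rewrite S10.2 // S9.2 // S8.2 // S7.2 // S6.2 // S5.2 //.
  by have -> : vr s10 vFr = vr s4 vFr by rewrite S10.1 // S9.1 // S8.1 // S7.1 // S6.1 // S5.1 //.
- rewrite Bad10 => /bad7[|]; last by right.
  by rewrite Bad6 => /far1; rewrite Bad2.
rewrite Bad10 => /adjC[]; rewrite Bad6 => /far0[]; rewrite Bad2 => b0 near {}adjC.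
split=> //.
set L := ar s2 aL in lev near adjC best mark check sep cost.
set C := ar s4 aC in adjC best mark sep cost.
pose B := ar s7 aB.
have comp u : u < n -> (L u != 0) = (cid u == cid v) := reached_component ltv lev near.
exists (vr s9 vOk != 0), (candidate v L C B).
have EX u : u < n -> (ar s8 aX u != 0) = candidate v L C B u by apply: mark.
have dom u : u < n -> dominated_once (fun y => ar s8 aX y != 0) u = dominated_once (candidate v L C B) u.
  move=> ltu; congr (_ == 1); apply: eq_in_count => y; rewrite inE => yu; apply: EX.
  by case/predU1P: yu => [->|/(adj_lt ltu)].
have K : vr s9 vCost = weight_in (candidate v L C B) (cid v).
  have -> : vr s9 vCost = vr s8 vCost by rewrite S9.1 //.
  rewrite cost /weight_in -[RHS]big_filter.
  (* [v] is not at level 4, hence not among the best vertices, and its weight is counted once. *)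
  have PE : perm_eq [seq x <- iota 0 n | (cid x == cid v) && candidate v L C B x]
                    (v :: [seq u <- iota 0 n | best4 L C B u]).
    apply: uniq_perm; rewrite ?filter_uniq ?iota_uniq //=.
      rewrite filter_uniq ?iota_uniq // mem_filter /best4 andbT.
      by case: eqP => // E; case: Lv; rewrite L7.
    move=> u; rewrite inE !mem_filter mem_iota add0n /=.
    rewrite /candidate; case: (u =P v) => [->|_] /=; first by rewrite eqxx ltv.
    case: ltnP => ltu; rewrite ?andbF // !andbT -comp // /best4.
    by case: eqP => [->|]; rewrite ?andbF.
  by rewrite (perm_big _ PE) big_cons big_filter.
split.
- move=> /eqP/check H u ltu Cu; rewrite -dom //; apply: H => //; apply/eqP.
  by rewrite comp // Cu.
- move=> D edD Dv; split.
    apply/eqP/check => u ltu Lu; rewrite dom //.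
    exact: (candidate_ed ltv lev near adjC sep best edD Dv ltu Lu).
  rewrite -K; have -> : vr s9 vCost = vr s8 vCost by rewrite S9.1 //.
  rewrite cost; apply: leq_trans (candidate_weight ltv lev near adjC sep best edD Dv) _.
  rewrite /weight_in big_seq_cond [X in _ <= X]big_seq_cond; apply: eq_leq.
  apply: eq_bigl => x; rewrite mem_iota add0n /=; case: ltnP => //= ltx.
  by rewrite comp.
move=> u ltu; have [-> ->] := update u ltu; rewrite K.
have -> : ar s9 aM = ar s aM by rewrite S9.2 // S8.2 // S7.2 // S6.2 // S5.2 // S4.2 // S3.2 // S2.2 // S1.2 //.
have -> : ar s9 aI = ar s aI by rewrite S9.2 // S8.2 // S7.2 // S6.2 // S5.2 // S4.2 // S3.2 // S2.2 // S1.2 //.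
have -> : ar s9 aX = ar s8 aX by rewrite S9.2 //.
have -> : ar s9 aL = L by rewrite S9.2 //.
by rewrite comp //; split=> //; case: ifP => // _; apply: EX.
Qed.

(** [M] is a weight plus 1, with 0 for no candidate. Its constancy on components keeps the part of
    [I] in a component the result of a single try. *)
Definition good (i : nat) (M I : nat -> nat) : Prop :=
  [/\ forall u y, u < n -> y \in adjn u -> M y = M u,
      forall u, u < n -> M u <> 0 ->
        dominated_once (fun y => I y != 0) u /\ M u = (weight_in (fun y => I y != 0) (cid u)).+1 &
      forall v D, v < i -> eff_dom D -> D v -> M v <> 0 /\ M v <= (weight_in D (cid v)).+1].

Lemma weight_in_eq (X Y : pred nat) c :
  (forall x, x < n -> cid x = c -> X x = Y x) -> weight_in X c = weight_in Y c.
Proof.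
move=> E; rewrite /weight_in big_seq_cond [RHS]big_seq_cond; apply: eq_bigl => x.
by rewrite mem_iota add0n /=; case: ltnP => //= ltx; case: eqP => //= /(E x ltx).
Qed.

Lemma dominated_once_eq (X Y : pred nat) u : u < n ->
  (forall x, x < n -> cid x = cid u -> X x = Y x) -> dominated_once X u = dominated_once Y u.
Proof.
move=> ltu E; congr (_ == 1); apply: eq_in_count => y; rewrite inE => /predU1P[->|yu].
  exact: E.
by apply: E; [apply: adj_lt yu|apply: cid_adj].
Qed.

Lemma good_component i M I u y : good i M I -> u < n -> y < n -> cid y = cid u -> M y = M u.
Proof.
case=> Ma _ _ ltu lty E; apply: (cid_min (X := fun y => M y = M u)) E => // x z ltx zx <-.
exact: Ma.
Qed.

Lemma good_step i M I M' I' (ok : bool) (X : pred nat) : i < n -> good i M I ->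
  (ok -> forall u, u < n -> cid u = cid i -> dominated_once X u) ->
  (forall D, eff_dom D -> D i -> ok /\ weight_in X (cid i) <= weight_in D (cid i)) ->
  (forall u, u < n -> let k := weight_in X (cid i) in
    let better := [&& ok, cid u == cid i & (M u == 0) || (k < (M u).-1)] in
    M' u = (if better then k.+1 else M u) /\
    (I' u != 0) = (if better then X u else I u != 0)) ->
  good i.+1 M' I'.
Proof.
move=> lti H okX bestX upd; have [Ma Mb Md] := H.
set k := weight_in X (cid i) in bestX upd.
(* As [M] is constant on the component of [i], the comparison has one outcome there: the old
   candidate is kept or replaced as a whole. *)
pose up := ok && ((M i == 0) || (k < (M i).-1)).
have {}upd u : u < n -> M' u = (if (cid u == cid i) && up then k.+1 else M u) /\
    (I' u != 0) = (if (cid u == cid i) && up then X u else I u != 0).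
  move=> ltu; have [-> ->] := upd u ltu.
  case: eqP => [/(good_component H lti ltu) ->|_]; last by rewrite andbF.
  by rewrite andTb.
have updI u : u < n -> up -> cid u = cid i -> weight_in (fun y => I' y != 0) (cid u) = k.
  move=> ltu Up Cu; rewrite Cu; apply: weight_in_eq => x ltx Cx.
  by case: (upd x ltx) => _ ->; rewrite Cx eqxx Up.
split=> [u y ltu yu|u ltu|v D].
- have [-> _] := upd y (adj_lt ltu yu); have [-> _] := upd u ltu.
  by rewrite (cid_adj ltu yu) (Ma u y).
- have [-> _] := upd u ltu; case: ifP => [/andP[/eqP Cu Up] _|nup].
    rewrite updI //; split=> //; case/andP: (Up) => Ok _.
    rewrite (dominated_once_eq (Y := X) ltu) => [|x ltx Cx]; first exact: okX.
    by case: (upd x ltx) => _ ->; rewrite Cx Cu eqxx Up.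
  have Ieq x : x < n -> cid x = cid u -> (I' x != 0) = (I x != 0).
    by move=> ltx Cx; case: (upd x ltx) => _ ->; rewrite Cx nup.
  move=> Mu; have [domI ->] := Mb u ltu Mu; rewrite (weight_in_eq Ieq); split=> //.
  by rewrite (dominated_once_eq ltu Ieq).
- rewrite ltnS leq_eqVlt => /predU1P[->|ltv] edD Dv.
    have [-> _] := upd i lti; have [Ok leD] := bestX D edD Dv.
    rewrite eqxx /up Ok /=; case: ifP => [_|/norP[/eqP M0 /negP lt]]; first by [].
    by split=> //; move: lt; lia.
  have ltvn : v < n by apply: ltn_trans lti.
  have [M0 leM] := Md v D ltv edD Dv; have [-> _] := upd v ltvn.
  case: ifP => [/andP[/eqP Cv Up]|//]; split=> //.
  rewrite (good_component H lti ltvn Cv) in M0 leM.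
  by case/andP: Up => _; lia.
Qed.

Definition outcome (code : nat) (I : nat -> nat) : Prop :=
  [\/ code = 0 /\ path5,
      code = 1 /\ (forall D, ~ eff_dom D)
    | code = 2 /\ (eff_dom (fun y => I y != 0) /\ forall D, eff_dom D ->
        \sum_(x <- iota 0 n | I x != 0) w x <= \sum_(x <- iota 0 n | D x) w x)].

Lemma sum_components (P : pred nat) :
  \sum_(x <- iota 0 n | P x) w x = \sum_(c <- undup (map cid (iota 0 n))) weight_in P c.
Proof.
rewrite /weight_in (exchange_big_dep P) => [|c x _ /andP[]//].
rewrite big_seq_cond [RHS]big_seq_cond; apply: eq_bigr => x /andP[xn Px].
rewrite (eq_bigl (pred1 (cid x))) => [|c]; last by rewrite Px andbT eq_sym.
by rewrite -big_filter filter_pred1_uniq ?undup_uniq ?mem_undup ?map_f // big_seq1.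
Qed.

(** In each component some vertex of [D] has been tried, so the recorded weight is at most the
    weight of [D] there. *)
Lemma good_optimal M I : good n M I -> (forall u, u < n -> M u <> 0) ->
  eff_dom (fun y => I y != 0) /\ forall D, eff_dom D ->
    \sum_(x <- iota 0 n | I x != 0) w x <= \sum_(x <- iota 0 n | D x) w x.
Proof.
case=> Ma Mb Md M0; split=> [u ltu|D edD]; first by case: (Mb u ltu (M0 u ltu)).
rewrite !sum_components big_seq [X in _ <= X]big_seq; apply: leq_sum => c.
rewrite mem_undup => /mapP[u]; rewrite mem_iota add0n /= => ltu ->.
case/dominated_onceP: (edD u ltu) => d [du Dd] _.
have [ltd Cd] : d < n /\ cid d = cid u.
  move: du; rewrite inE => /predU1P[->//|du].
  by split; [apply: adj_lt du|apply: cid_adj].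
have [_ Md'] := Mb d ltd (M0 d ltd).
by have [_] := Md d D ltd edD Dd; rewrite Md' ltnS Cd.
Qed.

Lemma cMainP s : graph_in s -> (forall c, ar s aNew c = 0) -> (forall u, ar s aM u = 0) ->
  outcome (vr (exe cMain s) vCode) (ar (exe cMain s) aI).
Proof.
move=> G New0 M0; rewrite /cMain.
have chain c1 c2 c3 c4 c5 s0 : exe (Seq c1 (Seq c2 (Seq c3 (Seq c4 c5)))) s0 =
  exe c5 (exe c4 (exe c3 (exe c2 (exe c1 s0)))) by [].
rewrite chain {chain}.
have [s1 E1] : exists s1, s1 = exe (Seq (Asg vBad (Cst 0)) (Asg vFr (Cst 0))) s by eexists.
rewrite -E1; have G1 : graph_in s1 by rewrite E1; apply: pres_in.
have [Bad1 F1] : vr s1 vBad = 0 /\ vr s1 vFr = 0 by rewrite E1.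
have New1 c : ar s1 aNew c = 0 by rewrite E1; apply: New0.
have M1 u : ar s1 aM u = 0 by rewrite E1; apply: M0.
have [s2 E2] : exists s2, s2 = exe (For vV (Var vN) cVertex) s1 by eexists.
rewrite -E2; have G2 : graph_in s2 by rewrite E2; apply: pres_in.
pose P i s' := [/\ forall c, ar s' aNew c <= vr s' vFr,
  vr s' vBad <> 0 -> path5 & vr s' vBad = 0 -> good i (ar s' aM) (ar s' aI)].
have {E2 New1 M1 F1 Bad1} : P n s2.
  have EN : eval (Var vN) s1 = n by case: G1.
  rewrite E2 -{1}EN; apply: For_ind => [|i s3]; rewrite ?EN.
    by split=> [c|//|_]; [rewrite New1|split=> // u y; rewrite !M1].
  move=> lti S3 [New3 Bad3 Good3].
  have G3 : graph_in (setv s3 vV i) by apply: graph_in_setv; apply: graph_in_same S3 G1.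
  have deg : ar s3 aD i = size (adjn i) by case: G3 => _ /(_ i lti)[].
  have Wi : ar s3 aW i = w i by case: G3 => _ /(_ i lti)[].
  rewrite /cVertex exe_if [eval _ _]/= deg; case: eqP => d0; last first.
    have := @cTryP (setv s3 vV i) G3 lti New3.
    move: (exe cTry _) => s4 [New4 Bad4 Ok4].
    split; first exact: New4.
      by move=> bad; case: (Bad4 bad) => //; apply: Bad3.
    move=> bad; have [/= b0 [ok [X [okX bestX upd]]]] := Ok4 bad.
    exact: (good_step lti (Good3 b0) okX bestX upd).
  have {d0} adj0 := size0nil d0.
  split=> // b0; have H := Good3 b0.
  have alone u : u < n -> (cid u == cid i) = (u == i).
    move=> ltu; apply/eqP/eqP => [|->//].
    apply: (cid_min (X := fun u => u = i)) => // x z _ + E; rewrite E adj0; by [].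
  have weight1 (X : pred nat) : weight_in X (cid i) = if X i then w i else 0.
    rewrite /weight_in big_mkcondr big_seq_cond.
    rewrite (eq_bigl (pred1 i)) => [|x]; last first.
      rewrite mem_iota add0n /=; case: ltnP => [ltx|lenx]; first by rewrite alone.
      by case: (x =P i) => // E; move: lenx; rewrite E leqNgt lti.
    by rewrite -big_filter filter_pred1_uniq ?iota_uniq ?mem_iota ?add0n // big_seq1.
  apply: (good_step (ok := true) (X := pred1 i) lti H).
  - move=> _ u ltu /eqP; rewrite alone // => /eqP->.
    by rewrite /dominated_once adj0 /= eqxx.
  - by move=> D edD Di; rewrite !weight1 /= eqxx Di.
  move=> u ltu; rewrite weight1 /= eqxx alone //; case: (u =P i) => [->|_] //=.
  (* The program overwrites without comparing; a candidate already recorded at an isolated vertex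
     must be that vertex itself, with the same weight. *)
  rewrite Wi addn1; case: ifP => [_|/norP[M0i ltM]]; first by [].
  have [_ Hb _] := H; have [] := Hb i lti; first by apply/eqP.
  rewrite /dominated_once adj0 weight1 /=; case: (ar s3 aI i == 0) => //= _ Mi.
case=> _ Bad2 Good2.
set s3 := exe (Asg vCode (Cst 2)) s2.
have G3 : graph_in s3 by apply: pres_in.
set s4 := exe _ s3.
have [s4E M4 I4] : [/\ vr s4 vBad = vr s2 vBad, ar s4 aM = ar s2 aM & ar s4 aI = ar s2 aI].
  by rewrite /s4 exe_vr // !exe_ar.
have : (vr s4 vCode = 2 /\ forall u, u < n -> ar s2 aM u <> 0) \/
       (vr s4 vCode = 1 /\ exists2 u, u < n & ar s2 aM u = 0).
  apply: (ForV_ind (P := fun i s' =>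
    (vr s' vCode = 2 /\ forall u, u < i -> ar s2 aM u <> 0) \/
    (vr s' vCode = 1 /\ exists2 u, u < n & ar s2 aM u = 0)) G3).
    by left.
  move=> i s5 lti S5 IH /=; have -> : ar s5 aM = ar s2 aM by rewrite S5.2.
  case: eqP => Mi /=; first by right; split=> //; exists i.
  case: IH => [[-> H]|]; [left|by right]; split=> // u.
  by rewrite ltnS leq_eqVlt => /predU1P[->|/H].
clearbody s4; rewrite /= s4E; case: eqP => [/Good2 H|/Bad2 p5]; last by constructor 1.
case=> [[-> Mn0]|[-> [u ltu Mu]]].
  by constructor 3; split=> //; rewrite I4; apply: good_optimal H Mn0.
constructor 2; split=> // D edD.
(* The dominator of [u] has been tried, so it has a candidate recorded, and then so has [u]. *)
case/dominated_onceP: (edD u ltu) => d [du Dd] _.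
have [Ma _ Md] := H.
have [ltd Ed] : d < n /\ ar s2 aM d = ar s2 aM u.
  move: du; rewrite inE => /predU1P[->//|du].
  by split; [apply: adj_lt du|apply: Ma].
by case: (Md d D ltd edD Dd); rewrite Ed Mu.
Qed.

(** * Running time of the main loop *)

Definition vertex_cost : nat := kcost 4 cVertex + 10.
Definition main_cost : nat := 10 * vertex_cost + kcost 4 cMain + 10.

(** A full try is charged to the edges at [i]: a vertex that is not isolated has degree at least 1.
    Summed over [i], the [1 + n] is multiplied by the degree sum and not by [n]. *)
Lemma cVertex_cost s i : i < n -> graph_in s -> vr s vV = i ->
  tcmd 4 cVertex s <= vertex_cost * (1 + size (adjn i) * (1 + n) + deg_sum n adjn).
Proof.
move=> lti G Vi; have deg : ar s aD i = size (adjn i) by case: G => _ /(_ i lti)[].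
have -> : tcmd 4 cVertex s = size (cexp 4 (At aD vV) 0) + 2 +
  (if size (adjn i) == 0 then tcmd 4 (Seq (Wr aM (Var vV) (Add (At aW vV) (Cst 1))) (Wr aI (Var vV) (Cst 1))) s
   else tcmd 4 cTry s) by rewrite -deg -Vi.
have H1 : tcmd 4 cTry s <= kcost 4 cTry * (1 + n + deg_sum n adjn).
  exact: (@linear_cost n w).
have H2 := @flat_cost 4 (Seq (Wr aM (Var vV) (Add (At aW vV) (Cst 1))) (Wr aI (Var vV) (Cst 1))) s isT.
have -> : vertex_cost = size (cexp 4 (At aD vV) 0) + 2 + (kcost 4 cTry +
  kcost 4 (Seq (Wr aM (Var vV) (Add (At aW vV) (Cst 1))) (Wr aI (Var vV) (Cst 1)))) + 10 by [].
move: H1 H2; move: (kcost 4 cTry) (kcost 4 (Seq _ _)) (size (cexp _ _ _)) (tcmd 4 cTry s) (tcmd 4 (Seq _ _) s).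
move=> K1 K2 z t1 t2 H1 H2; case: eqP => d0; first by nia.
set L := 1 + _ * _ + _.
have leL : 1 + n + deg_sum n adjn <= L.
  have d1 : 0 < size (adjn i) by lia.
  by rewrite /L leq_add2r; apply: leq_trans (leq_pmull (1 + n) d1) (leq_addl _ _).
have H3 : t1 <= K1 * L by apply: leq_trans H1 _; rewrite leq_mul2l leL orbT.
have L0 : 0 < L by []; clear leL; clearbody L; nia.
Qed.

Lemma cMain_cost s : graph_in s ->
  tcmd 4 cMain s <= main_cost * (n * deg_sum n adjn + deg_sum n adjn + n + 1).
Proof.
move=> G.
set c1 := Seq (Asg vBad (Cst 0)) (Asg vFr (Cst 0)).
set c4 := ForV (If (At aM vU) Skip (Asg vCode (Cst 1))).
set c5 := If (Var vBad) (Asg vCode (Cst 0)) Skip.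
set s1 := exe c1 s; set s2 := exe (For vV (Var vN) cVertex) s1.
set s3 := exe (Asg vCode (Cst 2)) s2; set s4 := exe c4 s3.
have -> : tcmd 4 cMain s = tcmd 4 c1 s + (tcmd 4 (For vV (Var vN) cVertex) s1 +
  (tcmd 4 (Asg vCode (Cst 2)) s2 + (tcmd 4 c4 s3 + tcmd 4 c5 s4))) by [].
have G1 : graph_in s1 by apply: pres_in.
have G2 : graph_in s2 by apply: pres_in.
have G3 : graph_in s3 by apply: pres_in.
have H1 : tcmd 4 c1 s <= kcost 4 c1 by apply: flat_cost.
have H3 : tcmd 4 (Asg vCode (Cst 2)) s2 <= kcost 4 (Asg vCode (Cst 2)) by apply: flat_cost.
have H4 : tcmd 4 c4 s3 <= kcost 4 c4 * (1 + n + deg_sum n adjn) by apply: (@linear_cost n w).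
have H5 : tcmd 4 c5 s4 <= kcost 4 c5 by apply: flat_cost.
have H2 : tcmd 4 (For vV (Var vN) cVertex) s1 <=
   size (cexp 4 (Var vN) 0) + 3 + (vertex_cost * (n + deg_sum n adjn * (1 + n) + n * deg_sum n adjn) + n * 5).
  apply: leq_trans (@tcmd_For 4 vV (Var vN) cVertex s1
    (fun i => vertex_cost * (1 + size (adjn i) * (1 + n) + deg_sum n adjn)) _) _.
    move=> i s' lti S; have {}lti : i < n by move: lti; case: G1 => /= ->.
    by apply: cVertex_cost => //; apply: graph_in_setv; apply: graph_in_same S G1.
  have -> : eval (Var vN) s1 = n by case: G1.
  rewrite leq_add2l big_split /= sum_nat_const card_ord -big_distrr /= !big_split /=.
  by rewrite !sum_nat_const card_ord -big_distrl /= muln1.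
have -> : main_cost = 10 * vertex_cost + (kcost 4 c1 + (size (cexp 4 (Var vN) 0) + 3 + (kcost 4 cVertex + 5) +
  (kcost 4 (Asg vCode (Cst 2)) + (kcost 4 c4 + kcost 4 c5)))) + 10 by [].
apply: leq_trans (leq_add H1 (leq_add H2 (leq_add H3 (leq_add H4 H5)))) _.
move: (kcost 4 c1) (kcost 4 c4) (kcost 4 c5) (kcost 4 (Asg _ _)) (kcost 4 cVertex) vertex_cost (size _) (deg_sum _ _).
move=> a b c d e f g D; nia.
Qed.
End Main.

(** * Copying the input into interleaved arrays *)

Local Notation vFB := 14 (only parsing).
Local Notation vN2 := 15 (only parsing).
Local Notation vOff := 16 (only parsing).
Local Notation vQ := 17 (only parsing).
Local Notation vPt := 18 (only parsing).
Local Notation vSt := 19 (only parsing).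
Local Notation vI := 20 (only parsing).

Local Notation Raw e := (Arr 0 (Sub (Add e (Var vOff)) (Cst 64))) (only parsing).
Local Notation RawDeg := (Raw (Add (Var vN2) (Add (Cst 1) (Var vI)))) (only parsing).

(* The input cell [a] is found at index [a + vOff - 64]. The number of vertices is recovered from
   its double, and for [vOff = 0] the first 63 weights are read where [boot_large] saved them. *)
Definition cHalve :=
  For vI (Var vN2) (If (Sub (Var vN2) (Add (Var vI) (Var vI))) (Asg vN (Add (Var vI) (Cst 1))) Skip).
Definition cDegrees :=
  Seq (Asg vQ (Cst 0)) (For vI (Var vN) (Asg vQ (Add (Var vQ) RawDeg))).
Definition cPtr1 :=
  Seq (Asg vFB (Add (Add (Var vN) (Add (Var vN) (Var vN))) (Add (Add (Cst 1) (Var vQ)) (Var vOff))))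
  (Seq (Asg vPt (Var vFB)) (Asg vSt (Cst 0))).
Definition cRow :=
  Seq (If (Add (Var vOff) (Sub (Var vI) (Cst 62)))
         (Wr 0 (Var vPt) (Raw (Add (Var vI) (Cst 1))))
         (Wr 0 (Var vPt) (Raw (Sub (Var vN2) (Var vI)))))
  (Seq (Wr 0 (Add (Var vPt) (Cst 1)) (Var vSt))
  (Seq (Wr 0 (Add (Var vPt) (Cst 2)) RawDeg)
  (Seq (Asg vSt (Add (Var vSt) RawDeg))
       (Asg vPt (Add (Var vPt) (Cst 16)))))).
Definition cRows := For vI (Var vN) cRow.
Definition cPtr2 := Asg vPt (Add (Var vFB) (Cst 3)).
Definition cCell :=
  Seq (Wr 0 (Var vPt) (Raw (Add (Add (Var vN2) (Var vN)) (Add (Cst 1) (Var vI)))))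
      (Asg vPt (Add (Var vPt) (Cst 16))).
Definition cCells := For vI (Var vQ) cCell.

Definition cSetup :=
  Seq cHalve (Seq cDegrees (Seq cPtr1 (Seq cRows (Seq cPtr2 cCells)))).

Lemma wfc_cSetup : wfc 0 cSetup 0. Proof. by []. Qed.

Definition setup_cost : nat :=
  kcost 0 cHalve + kcost 0 cDegrees + kcost 0 cPtr1 + kcost 0 cRows + kcost 0 cPtr2 + kcost 0 cCells.

Lemma For_flat_cost k x y c s : flat c ->
  tcmd k (For x (Var y) c) s <= kcost k (For x (Var y) c) * (1 + vr s y).
Proof.
move=> fc; apply: leq_trans (tcmd_For (b := fun=> kcost k c) _) _.
  by move=> i s' _ _; apply: flat_cost.
have -> : kcost k (For x (Var y) c) = size (cexp k (Var y) 0) + 3 + (kcost k c + 5) by [].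
by rewrite sum_nat_const card_ord [eval _ _]/=; move: (size _) (kcost _ _) (vr s y) => a b d; nia.
Qed.

Section Setup.
Variables (n off : nat) (W Dg Cl : nat -> nat) (s : st).
Let Q := \sum_(i < n) Dg i.
(** The input has [n + (n + n) + (1 + Q)] cells, and [off] allows for their shift; the new arrays
    start here, on zeros. *)
Let FB := n + (n + n) + (1 + Q + off).
Let h := ar s 0.
Let raw e := h (e + off - 64).
Hypothesis n_gt0 : 0 < n.
Hypothesis EN2 : vr s vN2 = n + n.
Hypothesis Eoff : vr s vOff = off.
Hypothesis rawW : forall i, i < n ->
  W i = if off + (i - 62) == 0 then raw (n + n - i) else raw (i + 1).
Hypothesis rawD : forall i, i < n -> raw (n + n + (1 + i)) = Dg i.
Hypothesis rawC : forall j, j < Q -> raw (n + n + n + (1 + j)) = Cl j.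
Hypothesis zero : forall a, FB <= a -> h a = 0.

Definition prefix_sum i := \sum_(j < i) Dg j.

(** List starts are recomputed as prefix sums of degrees: the given addresses are partly overwritten
    and refer to the old layout. *)
Definition rows (i a j : nat) : nat :=
  if j < i then nth 0 [:: W j; prefix_sum j; Dg j] a else 0.
Definition table (i a j : nat) : nat :=
  if a == 3 then (if j < i then Cl j else 0) else rows n a j.

Definition holds (h' : nat -> nat) (T : nat -> nat -> nat) : Prop :=
  (forall x, x < FB -> h' x = h x) /\ (forall a j, a < 16 -> h' (FB + j * 16 + a) = T a j).

Lemma seta_holds s' T i b v : b < 16 -> holds (ar s' 0) T ->
  holds (ar (seta s' 0 (FB + i * 16 + b) v) 0)
    (fun a j => if (a == b) && (j == i) then v else T a j).
Proof.
move=> ltb [H1 H2]; split=> [x ltx|a j lta] /=.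
  by rewrite H1 //; case: eqP => // E; lia.
have -> : (FB + j * 16 + a == FB + i * 16 + b) = (a == b) && (j == i) by lia.
by rewrite H2.
Qed.

Lemma holds_eq h' T T' : (forall a j, a < 16 -> T a j = T' a j) -> holds h' T -> holds h' T'.
Proof. by move=> E [H1 H2]; split=> // a j lta; rewrite H2 ?E. Qed.

Lemma cSetupP : let s' := exe cSetup s in
  [/\ vr s' vN = n, vr s' vFB = FB, holds (ar s' 0) (table Q) &
      tcmd 0 cSetup s <= setup_cost * (1 + (n + n) + Q)].
Proof.
have chain c1 c2 c3 c4 c5 c6 s0 : exe (Seq c1 (Seq c2 (Seq c3 (Seq c4 (Seq c5 c6))))) s0 =
  exe c6 (exe c5 (exe c4 (exe c3 (exe c2 (exe c1 s0))))) by [].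
have -> : tcmd 0 cSetup s = tcmd 0 cHalve s + (tcmd 0 cDegrees (exe cHalve s) +
  (tcmd 0 cPtr1 (exe cDegrees (exe cHalve s)) +
  (tcmd 0 cRows (exe cPtr1 (exe cDegrees (exe cHalve s))) +
  (tcmd 0 cPtr2 (exe cRows (exe cPtr1 (exe cDegrees (exe cHalve s)))) +
   tcmd 0 cCells (exe cPtr2 (exe cRows (exe cPtr1 (exe cDegrees (exe cHalve s))))))))) by [].
rewrite /cSetup chain {chain}.
have [s1 E1] : exists s1, s1 = exe cHalve s by eexists.
rewrite -!E1; have S1 : same cHalve s s1 by rewrite E1; apply: exe_same.
have N1 : vr s1 vN = n.
  rewrite E1; have En : eval (Var vN2) s = n + n by [].
  (* [vI + vI < n + n] holds exactly for [vI < n], so the assigned value climbs to [n] and stays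
     there. *)
  have := @For_ind vI (Var vN2) (If (Sub (Var vN2) (Add (Var vI) (Var vI))) (Asg vN (Add (Var vI) (Cst 1))) Skip)
     (fun i s' => 0 < i -> vr s' vN = minn i n) s; rewrite En.
  move=> H; rewrite H //; try lia.
  move=> i s' lti S' IH _ /=; have -> : vr s' vN2 = n + n by rewrite S'.1.
  by case: eqP => E /=; [rewrite IH|]; lia.
have [s2 E2] : exists s2, s2 = exe cDegrees s1 by eexists.
rewrite -!E2; have S2 : same cDegrees s1 s2 by rewrite E2; apply: exe_same.
have Q2 : vr s2 vQ = Q.
  have En : eval (Var vN) (setv s1 vQ 0) = n by [].
  suff: vr s2 vQ = prefix_sum (eval (Var vN) (setv s1 vQ 0)) by rewrite En.
  rewrite E2; apply: (@For_ind vI (Var vN) (Asg vQ (Add (Var vQ) RawDeg)) (fun i s' => vr s' vQ = prefix_sum i)).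
    by rewrite /prefix_sum big_ord0.
  move=> i s'; rewrite En => lti S' /= ->.
  have -> : ar s' 0 = h by rewrite S'.2 //= S1.2.
  have -> : vr s' vN2 = n + n by rewrite S'.1 //= S1.1.
  have -> : vr s' vOff = off by rewrite S'.1 //= S1.1.
  by rewrite -/(raw _) rawD // /prefix_sum big_ord_recr.
have [s3 E3] : exists s3, s3 = exe cPtr1 s2 by eexists.
rewrite -!E3; have S3 : same cPtr1 s2 s3 by rewrite E3; apply: exe_same.
have [F3 P3 T3] : [/\ vr s3 vFB = FB, vr s3 vPt = FB & vr s3 vSt = 0].
  rewrite E3 /=; have -> : vr s2 vN = n by rewrite S2.1.
  have -> : vr s2 vOff = off by rewrite S2.1 // S1.1.
  by rewrite Q2.
have [s4 E4] : exists s4, s4 = exe cRows s3 by eexists.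
rewrite -!E4; have S4 : same cRows s3 s4 by rewrite E4; apply: exe_same.
have N3 : vr s3 vN = n by rewrite S3.1 // S2.1.
have H3 : ar s3 0 = h by rewrite S3.2 // S2.2 // S1.2.
have O3 : vr s3 vOff = off by rewrite S3.1 // S2.1 // S1.1.
have M3 : vr s3 vN2 = n + n by rewrite S3.1 // S2.1 // S1.1.
have Z3 : holds (ar s3 0) (rows 0).
  by rewrite H3; split=> // a j _; rewrite zero //; lia.
have [Z4 _ _] : [/\ holds (ar s4 0) (rows n), vr s4 vPt = FB + n * 16 & vr s4 vSt = prefix_sum n].
  have En : eval (Var vN) s3 = n by [].
  pose P i s' := [/\ holds (ar s' 0) (rows i), vr s' vPt = FB + i * 16 & vr s' vSt = prefix_sum i].
  suff: P (eval (Var vN) s3) s4 by rewrite En.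
  rewrite E4; apply: (@For_ind vI (Var vN) cRow P).
    by rewrite /P P3 T3 addn0 /prefix_sum big_ord0.
  move=> i s'; rewrite En => lti S' [Z' P' T'].
  have O' : vr s' vOff = off by rewrite S'.1.
  have M' : vr s' vN2 = n + n by rewrite S'.1.
  have rd s0 T e : holds (ar s0 0) T -> e <= n + n + n + Q -> ar s0 0 (e + off - 64) = raw e.
    by move=> [Hx _] le; rewrite Hx // /FB; lia.
  have [u0 U0] : exists u0, u0 = setv s' vI i by eexists.
  have [I0 K0 V0 N0 T0] : [/\ vr u0 vI = i, vr u0 vOff = off, vr u0 vPt = FB + i * 16,
     vr u0 vN2 = n + n & vr u0 vSt = prefix_sum i] by rewrite U0.
  have H0 : holds (ar u0 0) (rows i) by rewrite U0.
  have step1 : exe (If (Add (Var vOff) (Sub (Var vI) (Cst 62)))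
         (Wr 0 (Var vPt) (Raw (Add (Var vI) (Cst 1))))
         (Wr 0 (Var vPt) (Raw (Sub (Var vN2) (Var vI))))) u0 = seta u0 0 (FB + i * 16 + 0) (W i).
    rewrite /= K0 I0 V0 N0 addn0 rawW //.
    by case: eqP => E; rewrite (rd _ _ _ H0) //; lia.
  have H1 := seta_holds i (W i) (isT : 0 < 16) H0.
  have H2 := seta_holds i (prefix_sum i) (isT : 1 < 16) H1.
  have H3' := seta_holds i (Dg i) (isT : 2 < 16) H2.
  set u1 := seta _ _ _ _ in H1 H2 H3' step1.
  set u2 := seta u1 _ _ _ in H2 H3'.
  set u3 := seta u2 _ _ _ in H3'.
  have E : exe cRow u0 = setv (setv u3 vSt (prefix_sum i.+1)) vPt (FB + i.+1 * 16).
    have -> : exe cRow u0 = exe (Asg vPt (Add (Var vPt) (Cst 16))) (exe (Asg vSt (Add (Var vSt) RawDeg))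
       (exe (Wr 0 (Add (Var vPt) (Cst 2)) RawDeg) (exe (Wr 0 (Add (Var vPt) (Cst 1)) (Var vSt)) u1))).
      by rewrite -step1.
    have -> : exe (Wr 0 (Add (Var vPt) (Cst 1)) (Var vSt)) u1 = u2.
      by rewrite /u2 -V0 -T0.
    have val u : holds (ar u 0) (fun a j => if (a == 1) && (j == i) then prefix_sum i else
            if (a == 0) && (j == i) then W i else rows i a j) \/
        holds (ar u 0) (fun a j => if (a == 2) && (j == i) then Dg i else if (a == 1) && (j == i) then prefix_sum i else
            if (a == 0) && (j == i) then W i else rows i a j) ->
        vr u = vr u0 -> eval RawDeg u = Dg i.
      move=> Hu Vu; rewrite /= Vu N0 I0 K0 -rawD //.
      by case: Hu => Hu; apply: rd Hu _; lia.
    have -> : exe (Wr 0 (Add (Var vPt) (Cst 2)) RawDeg) u2 = u3.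
      have -> : exe (Wr 0 (Add (Var vPt) (Cst 2)) RawDeg) u2 =
        seta u2 0 (vr u0 vPt + 2) (eval RawDeg u2) by [].
      by rewrite val ?V0 //; left.
    have -> : exe (Asg vSt (Add (Var vSt) RawDeg)) u3 = setv u3 vSt (vr u0 vSt + eval RawDeg u3) by [].
    rewrite val; [|by right|by []].
    rewrite /= V0 T0 /prefix_sum big_ord_recr /=; congr setv; lia.
  rewrite -U0 E /P; split=> //.
  apply: holds_eq H3' => a j lta; rewrite /rows ltnS [in RHS]leq_eqVlt.
  case: (j =P i) => [->|_]; rewrite ?andbF ?andbT //= ltnn.
  by case: a lta => [|[|[|a]]] //=; rewrite nth_nil.
have [s5 E5] : exists s5, s5 = exe cPtr2 s4 by eexists.
rewrite -!E5; have S5 : same cPtr2 s4 s5 by rewrite E5; apply: exe_same.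
have [s6 E6] : exists s6, s6 = exe cCells s5 by eexists.
rewrite -E6; have S6 : same cCells s5 s6 by rewrite E6; apply: exe_same.
have F4 : vr s4 vFB = FB by rewrite S4.1.
have P5 : vr s5 vPt = FB + 3 by rewrite E5 /= F4.
have Z5 : holds (ar s5 0) (table 0).
  rewrite S5.2 //; apply: holds_eq Z4 => a j _; rewrite /table /rows.
  by case: a => [|[|[|[|a]]]] //=; case: ifP.
have Q5 : vr s5 vQ = Q by rewrite S5.1 // S4.1 // S3.1.
have O5 : vr s5 vOff = off by rewrite S5.1 // S4.1.
have M5 : vr s5 vN2 = n + n by rewrite S5.1 // S4.1.
have N5 : vr s5 vN = n by rewrite S5.1 // S4.1.
split.
- by rewrite S6.1.
- by rewrite S6.1 // S5.1.
2: {
  have c1 : tcmd 0 cHalve s <= kcost 0 cHalve * (1 + vr s vN2) by apply: For_flat_cost.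
  have c2 : tcmd 0 cDegrees s1 <= kcost 0 cDegrees * (1 + vr s1 vN).
    have -> : tcmd 0 cDegrees s1 = 2 + tcmd 0 (For vI (Var vN) (Asg vQ (Add (Var vQ) RawDeg)))
      (setv s1 vQ 0) by [].
    have -> : kcost 0 cDegrees = 2 + kcost 0 (For vI (Var vN) (Asg vQ (Add (Var vQ) RawDeg))) by [].
    by rewrite mulnDl; apply: leq_add; [apply: leq_pmulr|apply: For_flat_cost].
  have c3 : tcmd 0 cPtr1 s2 <= kcost 0 cPtr1 by apply: flat_cost.
  have c4 : tcmd 0 cRows s3 <= kcost 0 cRows * (1 + vr s3 vN) by apply: For_flat_cost.
  have c5 : tcmd 0 cPtr2 s4 <= kcost 0 cPtr2 by apply: flat_cost.
  have c6 : tcmd 0 cCells s5 <= kcost 0 cCells * (1 + vr s5 vQ) by apply: For_flat_cost.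
  rewrite EN2 in c1; rewrite N1 in c2; rewrite N3 in c4; rewrite Q5 in c6.
  apply: leq_trans (leq_add c1 (leq_add c2 (leq_add c3 (leq_add c4 (leq_add c5 c6))))) _.
  rewrite /setup_cost; clear.
  move: (kcost 0 cHalve) (kcost 0 cDegrees) (kcost 0 cPtr1) (kcost 0 cRows) (kcost 0 cPtr2) (kcost 0 cCells) Q.
  move=> a b c d e f q; nia. }
have En : eval (Var vQ) s5 = Q by [].
pose P i s' := holds (ar s' 0) (table i) /\ vr s' vPt = FB + i * 16 + 3.
suff: P (eval (Var vQ) s5) s6 by rewrite En => -[].
rewrite E6; apply: (@For_ind vI (Var vQ) cCell P).
  by rewrite /P P5 addn0.
move=> i s'; rewrite En => lti S' [Z' P'].
have O' : vr s' vOff = off by rewrite S'.1.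
have M' : vr s' vN2 = n + n by rewrite S'.1.
have N' : vr s' vN = n by rewrite S'.1.
have rd : ar s' 0 (n + n + n + (1 + i) + off - 64) = Cl i.
  by rewrite -rawC //; case: Z' => Hx _; rewrite Hx // /FB; lia.
have H1 := seta_holds i (Cl i) (isT : 3 < 16) Z'.
split; last by rewrite /= P'; lia.
rewrite /= O' M' N' P' rd; apply: holds_eq H1 => a j lta; rewrite /table ltnS [in RHS]leq_eqVlt.
by case: (j =P i) => [->|_]; rewrite ?andbF ?andbT ?ltnn; case: eqP.
Qed.

End Setup.

(** * Copying the result back *)

(* [1019 = 63 * 16 + 11] is the offset of entry 63 of [aI]; entry 62, which goes to cell 63, has
   address [vFB + 1067], since the heap starts in cell 64. *)
Definition cPut := Seq (Wr 0 (Var vI) (Arr 0 (Var vPt))) (Asg vPt (Add (Var vPt) (Cst 16))).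
Definition cCopy :=
  Seq (Asg vPt (Add (Var vFB) (Cst 1019)))
  (Seq (For vI (Var vN) cPut) (Asg vPt (Add (Var vFB) (Cst 1067)))).

Lemma wfc_cCopy : wfc 0 cCopy 0. Proof. by []. Qed.

(** Writes go to indices below [n] and reads come from [FB] on, so no entry is lost before it is
    read. Copying past the end of the result is harmless. *)
Lemma cCopyP n FB s : vr s vN = n -> vr s vFB = FB -> n <= FB ->
  let s' := exe cCopy s in
  [/\ forall i, i < n -> ar s' 0 i = ar s 0 (FB + (63 + i) * 16 + 11),
      forall x, FB <= x -> ar s' 0 x = ar s 0 x,
      vr s' vPt = FB + 1067, vr s' vCode = vr s vCode &
      tcmd 0 cCopy s <= kcost 0 cCopy * (1 + n)].
Proof.
move=> En EF leF s'.
pose s1 := setv s vPt (FB + 1019); pose s2 := exe (For vI (Var vN) cPut) s1.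
have E1 : exe (Asg vPt (Add (Var vFB) (Cst 1019))) s = s1 by rewrite /s1 -EF.
have Es : s' = setv s2 vPt (FB + 1067).
  rewrite /s' -[exe cCopy s]/(exe (Asg vPt (Add (Var vFB) (Cst 1067))) (exe (For vI (Var vN) cPut)
    (exe (Asg vPt (Add (Var vFB) (Cst 1019))) s))) E1 -/s2.
  by rewrite -[exe _ s2]/(setv s2 vPt (vr s2 vFB + 1067)) /s2 exe_vr //= EF.
pose P i u := [/\ forall j, j < i -> ar u 0 j = ar s 0 (FB + (63 + j) * 16 + 11),
  forall x, FB <= x -> ar u 0 x = ar s 0 x & vr u vPt = FB + (63 + i) * 16 + 11].
have [P1 P2 _] : P n s2.
  have Ev : eval (Var vN) s1 = n by [].
  suff: P (eval (Var vN) s1) s2 by rewrite Ev.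
  apply: For_ind; first by split=> //=; lia.
  move=> i u; rewrite Ev => lti S [H1 H2 H3]; split=> /=.
  - move=> j; rewrite ltnS leq_eqVlt => /predU1P[->|ltj].
      by rewrite eqxx H3 H2 //; lia.
    by case: eqP => [E|_]; [lia|apply: H1].
  - by move=> x lex; case: eqP => [E|_]; [lia|apply: H2].
  - by rewrite H3; lia.
split; [by rewrite Es|by rewrite Es|by rewrite Es|by rewrite Es /= /s2 exe_vr|].
have -> : tcmd 0 cCopy s = tcmd 0 (Asg vPt (Add (Var vFB) (Cst 1019))) s +
  (tcmd 0 (For vI (Var vN) cPut) s1 + tcmd 0 (Asg vPt (Add (Var vFB) (Cst 1067))) s2).
  by rewrite /s2 -E1.
have -> : kcost 0 cCopy = kcost 0 (Asg vPt (Add (Var vFB) (Cst 1019))) +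
  (kcost 0 (For vI (Var vN) cPut) + kcost 0 (Asg vPt (Add (Var vFB) (Cst 1067)))) by [].
have H : tcmd 0 (For vI (Var vN) cPut) s1 <= kcost 0 (For vI (Var vN) cPut) * (1 + vr s1 vN).
  exact: For_flat_cost.
rewrite [vr s1 _]En in H.
move: (@flat_cost 0 (Asg vPt (Add (Var vFB) (Cst 1019))) s isT).
move: (@flat_cost 0 (Asg vPt (Add (Var vFB) (Cst 1067))) s2 isT) H.
move: (tcmd _ _ _) (tcmd _ _ _) (tcmd _ _ _) (kcost _ _) (kcost _ _) (kcost _ _).
by clear; move=> a b c d e f; nia.
Qed.

(* Bounds the length of the input for less than 64 vertices. *)
Definition small_bound : nat := 65 * 64.

(** Going from the top down, nothing is overwritten before it has moved. No register is free, so the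
    zero for a move is taken from the cell just behind the moved block. *)
Fixpoint shift_code (j : nat) : seq instr :=
  if j is a.+1 then IAdd (a + 64) a (small_bound + 64) :: shift_code a else [::].

(** Cell 0 is a descending pointer into the list addresses, cell 1 holds the decrement 1. *)
Fixpoint save_code (j : nat) : seq instr :=
  if j is a.+1 then save_code a ++ [:: ISub 0 0 1; IStore 0 a.+2] else [::].

(** Cells 0 and 1 hold the pointer and the stride 16, so loading goes down and stops at cell 2. *)
Fixpoint load_code (j : nat) : seq instr :=
  if j is a.+1 then [:: ILoad a.+2 0, ISub 0 0 1 & load_code a] else [::].

Lemma size_shift_code j : size (shift_code j) = j.
Proof. by elim: j => //= j ->. Qed.

Lemma size_save_code j : size (save_code j) = j * 2.
Proof. by elim: j => //= j IH; rewrite size_cat IH /=; lia. Qed.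

Lemma size_load_code j : size (load_code j) = j * 2.
Proof. by elim: j => //= j ->. Qed.

(** * Straight-line code that moves blocks of cells *)

Section Pieces.
Variable p : seq instr.

Lemma shift_codeP j pos m : code_at p pos (shift_code j) -> m (small_bound + 64) = 0 ->
  j <= small_bound ->
  exists m', reach p j (pos, m) (pos + j, m') /\
    forall c, m' c = if 64 <= c < j + 64 then m (c - 64) else m c.
Proof.
elim: j pos m => [|j IH] pos m /=.
  by move=> _ _ _; exists m; rewrite addn0; split=> [|c]; [apply: reach_refl|case: ifP => //; lia].
case=> I C m0 lej; have [] := IH pos.+1 (upd m (j + 64) (m j)) C.
- by rewrite upd_neq //; lia.
- exact: ltnW.
move=> m' [r E]; exists m'; split.
  by rewrite addnS -addSn; apply: (reach_add I); rewrite m0 addn0.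
move=> c; rewrite E /upd.
case: (c =P j + 64) => [->|ne].
  have -> : 64 <= j + 64 < j + 64 = false by lia.
  have -> : 64 <= j + 64 < j.+1 + 64 = true by lia.
  by rewrite addnK.
have -> : (64 <= c < j.+1 + 64) = (64 <= c < j + 64) by lia.
by case: ifP => // ltc; case: eqP => // E'; lia.
Qed.

Lemma save_codeP j pos m A : code_at p pos (save_code j) -> m 1 = 1 -> m 0 = A ->
  64 + j <= A -> j <= 62 ->
  exists m', [/\ reach p (j * 2) (pos, m) (pos + j * 2, m'), m' 0 = A - j &
    forall c, 0 < c -> m' c = if A - j <= c < A then m (A - c).+1 else m c].
Proof.
elim: j pos => [|j IH] pos.
  move=> _ m1 m0 leA _; exists m; rewrite addn0 subn0; split=> // [|c c0]; first exact: reach_refl.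
  by case: ifP => //; lia.
move=> /= /code_at_cat[C [I1 [I2 _]]] m1 m0 leA lej.
have [|||//|//|m' [r E0 E]] := IH pos; rewrite ?m1 //; try lia.
rewrite size_save_code in I1 I2.
exists (upd (upd m' 0 (A - j.+1)) (A - j.+1) (m j.+2)); split.
- have -> : j.+1 * 2 = j * 2 + 2 by lia.
  rewrite addnA; apply: (reach_trans r).
  apply: (reach_sub I1); rewrite E0 (E 1) //.
  have -> : A - j <= 1 < A = false by lia.
  rewrite m1 -subnDA addn1; apply: (reach_store I2).
  rewrite upd_eq upd_neq // (E j.+2) //.
  have -> : A - j <= j.+2 < A = false by lia.
  by rewrite addn2; apply: reach_refl.
- by rewrite upd_neq ?upd_eq //; lia.
- move=> c c0; rewrite /upd; case: (c =P A - j.+1) => [->|ne].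
    by case: ifP; [move=> _; congr m|]; lia.
  case: (c =P 0) => [|_]; first lia.
  by rewrite E //; do 2 case: ifP => //; lia.
Qed.

Lemma load_codeP j pos m A : code_at p pos (load_code j) -> m 1 = 16 -> m 0 = A ->
  64 + 16 * j <= A -> j <= 62 ->
  exists m', [/\ reach p (j * 2) (pos, m) (pos + j * 2, m'), m' 0 = A - 16 * j,
    forall c, 2 <= c < j.+2 -> m' c = m (A - 16 * (j.+1 - c)) &
    forall c, 0 < c -> ~~ (2 <= c < j.+2) -> m' c = m c].
Proof.
elim: j pos m A => [|j IH] pos m A.
  move=> _ m1 m0 leA _; exists m; rewrite addn0 muln0 subn0; split=> // [|c]; first exact: reach_refl.
  lia.
move=> /= [I1 [I2 C]] m1 m0 leA lej.
pose m2 := upd (upd m j.+2 (m A)) 0 (A - 16).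
have h1 : m2 1 = 16 by rewrite /m2 !upd_neq.
have h0 : m2 0 = A - 16 by rewrite /m2 upd_eq.
have hA : 64 + 16 * j <= A - 16 by lia.
have [m' [r E0 E1 E2]] := IH pos.+2 m2 (A - 16) C h1 h0 hA (ltnW lej).
exists m'; split.
- have -> : pos + j.+1 * 2 = pos.+2 + j * 2 by lia.
  apply: (reach_load I1); rewrite m0; apply: (reach_sub I2).
  by rewrite !upd_neq // m0 m1.
- by rewrite E0; lia.
- move=> c ltc; case: (c =P j.+2) => [->|ne].
    rewrite E2 //; last lia.
    rewrite /m2 upd_neq // upd_eq; congr m; lia.
  rewrite E1; last lia.
  by rewrite /m2 !upd_neq; try lia; congr m; lia.
- move=> c c0 nc; rewrite E2 //; last lia.
  by rewrite /m2 !upd_neq //; lia.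
Qed.
End Pieces.

(** The registers are given back last. Offset 133 is the exit for code 1; offset 134 is the one for
    code 0, where cell 0 already holds the answer. *)
Definition out_code (q : nat) : seq instr :=
  [:: IAdd 3 (cV vCode) 0; IJz 3 (q + 134); ISub 3 3 1; IJz 3 (q + 133);
      IAdd 0 (cV vPt) 0; IConst 1 16] ++ load_code 62 ++
  [:: ILoad 1 0; IConst 0 2; IHalt; IConst 0 1; IHalt].

(** 1056 is [64 + 16 * 62]: all 63 reads stay above the cells being overwritten. *)
Lemma out_codeP p q m A : code_at p q (out_code q) -> m 0 = 0 -> m 1 = 1 ->
  m (cV vPt) = A -> 1056 <= A -> m (cV vCode) <= 2 ->
  exists pc out, [/\ reach p 140 (q, m) (pc, out), step p (pc, out) = None,
    out 0 = m (cV vCode) &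
    m (cV vCode) = 2 -> (forall k, 0 < k < 64 -> out k = m (A - 16 * (63 - k))) /\
                        (forall k, 64 <= k -> out k = m k)].
Proof.
case/code_at_cat=> -[I0 [I1 [I2 [I3 [I4 [I5 _]]]]]].
case/code_at_cat=> C [J0 [J1 [J2 [J3 [J4 _]]]]] m0 m1 mA leA.
set P := (_ + _) in J0 J1 J2 J3 J4.
have EP : P = q + 6 + 62 * 2 by rewrite /P size_load_code.
have E4 : q + 134 = P.+4 by rewrite EP; lia.
have E3 : q + 133 = P.+3 by rewrite EP; lia.
rewrite E4 E3 in I1 I3; clearbody P.
have halt pc m' : nth IHalt p pc = IHalt -> step p (pc, m') = None by move=> H; rewrite /step H.
set code := m (cV vCode); pose r1 := upd m 3 code => le2.
have i0 T c : reach p T (q.+1, r1) c -> reach p T.+1 (q, m) c.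
  by move=> r; apply: (reach_add I0); rewrite m0 addn0.
have r13 : r1 3 = code by rewrite /r1 upd_eq.
have r11 : r1 1 = 1 by rewrite /r1 upd_neq.
have [c0|c0] := code =P 0.
  exists P.+4, r1; split; rewrite ?c0 //; last exact: halt.
  apply: (@reach_le p 2 140) => //; apply: i0; apply: (reach_jz I1).
  by rewrite r13 c0; apply: reach_refl.
have i1 T c : reach p T (q.+2, r1) c -> reach p T.+2 (q, m) c.
  by move=> r; apply: i0; apply: (reach_jz I1); rewrite r13 (introF eqP c0).
pose r2 := upd r1 3 (code - 1).
have i2 T c : reach p T (q.+3, r2) c -> reach p T.+3 (q, m) c.
  move=> r; apply: i1; apply: (reach_sub I2); rewrite r13 r11; apply: r.
have r23 : r2 3 = code - 1 by rewrite /r2 upd_eq.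
have r20 : r2 0 = 0 by rewrite /r2 /r1 !upd_neq.
have [c1|c1] := code - 1 =P 0.
  pose r4 := upd r2 0 1; exists P.+4, r4; split.
  - apply: (@reach_le p 5 140) => //; apply: i2; apply: (reach_jz I3); rewrite r23 c1 eqxx.
    by apply: (reach_const J3); apply: reach_refl.
  - exact: halt.
  - by rewrite /r4 upd_eq; lia.
  - by move=> c2; rewrite c2 in c1.
have {c0 c1 le2} c2 : code = 2 by lia.
pose r3 := upd (upd r2 0 A) 1 16.
have i3 T c : reach p T (q + 6, r3) c -> reach p T.+4.+2 (q, m) c.
  move=> r; apply: i2; apply: (reach_jz I3); rewrite r23 c2 /=.
  apply: (reach_add I4); rewrite r20 addn0 /r2 /r1 !upd_neq // mA.
  by apply: (reach_const I5); move: r; rewrite (_ : q + 6 = q.+4.+2) //; lia.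
have r3E c : 4 <= c -> r3 c = m c.
  by move=> lec; rewrite /r3 /r2 /r1 !upd_neq //; lia.
have r31 : r3 1 = 16 by rewrite /r3 upd_eq.
have r30 : r3 0 = A by rewrite /r3 upd_neq // upd_eq.
have [m' [r' E0 E1 E2]] := load_codeP C r31 r30 leA isT.
pose r4 := upd (upd m' 1 (m' (m' 0))) 0 2; exists P.+2, r4; split.
- apply: (@reach_le p (4 + 2 + (62 * 2 + 2)) 140) => //; rewrite addnC; apply: i3.
  apply: (reach_trans r'); rewrite -EP.
  by apply: (reach_load J0); apply: (reach_const J1); apply: reach_refl.
- exact: halt.
- by rewrite /r4 upd_eq -/code c2.
rewrite /r4; move=> _; split=> k ltk.
  rewrite upd_neq; last lia.
  case: (k =P 1) => [->|k1].
    rewrite upd_eq E0 E2; try lia.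
    by rewrite r3E; [congr m|]; lia.
  rewrite upd_neq; last exact/eqP.
  by rewrite E1; [rewrite r3E; [congr m|]|]; lia.
by rewrite !upd_neq ?E2 ?r3E //; lia.
Qed.

(** Every memory with the three constants in place represents some state, for any array layout; so
    one memory can be reread under another layout. *)
Definition view (k B : nat) (m : memory) : st :=
  St (fun x => m (cV x)) (fun a i => m (B + i * 2 ^ k + a)).

Lemma repr_view k B m : m 0 = 0 -> m 1 = 1 -> m 2 = B -> repr k B (view k B m) m.
Proof. by []. Qed.

Section Cells.
Variables (n : nat) (adjn : nat -> seq nat).
Local Notation start := (prefix_sum (fun u => size (adjn u))) (only parsing).

Lemma size_cells i : size (flatten [seq adjn u | u <- iota 0 i]) = start i.
Proof.
elim: i => [|i IH]; first by rewrite /prefix_sum big_ord0.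
by rewrite iota0S map_cat flatten_cat size_cat IH /= cats0 /prefix_sum big_ord_recr.
Qed.

Lemma nth_cells u j : u < n -> j < size (adjn u) ->
  start u + j < start n /\
  nth 0 (flatten [seq adjn u | u <- iota 0 n]) (start u + j) = nth 0 (adjn u) j.
Proof.
move=> ltu ltj; have En : iota 0 n = iota 0 u ++ u :: iota u.+1 (n - u.+1).
  by rewrite -[u :: _]/(iota u (n - u.+1).+1) subnSK // -[in RHS](add0n u) -iotaD subnKC // ltnW.
rewrite -!size_cells En map_cat flatten_cat /= size_cat size_cat ltn_add2l; split.
  exact: leq_trans ltj (leq_addr _ _).
by rewrite nth_cat ltnNge leq_addr /= addKn nth_cat ltj.
Qed.
End Cells.

Section Run.
Variables (n : nat) (w : nat -> nat) (adjn : nat -> seq nat) (cid : nat -> nat).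
Hypothesis n_gt0 : 0 < n.
Hypothesis adj_lt : forall u y, u < n -> y \in adjn u -> y < n.
Hypothesis adj_sym : forall u y, u < n -> y \in adjn u -> u \in adjn y.
Hypothesis adj_irr : forall u, u \notin adjn u.
Hypothesis adj_uniq : forall u, uniq (adjn u).
Hypothesis cid_adj : forall u y, u < n -> y \in adjn u -> cid y = cid u.
Hypothesis cid_min : forall (X : nat -> Prop) u y, u < n -> y < n ->
  (forall x z, x < n -> z \in adjn x -> X x -> X z) -> X u -> cid y = cid u -> X y.

Let Q := deg_sum n adjn.
Let cells := flatten [seq adjn u | u <- iota 0 n].

Variables (p : seq instr) (q : nat).
Let q2 := q + size (ccmd 0 cSetup 0 q).
Let q3 := q2.+1 + size (ccmd 4 cMain 0 q2.+1).
Let q4 := q3.+1 + size (ccmd 0 cCopy 0 q3.+1).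
Hypothesis code_setup : code_at p q (ccmd 0 cSetup 0 q).
Hypothesis code_q2 : nth IHalt p q2 = IAdd 2 2 (cV vFB).
Hypothesis code_main : code_at p q2.+1 (ccmd 4 cMain 0 q2.+1).
Hypothesis code_q3 : nth IHalt p q3 = IConst 2 64.
Hypothesis code_copy : code_at p q3.+1 (ccmd 0 cCopy 0 q3.+1).
Hypothesis code_out : code_at p q4 (out_code q4).

Variables (off : nat) (m : memory).
Let raw e := m (64 + (e + off - 64)).
Hypotheses (m0 : m 0 = 0) (m1 : m 1 = 1) (m2 : m 2 = 64).
Hypotheses (mN2 : m (cV vN2) = n + n) (mOff : m (cV vOff) = off).
Hypothesis rawW : forall i, i < n ->
  w i = if off + (i - 62) == 0 then raw (n + n - i) else raw (i + 1).
Hypothesis rawD : forall i, i < n -> raw (n + n + (1 + i)) = size (adjn i).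
Hypothesis rawC : forall j, j < Q -> raw (n + n + n + (1 + j)) = nth 0 cells j.
Hypothesis zero : forall a, n + (n + n) + (1 + Q + off) <= a -> m (64 + a) = 0.

Lemma runP : exists pc out I,
  [/\ reach p (setup_cost * (1 + (n + n) + Q) +
               (main_cost * (n * Q + Q + n + 1) + (kcost 0 cCopy * (1 + n) + 142)))
        (q, m) (pc, out),
      step p (pc, out) = None, outcome n w adjn (out 0) I &
      out 0 = 2 -> forall i, i < n -> out i.+1 = I i].
Proof.
pose FB := n + (n + n) + (1 + Q + off).
have ge64 B : 64 <= 64 + B by apply: leq_addr.
pose s := view 0 64 m.
have hE a i : a = 0 -> ar s a i = m (64 + i) by move=> ->; rewrite /= muln1 addn0.
have [N1 F1 Z1 T1] : let s' := exe cSetup s in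
  [/\ vr s' vN = n, vr s' vFB = FB,
      holds n off (fun u => size (adjn u)) s (ar s' 0) (table n w (fun u => size (adjn u)) (nth 0 cells) Q) &
      tcmd 0 cSetup s <= setup_cost * (1 + (n + n) + Q)].
  apply: cSetupP => //.
  - by move=> i lti; rewrite !hE //; apply: rawW.
  - by move=> i lti; rewrite hE //; apply: rawD.
  - by move=> j ltj; rewrite hE //; apply: rawC.
  - by move=> a lea; rewrite hE //; apply: zero.
have [ma [ra repa _]] := ccmdP (leqnn 64) (isT : 0 <= 5) (repr_view 0 m0 m1 m2) wfc_cSetup code_setup.
rewrite -/q2 -/s in ra repa; move: (exe cSetup s) N1 F1 Z1 repa => s1 N1 F1 [_ Z1] repa.
have vF : ma (cV vFB) = FB by rewrite (reprV repa).
pose mb := upd ma 2 (64 + FB).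
have mb0 : mb 0 = 0 by rewrite /mb upd_neq // (repr0 repa).
have mb1 : mb 1 = 1 by rewrite /mb upd_neq // (repr1 repa).
have mb2 : mb 2 = 64 + FB by rewrite /mb upd_eq.
have rb : reach p 1 (q2, ma) (q2.+1, mb).
  by apply: (reach_add code_q2); rewrite (reprB repa) vF; apply: reach_refl.
pose t := view 4 (64 + FB) mb.
have tE a i : a < 16 -> ar t a i = table n w (fun u => size (adjn u)) (nth 0 cells) Q a i.
  move=> lta; rewrite -Z1 // -[LHS]/(mb (64 + FB + i * 16 + a)) /mb upd_neq; last lia.
  have := reprA repa (FB + i * 16 + a) (isT : 0 < 2 ^ 0); rewrite muln1 addn0 => <-.
  by rewrite !addnA.
have repb : repr 4 (64 + FB) t mb := repr_view 4 mb0 mb1 mb2.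
have tV x : vr t x = mb (cV x) by [].
clearbody t.
have EQ : Q = prefix_sum (fun u => size (adjn u)) n by [].
have Gt : graph_in n w adjn t.
  split=> [|u ltu]; first by rewrite tV /mb upd_neq // (reprV repa).
  rewrite !tE // /table /rows ltu /=; split=> // j ltj.
  have [lt E] := nth_cells ltu ltj.
  by rewrite tE // /table /= EQ lt E.
have [mc [rc repc _]] := ccmdP (ge64 FB) (isT : 0 <= 5) repb wfc_cMain code_main.
rewrite -/q3 in rc repc.
have T2 : tcmd 4 cMain t <= main_cost * (n * Q + Q + n + 1) := cMain_cost Gt.
have [] : [/\ outcome n w adjn (vr (exe cMain t) vCode) (ar (exe cMain t) aI),
   vr (exe cMain t) vN = n & vr (exe cMain t) vFB = FB].
  split.
  - apply: (cMainP adj_lt adj_sym adj_irr adj_uniq cid_adj cid_min Gt) => c;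
      by rewrite tE // /table /rows /=; case: ifP.
  - by rewrite exe_vr //; case: Gt.
  - by rewrite exe_vr // tV /mb upd_neq.
move: (exe cMain t) repc => t' repc out N2 F2.
pose md := upd mc 2 64.
have md0 : md 0 = 0 by rewrite /md upd_neq // (repr0 repc).
have md1 : md 1 = 1 by rewrite /md upd_neq // (repr1 repc).
have md2 : md 2 = 64 by rewrite /md upd_eq.
have rd : reach p 1 (q3, mc) (q3.+1, md) by apply: (reach_const code_q3); apply: reach_refl.
pose u := view 0 64 md.
have uV x : x < 43 -> vr u x = vr t' x.
  by move=> ltx; rewrite /= /md upd_neq // (reprV repc).
have [me [re repe _]] := ccmdP (leqnn 64) (isT : 0 <= 5) (repr_view 0 md0 md1 md2) wfc_cCopy code_copy.
rewrite -/q4 -/u in re repe.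
have Nu : vr u vN = n by rewrite uV.
have Fu : vr u vFB = FB by rewrite uV.
have leFB : n <= FB by rewrite /FB -addnA leq_addr.
have [C1 C2 C3 C4 T3] := cCopyP Nu Fu leFB.
move: (exe cCopy u) C1 C2 C3 C4 repe => u' C1 C2 C3 C4 repe.
have le2 : me (cV vCode) <= 2.
  by rewrite (reprV repe) // C4 uV //; case: out => -[->].
have ePt : me (cV vPt) = FB + 1067 by rewrite (reprV repe).
have [|pc [o [ro halt o0 oI]]] := out_codeP code_out (repr0 repe) (repr1 repe) ePt _ le2.
  by rewrite -[1056]add0n leq_add.
have eC : me (cV vCode) = vr t' vCode by rewrite (reprV repe) // C4 uV.
have uA j : ar u 0 (FB + j * 16 + 11) = ar t' aI j.
  rewrite -[LHS]/(md (64 + (FB + j * 16 + 11) * 1 + 0)) muln1 addn0 /md upd_neq; last lia.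
  by rewrite -(reprA repc j (isT : 11 < 2 ^ 4)) !addnA.
have eA x : me (64 + x) = ar u' 0 x.
  by have := reprA repe x (isT : 0 < 2 ^ 0); rewrite muln1 addn0.
exists pc, o, (ar t' aI); split=> //.
- have -> : setup_cost * (1 + (n + n) + Q) + (main_cost * (n * Q + Q + n + 1) + (kcost 0 cCopy * (1 + n) + 142)) =
    setup_cost * (1 + (n + n) + Q) + (1 + (main_cost * (n * Q + Q + n + 1) + (1 + (kcost 0 cCopy * (1 + n) + 140)))).
    by lia.
  apply: reach_trans (reach_le T1 ra) _; apply: (reach_trans rb).
  apply: reach_trans (reach_le T2 rc) _; apply: (reach_trans rd).
  exact: reach_trans (reach_le T3 re) ro.
- by rewrite o0 eC.
rewrite o0 => /oI[lo hi] i lti; case: (leqP 63 i) => li.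
  rewrite hi; last lia.
  have -> : i.+1 = 64 + (i - 63) by lia.
  rewrite eA C1; last lia.
  by rewrite uA; congr (ar t' _); lia.
rewrite lo; last lia.
have -> : FB + 1067 - 16 * (63 - i.+1) = 64 + (FB + i * 16 + 11) by lia.
by rewrite eA C2 ?uA //; lia.
Qed.
End Run.

(** * Freeing registers at the start *)

(* No cell is free at first. But the addresses of the adjacency lists are determined by the
   degrees, so the last of them, in cell [2n], makes room for cell 1. With fewer than 64 vertices
   the whole memory is then moved up by 64 cells, otherwise the weights in cells 2 to 63 also
   replace list addresses. *)
Definition boot_start (zero large : nat) : seq instr :=
  [:: IJz 0 zero; IAdd 0 0 0; IStore 0 1; IConst 1 128; ISub 1 1 0; IJz 1 large; ILoad 1 0].
(** Cell 64 holds the shifted cell 0, which is twice the number of vertices. *)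
Definition boot_small (main : nat) : seq instr :=
  [:: IConst 0 0; IConst 1 1; IConst 2 64; IAdd (cV vN2) 64 0; IConst (cV vOff) 64; IJz 0 main].
(** Saving has lowered cell 0 by 62, which is added back. *)
Definition boot_large : seq instr :=
  [:: IConst 1 1] ++ save_code 62 ++
  [:: IConst 2 62; IAdd (cV vN2) 0 2; IConst 0 0; IConst 2 64; IConst (cV vOff) 0].

Section Boot.
Variables (n : nat) (w : nat -> nat) (adjn : nat -> seq nat) (I : memory).
Let Q := deg_sum n adjn.
Let cells := flatten [seq adjn u | u <- iota 0 n].
Hypothesis adj_lt : forall u y, u < n -> y \in adjn u -> y < n.
Hypothesis adj_uniq : forall u, uniq (adjn u).
Hypothesis n_gt0 : 0 < n.
Hypothesis I0 : I 0 = n.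
Hypothesis IW : forall i, i < n -> I i.+1 = w i.
Hypothesis ID : forall i, i < n -> I (n + n + (1 + i)) = size (adjn i).
Hypothesis IC : forall j, j < Q -> I (n + n + n + (1 + j)) = nth 0 cells j.
Hypothesis IZ : forall a, n + n + n + (1 + Q) <= a -> I a = 0.

Variables (p : seq instr) (zero large main : nat).
Hypothesis Elarge : large = 7 + small_bound + 6.
Hypothesis Emain : main = large + 130.
Hypothesis code_start : code_at p 0 (boot_start zero large).
Hypothesis code_shift : code_at p 7 (shift_code small_bound).
Hypothesis code_small : code_at p (7 + small_bound) (boot_small main).
Hypothesis code_large : code_at p large boot_large.

(** Lists without repetition give [Q <= n * n], and 3 * 63 + 1 + 63 * 63 = 4159 is just below 65 *
    64. *)
Lemma deg_sum_small : n < 64 -> n + n + n + (1 + Q) <= small_bound.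
Proof.
move=> ltn; have leQ : Q <= n * n.
  rewrite /Q /deg_sum -[X in _ <= X * _]card_ord -sum_nat_const; apply: leq_sum => u _.
  rewrite -[X in _ <= X](size_iota 0); apply: uniq_leq_size => // y /adj_lt.
  by rewrite mem_iota; apply.
by apply: leq_trans (_ : n + n + n + (1 + 63 * 63) <= _); [nia|rewrite /small_bound; lia].
Qed.

Let m2 := upd (upd I 0 (n + n)) (n + n) (I 1).

Lemma bootP : exists off m,
  [/\ reach p (small_bound + 140) (0, I) (main, m),
      [/\ m 0 = 0, m 1 = 1, m 2 = 64, m (cV vN2) = n + n & m (cV vOff) = off] &
      let raw e := m (64 + (e + off - 64)) in
      [/\ forall i, i < n -> w i = if off + (i - 62) == 0 then raw (n + n - i) else raw (i + 1),
          forall i, i < n -> raw (n + n + (1 + i)) = size (adjn i),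
          forall j, j < Q -> raw (n + n + n + (1 + j)) = nth 0 cells j &
          forall a, n + (n + n) + (1 + Q + off) <= a -> m (64 + a) = 0]].
Proof.
case: code_start => [S0 [S1 [S2 [S3 [S4 [S5 [S6 _]]]]]]].
have m20 : m2 0 = n + n by rewrite /m2 upd_neq ?upd_eq //; lia.
have m2n : m2 (n + n) = I 1 by rewrite /m2 upd_eq.
have m2E c : c != 0 -> c != n + n -> m2 c = I c by move=> *; rewrite /m2 !upd_neq.
have n2 : n + n != 1 by lia.
pose m4 := upd (upd m2 1 128) 1 (128 - (n + n)).
have start T c : reach p T (5, m4) c -> reach p (5 + T) (0, I) c.
  move=> r; rewrite addnC !addnS addn0.
  apply: (reach_jz S0); rewrite I0 (gtn_eqF n_gt0); apply: (reach_add S1).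
  rewrite I0; apply: (reach_store S2); rewrite upd_eq upd_neq //.
  apply: (reach_const S3); apply: (reach_sub S4).
  by rewrite upd_eq [upd _ 1 128 0]upd_neq // -/m2 m20.
have m40 : m4 0 = n + n by rewrite /m4 !upd_neq.
have m41 : m4 1 = 128 - (n + n) by rewrite /m4 upd_eq.
(* The truncated difference [128 - (n + n)] in cell 1 is 0 exactly in the second case. *)
case: (ltnP n 64) => [lt|ge].
  pose m5 := upd m4 1 (I 1).
  have m5E c : c != 0 -> c != n + n -> m5 c = I c.
    move=> c0 cn; rewrite /m5 /upd; case: (c =P 1) => [->//|/eqP c1].
    by rewrite /m4 !upd_neq // m2E.
  have bnd := deg_sum_small lt.
  have z5 : m5 (small_bound + 64) = 0 by rewrite m5E; [rewrite IZ //; lia|lia|lia].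
  have [m6 [r6 E6]] := shift_codeP code_shift z5 (leqnn _).
  have Z6 e : e < small_bound -> m6 (64 + e) = m5 e.
    by move=> lte; rewrite E6 addKn; case: ifP => //; lia.
  case: code_small => [T0 [T1 [T2 [T3 [T4 [T5 _]]]]]].
  pose m7 := upd (upd (upd m6 0 0) 1 1) 2 64.
  pose m := upd (upd m7 (cV vN2) (n + n)) (cV vOff) 64.
  have mE c : 64 <= c -> m c = m6 c.
    by move=> lec; rewrite /m /m7 !upd_neq //; rewrite /cV; lia.
  have raw e : e <= n + n + n + Q -> e != 0 -> e != n + n -> m (64 + (e + 64 - 64)) = I e.
    by move=> lee e0 en; rewrite addnK mE ?leq_addr // Z6 ?m5E //; lia.
  exists 64, m; split.
  - apply: (@reach_le p (5 + (2 + (small_bound + 6)))); first lia.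
    apply: start; apply: (reach_jz S5).
    have -> : m4 1 == 0 = false by rewrite m41; lia.
    apply: (reach_load S6).
    have -> : m4 (m4 0) = I 1 by rewrite m40 /m4 !upd_neq.
    apply: (reach_trans r6); apply: (reach_const T0); apply: (reach_const T1); apply: (reach_const T2).
    apply: (reach_add T3).
    have -> : upd (upd (upd m6 0 0) 1 1) 2 64 64 + upd (upd (upd m6 0 0) 1 1) 2 64 0 = n + n.
      rewrite /upd /= addn0 -[64]addn0 Z6; first by rewrite /m5 upd_neq.
      by rewrite /small_bound; lia.
    apply: (reach_const T4); apply: (reach_jz T5); exact: reach_refl.
  - by split; rewrite /m /m7; do ?[rewrite upd_eq //|rewrite upd_neq //].
  - split=> [i lti|i lti|j ltj|a lea].
    + by rewrite addSn /= raw ?addn1 ?IW //; lia.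
    + by rewrite raw ?ID //; lia.
    + by rewrite raw ?IC //; lia.
    + rewrite mE ?leq_addr //; case: (ltnP a small_bound) => lta.
        by rewrite Z6 // m5E ?IZ //; lia.
      rewrite E6; have -> : 64 <= 64 + a < small_bound + 64 = false by lia.
      by rewrite m5E ?IZ //; lia.
have {}large0 : m4 1 == 0 by rewrite m41; lia.
case/code_at_cat: code_large => -[T0 _]; rewrite addn1 => /code_at_cat[T1].
rewrite size_save_code => -[T2 [T3 [T4 [T5 [T6 _]]]]].
pose m5 := upd m4 1 1.
have m51 : m5 1 = 1 by rewrite /m5 upd_eq.
have m50 : m5 0 = n + n by rewrite /m5 upd_neq.
have [|m6 [r6 E0 E6]] := save_codeP T1 m51 m50 _ isT; first lia.
pose m7 := upd (upd (upd m6 2 62) (cV vN2) (n + n)) 0 0.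
pose m := upd (upd m7 2 64) (cV vOff) 0.
have mE c : 64 <= c -> m c = m6 c.
  by move=> lec; rewrite /m /m7 !upd_neq //; rewrite /cV; lia.
(* The weights of cells 1 to 63 now lie in cells [n + n] down to [n + n - 62], all of them former
   list addresses because [n >= 64]. *)
have saved e : n + n - 62 <= e <= n + n -> m (64 + (e + 0 - 64)) = I (n + n - e).+1.
  move=> lte; have -> : 64 + (e + 0 - 64) = e by lia.
  rewrite mE ?E6; try lia.
  case: (e =P n + n) => [->|ne].
    have -> : n + n - 62 <= n + n < n + n = false by lia.
    by rewrite subnn /m5 /m4 !upd_neq //; lia.
  have -> : n + n - 62 <= e < n + n by lia.
  by rewrite /m5 /m4 !upd_neq ?m2E //; lia.
have raw e : 64 <= e -> (e < n + n - 62) || (n + n < e) -> m (64 + (e + 0 - 64)) = I e.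
  move=> le64 lte; have -> : 64 + (e + 0 - 64) = e by lia.
  rewrite mE ?E6; try lia.
  have -> : n + n - 62 <= e < n + n = false by lia.
  by rewrite /m5 /m4 !upd_neq ?m2E //; lia.
exists 0, m; split.
- apply: (@reach_le p (5 + (1 + (1 + (62 * 2 + 5))))); first lia.
  apply: start; apply: (reach_jz S5); rewrite large0; apply: (reach_const T0).
  apply: (reach_trans r6); apply: (reach_const T2); apply: (reach_add T3).
  have -> : upd m6 2 62 0 + upd m6 2 62 2 = n + n by rewrite upd_neq // upd_eq E0; lia.
  apply: (reach_const T4); apply: (reach_const T5); apply: (reach_const T6).
  have -> : (large.+1 + 62 * 2).+4.+1 = main by rewrite Emain; lia.
  exact: reach_refl.
- have m61 : m6 1 = 1 by rewrite E6 //; case: ifP => //; lia.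
  by split; rewrite /m /m7; do ?[rewrite upd_eq //|rewrite upd_neq //].
split=> [i lti|i lti|j ltj|a lea].
- rewrite add0n; case: eqP => li.
    by rewrite saved -?IW //; [congr I|]; lia.
  by rewrite raw ?addn1 ?IW //; lia.
- by rewrite raw ?ID //; lia.
- by rewrite raw ?IC //; lia.
- have -> : 64 + a = 64 + (64 + a + 0 - 64) by lia.
  by rewrite raw ?IZ //; lia.
Qed.
End Boot.

(** * Graphs on ordinals *)

Section Ordinals.
Variables (n : nat) (e : rel 'I_n) (w : 'I_n -> nat) (adj : 'I_n -> seq 'I_n).
Hypotheses (simple : simple_graph e) (adjP : adj_list_of e adj).

(** Numbers out of range get the empty list, so irreflexivity and uniqueness hold for all [u]. *)
Definition adjn (u : nat) : seq nat := oapp (fun i => map val (adj i)) [::] (vopt n u).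
Definition wn (u : nat) : nat := oapp w 0 (vopt n u).
Definition cid (u : nat) : nat := oapp (fun i => val (fingraph.root e i)) 0 (vopt n u).

Lemma adjnE (i : 'I_n) : adjn i = map val (adj i).
Proof. by rewrite /adjn /vopt valK. Qed.

Lemma wnE (i : 'I_n) : wn i = w i. Proof. by rewrite /wn /vopt valK. Qed.

Lemma mem_adjn (i j : 'I_n) : (val j \in adjn i) = e i j.
Proof. by rewrite adjnE mem_map ?(adjP i).2 //; apply: val_inj. Qed.

Lemma adjn_ord u y : y \in adjn u -> exists i j : 'I_n, [/\ u = i, y = j & e i j].
Proof.
rewrite /adjn /vopt; case: insubP => //= i _ <- /mapP[j ji ->].
by exists i, j; split=> //; rewrite -(adjP i).2.
Qed.

Lemma adjn_lt u y : u < n -> y \in adjn u -> y < n.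
Proof. by move=> _ /adjn_ord[i [j [_ -> _]]]. Qed.

Lemma adjn_sym u y : u < n -> y \in adjn u -> u \in adjn y.
Proof. by move=> _ /adjn_ord[i [j [-> -> eij]]]; rewrite mem_adjn simple.1. Qed.

Lemma adjn_irr u : u \notin adjn u.
Proof.
by apply/negP => /adjn_ord[i [j [-> /val_inj <-]]]; rewrite simple.2.
Qed.

Lemma adjn_uniq u : uniq (adjn u).
Proof.
rewrite /adjn; case: (vopt n u) => //= i; rewrite map_inj_uniq; last exact: val_inj.
exact: (adjP i).1.
Qed.

Lemma cid_adj u y : u < n -> y \in adjn u -> cid y = cid u.
Proof.
move=> _ /adjn_ord[i [j [-> -> eij]]]; rewrite /cid /vopt !valK /=; congr val.
apply/eqP; rewrite root_connect; last exact: (sym_connect_sym simple.1).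
by apply: connect1; rewrite simple.1.
Qed.

Lemma cid_min (X : nat -> Prop) u y : u < n -> y < n ->
  (forall x z, x < n -> z \in adjn x -> X x -> X z) -> X u -> cid y = cid u -> X y.
Proof.
move=> ltu lty closed; rewrite -[u]/(val (Ordinal ltu)) -[y]/(val (Ordinal lty)).
move: (Ordinal ltu) (Ordinal lty) => i j Xi.
rewrite /cid /vopt !valK /= => /val_inj/eqP.
rewrite eq_sym root_connect; last exact: (sym_connect_sym simple.1).
case/connectP=> s; elim: s i Xi => [|k s IH] i Xi /=; first by move=> _ ->.
case/andP=> eik; apply: IH; apply: (closed i) => //.
by rewrite mem_adjn.
Qed.

Lemma path5_not_P5_free : path5 n adjn -> ~ P5_free e.
Proof.
case=> a [b [c [d [f [[la lb lc ld lf] [ab bc cd df] [ac ad af] [bd bf cf]]]]]] free.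
move: ab bc cd df ac ad af bd bf cf.
rewrite -[a]/(val (Ordinal la)) -[b]/(val (Ordinal lb)) -[c]/(val (Ordinal lc)).
rewrite -[d]/(val (Ordinal ld)) -[f]/(val (Ordinal lf)) !mem_adjn.
move: (Ordinal la) (Ordinal lb) (Ordinal lc) (Ordinal ld) (Ordinal lf).
move=> {la lb lc ld lf}{}a {}b {}c {}d {}f ab bc cd df.
move=> /negbTE ac /negbTE ad /negbTE af /negbTE bd /negbTE bf /negbTE cf.
pose g (i : 'I_5) := nth a [:: a; b; c; d; f] i.
have sy := simple.1; have ir := simple.2.
have adjg (i j : 'I_5) : e (g i) (g j) = ((i.+1 == j :> nat) || (j.+1 == i :> nat)).
  case: i j => [[|[|[|[|[|i]]]]] // Hi] [[|[|[|[|[|j]]]]] // Hj]; rewrite /g /= ?ir //;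
    by [rewrite ?ab ?bc ?cd ?df ?ac ?ad ?af ?bd ?bf ?cf
       |rewrite sy ?ab ?bc ?cd ?df ?ac ?ad ?af ?bd ?bf ?cf].
apply: (free g); split=> // i j E.
(* Injectivity follows from adjacency: no two vertices of a path on five vertices have the same
   neighbours. *)
have row k : ((i.+1 == k) || (k.+1 == i)) = ((j.+1 == k :> nat) || (k.+1 == j)) \/ 5 <= k.
  case: (ltnP k 5) => [ltk|]; [left|by right].
  by have := adjg i (Ordinal ltk); rewrite E adjg.
apply: val_inj; case: (row 0) (row 1) (row 2) (row 3) (row 4) => // r0 [|//] r1 [|//] r2 [|//] r3 [|//] r4.
clear E row; case: i j r0 r1 r2 r3 r4 => [[|[|[|[|[|i]]]]] // Hi] [[|[|[|[|[|j]]]]] // Hj] //.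
Qed.

Lemma dominated_onceE (D : {set 'I_n}) (X : pred nat) (u : 'I_n) :
  (forall i : 'I_n, X i = (i \in D)) ->
  dominated_once adjn X u = (#|[set v in D | dominates e v u]| == 1).
Proof.
move=> XD; rewrite /dominated_once adjnE -[_ :: _]/(map val (u :: adj u)) count_map.
congr (_ == 1); rewrite (eq_count (a2 := mem D)) // -size_filter cardE.
apply: perm_size; apply: uniq_perm.
- rewrite filter_uniq //= (adjP u).1 andbT (adjP u).2 simple.2 //.
- exact: enum_uniq.
move=> v; rewrite mem_filter mem_enum !inE (adjP u).2 /dominates simple.1; congr (_ && _).
Qed.

Lemma eff_domE (D : {set 'I_n}) (X : pred nat) :
  (forall i : 'I_n, X i = (i \in D)) -> eff_dom n adjn X <-> efficient_dominating e D.
Proof.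
move=> XD; split=> [H u|H u ltu]; first by apply/eqP; rewrite -(dominated_onceE u XD) H.
by rewrite -[u]/(val (Ordinal ltu)) (dominated_onceE _ XD) H.
Qed.

Lemma weightE (D : {set 'I_n}) (X : pred nat) : (forall i : 'I_n, X i = (i \in D)) ->
  \sum_(x <- iota 0 n | X x) wn x = set_weight w D.
Proof.
move=> XD; rewrite -[n in iota 0 n]subn0 -[iota _ _]/(index_iota 0 n) big_mkord.
by apply: eq_big => [i|i _]; [apply: XD|apply: wnE].
Qed.

Definition set_pred (D : {set 'I_n}) (x : nat) : bool := oapp (fun i => i \in D) false (vopt n x).

Lemma set_predE (D : {set 'I_n}) (i : 'I_n) : set_pred D i = (i \in D).
Proof. by rewrite /set_pred /vopt valK. Qed.

(** Half of the handshake lemma: an ordered edge is increasing or the swap of an increasing one. *)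
Lemma deg_sum_edges : deg_sum n adjn <= num_edges e * 2.
Proof.
have -> : deg_sum n adjn = \sum_(i < n) #|[set j | e i j]|.
  apply: eq_bigr => i _; rewrite adjnE size_map cardE; apply: perm_size; apply: uniq_perm.
  - exact: (adjP i).1.
  - exact: enum_uniq.
  by move=> j; rewrite mem_enum inE (adjP i).2.
have -> : \sum_(i < n) #|[set j | e i j]| = #|[set q : 'I_n * 'I_n | e q.1 q.2]|.
  rewrite -sum1_card (eq_bigl (fun q => true && e q.1 q.2)) => [|q]; last by rewrite inE.
  rewrite -(pair_big_dep predT (fun i j => e i j) (fun _ _ => 1)) /=.
  by apply: eq_bigr => i _; rewrite -sum1_card; apply: eq_bigl => j; rewrite inE.
set A := [set q : 'I_n * 'I_n | (q.1 < q.2) && e q.1 q.2].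
pose swap (q : 'I_n * 'I_n) := (q.2, q.1).
have : [set q : 'I_n * 'I_n | e q.1 q.2] \subset A :|: swap @: A.
  apply/subsetP=> -[i j]; rewrite !inE /= => eij; case: (ltngtP i j) => [lt|lt|E].
  - by rewrite eij.
  - by apply/imsetP; exists (j, i); rewrite // inE /= lt simple.1.
  - by move: eij; rewrite (val_inj E) simple.2.
move/subset_leq_card/leq_trans; apply; rewrite muln2 -addnn.
apply: leq_trans (leq_card_setU _ _) _; rewrite leq_add2l; exact: leq_imset_card.
Qed.

Let I := input_mem w adj.

Lemma input_weight i : i < n -> I i.+1 = wn i.
Proof. by move=> lti; rewrite /I /input_mem /= lti. Qed.

Lemma input_degree i : i < n -> I (n + n + (1 + i)) = size (adjn i).
Proof.
move=> lti; rewrite /I /input_mem.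
have -> : n + n + (1 + i) == 0 = false by lia.
have -> : n + n + (1 + i) <= n = false by lia.
have -> : n + n + (1 + i) <= 2 * n = false by lia.
have -> : n + n + (1 + i) <= 3 * n by lia.
have -> : (n + n + (1 + i)).-1 - 2 * n = i by lia.
by rewrite -[i]/(val (Ordinal lti)) adjnE size_map /vopt valK.
Qed.

(** The default of [nth] covers the zero cells behind the input as well. *)
Lemma input_cells a : n + n + n + 1 <= a ->
  I a = nth 0 (flatten [seq adjn u | u <- iota 0 n]) (a - (n + n + n + 1)).
Proof.
move=> lea; rewrite /I /input_mem.
have -> : a == 0 = false by lia.
have -> : a <= n = false by lia.
have -> : a <= 2 * n = false by lia.
have -> : a <= 3 * n = false by lia.
congr nth; last lia.
rewrite /adj_cells -val_enum_ord -map_comp; congr flatten; apply: eq_map => i.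
by rewrite /= adjnE.
Qed.
End Ordinals.

(** * The program *)

Definition q_large : nat := 7 + small_bound + 6.
Definition q_main : nat := q_large + 130.
Definition q_view : nat := q_main + size (ccmd 0 cSetup 0 q_main).
Definition q_unview : nat := q_view.+1 + size (ccmd 4 cMain 0 q_view.+1).
Definition q_out : nat := q_unview.+1 + size (ccmd 0 cCopy 0 q_unview.+1).

(** For [n = 0] the first instruction jumps to [q_out + 131], which writes 2 and halts: the empty
    set solves the empty graph. *)
Definition program : seq instr :=
  boot_start (q_out + 131) q_large ++ shift_code small_bound ++ boot_small q_main ++ boot_large ++
  ccmd 0 cSetup 0 q_main ++ [:: IAdd 2 2 (cV vFB)] ++
  ccmd 4 cMain 0 q_view.+1 ++ [:: IConst 2 64] ++
  ccmd 0 cCopy 0 q_unview.+1 ++ out_code q_out.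

Lemma code_at_self p : code_at p 0 p.
Proof. by have := code_at_mid [::] p [::]; rewrite /= cats0. Qed.

Lemma out_code_end p q : code_at p q (out_code q) ->
  nth IHalt p (q + 131) = IConst 0 2 /\ nth IHalt p (q + 131).+1 = IHalt.
Proof.
case/code_at_cat=> _ /code_at_cat[_ [_ [K1 [K2 _]]]].
rewrite size_load_code in K1 K2.
by have -> : q + 131 = (q + 6 + 62 * 2).+1 by lia.
Qed.

Lemma code_at_program : let p := program in
  [/\ code_at p 0 (boot_start (q_out + 131) q_large) /\ code_at p 7 (shift_code small_bound),
      code_at p (7 + small_bound) (boot_small q_main) /\ code_at p q_large boot_large,
      code_at p q_main (ccmd 0 cSetup 0 q_main) /\ nth IHalt p q_view = IAdd 2 2 (cV vFB),
      code_at p q_view.+1 (ccmd 4 cMain 0 q_view.+1) /\ nth IHalt p q_unview = IConst 2 64 &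
      code_at p q_unview.+1 (ccmd 0 cCopy 0 q_unview.+1) /\ code_at p q_out (out_code q_out)].
Proof.
(* Stated for arbitrary blocks, so that the compiled code is not unfolded. *)
have split10 p c1 c2 c3 c4 c5 c6 c7 c8 c9 c10 :
  code_at p 0 (c1 ++ c2 ++ c3 ++ c4 ++ c5 ++ c6 ++ c7 ++ c8 ++ c9 ++ c10) ->
  let p2 := 0 + size c1 in let p3 := p2 + size c2 in let p4 := p3 + size c3 in
  let p5 := p4 + size c4 in let p6 := p5 + size c5 in let p7 := p6 + size c6 in
  let p8 := p7 + size c7 in let p9 := p8 + size c8 in let p10 := p9 + size c9 in
  [/\ code_at p 0 c1 /\ code_at p p2 c2, code_at p p3 c3 /\ code_at p p4 c4,
      code_at p p5 c5 /\ code_at p p6 c6, code_at p p7 c7 /\ code_at p p8 c8 &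
      code_at p p9 c9 /\ code_at p p10 c10].
  by do 9 move=> /code_at_cat[? ]; move=> ?; split.
have := split10 _ _ _ _ _ _ _ _ _ _ _ (code_at_self program : code_at program 0 _); cbv zeta.
rewrite size_shift_code.
have -> : size (boot_start (q_out + 131) q_large) = 7 by [].
have -> : size (boot_small q_main) = 6 by [].
have -> : size boot_large = 130 by rewrite 2!size_cat size_save_code.
rewrite -/q_large -/q_main -/q_view addn1 -/q_unview addn1 -/q_out.
move=> [H1 H2 [H3 [H4 _]] [H5 [H6 _]] H7].
by split; first [exact: H1|exact: H2|exact: H7|split; [exact: H3|exact: H4]|split; [exact: H5|exact: H6]].
Qed.

Definition time_bound : nat :=
  small_bound + 282 + 4 * setup_cost + 4 * main_cost + kcost 0 cCopy.

(** Positivity of [n] lets [n * M] absorb [M], and with it [Q]. *)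
Lemma time_arith a s m k n Q M : 0 < n -> Q <= M * 2 ->
  a + 140 + (s * (1 + (n + n) + Q) + (m * (n * Q + Q + n + 1) + (k * (1 + n) + 142))) <=
  (a + 282 + 4 * s + 4 * m + k) * (n * M + n + 1).
Proof.
move=> n0 leQ; set X := n * M + n + 1.
have leM : M <= n * M by apply: leq_pmull.
have h1 : 1 + (n + n) + Q <= 4 * X by rewrite /X; lia.
have h2 : n * Q + Q + n + 1 <= 4 * X.
  by have : n * Q <= n * (M * 2) by [rewrite leq_mul2l leQ orbT]; rewrite /X; lia.
have h3 : 1 + n <= X by rewrite /X; lia.
have h4 : 1 <= X by rewrite /X addn1.
have {}h1 : s * (1 + (n + n) + Q) <= 4 * s * X by rewrite (mulnC 4) -mulnA leq_mul.
have {}h2 : m * (n * Q + Q + n + 1) <= 4 * m * X by rewrite (mulnC 4) -mulnA leq_mul.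
have {}h3 : k * (1 + n) <= k * X by rewrite leq_mul.
have h5 : a + 282 <= (a + 282) * X by apply: leq_pmulr.
rewrite (mulnDl _ k) (mulnDl _ (4 * m)) (mulnDl _ (4 * s)); lia.
Qed.

Lemma run_empty I f : I 0 = 0 -> 2 <= f -> run program f (0, I) = Some (upd I 0 2).
Proof.
move=> I0 lef; have [_ _ _ _ [_ /out_code_end[K1 K2]]] := code_at_program.
have [[[B0 _] _] _ _ _ _] := code_at_program.
apply: (@reach_run _ 2 _ ((q_out + 131).+1, upd I 0 2)); [|by rewrite /step K2|exact: lef].
apply: (reach_jz B0); rewrite I0; apply: (reach_const K1); exact: reach_refl.
Qed.

Section Nonempty.
Variables (n : nat) (e : rel 'I_n) (w : 'I_n -> nat) (adj : 'I_n -> seq 'I_n).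
Hypotheses (simple : simple_graph e) (adjP : adj_list_of e adj) (n_gt0 : 0 < n).

Lemma run_nonempty : exists out S,
  [/\ run program (time_bound * (n * num_edges e + n + 1)) (0, input_mem w adj) = Some out,
      outcome n (wn w) (adjn adj) (out 0) S &
      out 0 = 2 -> forall i, i < n -> out i.+1 = S i].
Proof.
pose A := adjn adj; pose Q := deg_sum n A.
have lt u y : u < n -> y \in A u -> y < n by apply: (adjn_lt adjP).
have IZ a : n + n + n + (1 + Q) <= a -> input_mem w adj a = 0.
  move=> lea; rewrite input_cells; last lia.
  by rewrite nth_default // size_cells -[prefix_sum _ n]/Q; lia.
have ID i : i < n -> input_mem w adj (n + n + (1 + i)) = size (A i) by apply: input_degree.
have IW i : i < n -> input_mem w adj i.+1 = wn w i by apply: input_weight.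
have IC j : j < Q -> input_mem w adj (n + n + n + (1 + j)) = nth 0 (flatten [seq A u | u <- iota 0 n]) j.
  by move=> _; rewrite input_cells; [congr nth|]; lia.
have [[b1 b2] [b3 b4] [c1 c2] [c3 c4] [c5 c6]] := code_at_program.
have [off [m [rb [m0 m1 m2 m3 m4] [R1 R2 R3 R4]]]] :=
  bootP lt (adjn_uniq adjP) n_gt0 erefl IW ID IC IZ (erefl q_large) (erefl q_main) b1 b2 b3 b4.
have [pc [out [S [rr halt oc oS]]]] :=
  runP n_gt0 lt (adjn_sym simple adjP) (adjn_irr simple adjP) (adjn_uniq adjP)
    (cid_adj simple adjP) (cid_min simple adjP) c1 c2 c3 c4 c5 c6 m0 m1 m2 m3 m4 R1 R2 R3 R4.
exists out, S; split; [|exact: oc|exact: oS].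
apply: (reach_run (reach_trans rb rr) halt).
rewrite /time_bound; move: setup_cost main_cost (kcost 0 cCopy) small_bound => s mc k a.
exact: time_arith n_gt0 (deg_sum_edges simple adjP).
Qed.
End Nonempty.

Theorem theorem2 :
  exists (prog : seq instr) (c : nat),
    forall (n : nat) (e : rel 'I_n) (w : 'I_n -> nat) (adj : 'I_n -> seq 'I_n),
      simple_graph e -> adj_list_of e adj ->
      exists out : memory,
        run prog (c * (n * num_edges e + n + 1)) (0, input_mem w adj) = Some out /\
        [\/ out 0 = 0 /\ ~ P5_free e,
            out 0 = 1 /\ (forall D : {set 'I_n}, ~ efficient_dominating e D)
          | out 0 = 2 /\ min_weight_ed e w (output_set n out)].
Proof.
exists program, time_bound => n e w adj simple adjP.
case: (posnP n) => n0.
  exists (upd (input_mem w adj) 0 2); split.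
    apply: run_empty; first exact: n0.
    have tb : 2 <= time_bound by rewrite /time_bound; move: (4 * _) (4 * _) (kcost _ _) small_bound; lia.
    by move: time_bound tb => T tb; apply: (leq_trans tb); rewrite leq_pmulr // addn1.
  have no (i : 'I_n) : False by case: i => i; rewrite n0.
  constructor 3; split=> //; split=> [u|D' _]; first by case: (no u).
  by rewrite /set_weight big1 // => i; case: (no i).
have [out [S [runE oc oS]]] := run_nonempty w simple adjP n0.
exists out; split; first exact: runE.
clear runE; case: oc => [[-> p5]|[-> none]|[o2 [edS opt]]].
- by constructor 1; split=> //; apply: path5_not_P5_free p5.
- by constructor 2; split=> // D /(eff_domE simple adjP (set_predE D)); apply: none.
constructor 3; split=> //.
pose X := (fun y => S y != 0) : pred nat.
have SE (i : 'I_n) : X i = (i \in output_set n out) by rewrite inE oS.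
split; first by have [H _] := eff_domE simple adjP SE; apply: H.
move=> D edD; rewrite -(weightE w (X := X) SE) -(weightE w (set_predE D)).
by apply: opt; have [_] := eff_domE simple adjP (set_predE D); apply.
Qed.
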